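(* For any fixed totally real number field $k$ of given degree $d\geq 1$ over $\mathbb{Q}$, there are infinitely many quasi-arithmetic maximal reflection groups $\Gamma<\mathrm{Isom}\,\mathbb{H}^2$ defined over $k$ (that is, with field of definition $k$).
   Context: $\mathbb{H}^n$ is hyperbolic $n$-space in the hyperboloid model: the upper sheet $\{x : \langle x,x\rangle=-1,\ x_0>0\}$ in $\mathbb{R}^{n,1}$, i.e. $\mathbb{R}^{n+1}$ with the Lorentzian product $\langle x,y\rangle=-x_0y_0+x_1y_1+\dots+x_ny_n$; $\mathrm{Isom}\,\mathbb{H}^n\cong \mathrm{O}^+_{n,1}\cong\mathrm{PO}_{n,1}$. A lattice is a discrete subgroup of $\mathrm{Isom}\,\mathbb{H}^n$ of finite covolume. A Coxeter polytope $P\subset\mathbb{H}^n$ is a convex polytope all of whose dihedral angles are of the form $\pi/m$ with $m\ge 2$ an integer. The reflection group $\Gamma(P)$ is the group generated by the reflections in the facets of $P$; it is a lattice when $P$ has finite volume. The Gram matrix of $P$ is $G=G(P)=(\langle e_i,e_j\rangle)_{i,j}$, where the $e_i\in\mathbb{R}^{n,1}$ are the unit outer normals to the facets of $P$. Let $K=K(G)$ be the field generated over $\mathbb{Q}$ by the entries of $G$, and $k(G)$ the field generated over $\mathbb{Q}$ by all cyclic products $g_{i_1i_2}g_{i_2i_3}\cdots g_{i_si_1}$ of entries of $G$. For a finite-volume Coxeter polytope $P$, the lattice $\Gamma(P)$ is called quasi-arithmetic if (a) $K$ is a totally real number field, and (b) for every embedding $\sigma:K\to\mathbb{R}$ with $\sigma|_{k(G)}\neq\mathrm{id}$,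 the matrix $G^\sigma$ obtained by applying $\sigma$ to each entry of $G$ is positive semi-definite. The field of definition of a lattice $\Gamma$ is the smallest field containing the traces of the adjoint representation $\mathrm{Ad}\,\Gamma$; for a quasi-arithmetic reflection group $\Gamma(P)$ it equals $k(G)$. A reflection group $\Gamma<\mathrm{Isom}\,\mathbb{H}^2$ is a maximal reflection group if, for any subgroup $\Gamma'<\mathrm{Isom}\,\mathbb{H}^2$ generated by reflections, $\Gamma$ is contained in $\Gamma'$ with finite index if and only if $\Gamma'=\Gamma$. *)

(* Defs.v *)
From HB Require Import structures.
From mathcomp Require Import all_boot all_order all_algebra all_field.
From mathcomp Require Import complex.
From mathcomp Require Import all_classical all_reals all_analysis.

Set Implicit Arguments.
Unset Strict Implicit.
Unset Printing Implicit Defensive.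

Import Order.TTheory GRing.Theory Num.Theory.

Local Open Scope classical_set_scope.
Local Open Scope ring_scope.

Section LorentzSpace.
Variable R : realType.

Definition lorentz_form : 'M[R]_3 :=
  diag_mx (\row_j if j == ord0 then -1 else 1).

Definition lorentz (x y : 'cV[R]_3) : R :=
  (x^T *m lorentz_form *m y) ord0 ord0.

Lemma lorentzE (x y : 'cV[R]_3) :
  lorentz x y = - (x 0 0 * y 0 0) + x 1 0 * y 1 0 + x 2%:R 0 * y 2%:R 0.
Proof.
rewrite /lorentz /lorentz_form mul_mx_diag !mxE !big_ord_recl big_ord0 !mxE /=.
have -> : lift ord0 ord0 = 1 :> 'I_3 by exact/val_inj.
have -> : lift ord0 (lift ord0 ord0) = 2%:R :> 'I_3 by exact/val_inj.
by rewrite !mulr1 mulrN1 mulNr addr0 addrA.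
Qed.

Definition hyperbolic_plane : set 'cV[R]_3 :=
  [set x | lorentz x x = -1 /\ 0 < x 0 0].

(* Isom H^2, identified with O^+_{2,1}. *)
Definition isom_group : set 'M[R]_3 :=
  [set A | (forall x y, lorentz (A *m x) (A *m y) = lorentz x y) /\
           (forall x, hyperbolic_plane x -> hyperbolic_plane (A *m x))].

(* The chart x |-> (x_1, x_2) is a bijection from H^2 onto R^2; its inverse. *)
Definition chart_inv (p : R * R) : 'cV[R]_3 :=
  \col_(i < 3) nth 0 [:: Num.sqrt (1 + p.1 ^+ 2 + p.2 ^+ 2); p.1; p.2] i.

(* In the coordinates (x_1, x_2) the Riemannian area form of H^2 is
   dx_1 dx_2 / x_0. *)
Definition hyperbolic_area (A : set 'cV[R]_3) : \bar R :=
  (\int[(@lebesgue_measure R \x @lebesgue_measure R)%E]_(p in chart_inv @^-1` A)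
     ((Num.sqrt (1 + p.1 ^+ 2 + p.2 ^+ 2))^-1)%:E)%E.

End LorentzSpace.

Section SubgroupsOfIsom.
Variable R : realType.
Implicit Types (H Gam : set 'M[R]_3).

Definition is_subgroup H : Prop :=
  H `<=` @isom_group R /\ divr_closed (mem H).

Definition generated_subgroup (S : set 'M[R]_3) : set 'M[R]_3 :=
  smallest is_subgroup S.

(* The reflection in the line of H^2 orthogonal to e, when <e, e> = 1. *)
Definition reflection (e : 'cV[R]_3) : 'M[R]_3 :=
  1%:M - 2%:R *: (e *m (e^T *m lorentz_form R)).

Lemma reflectionE (e x : 'cV[R]_3) :
  reflection e *m x = x - (2%:R * lorentz e x) *: e.
Proof.
rewrite /reflection mulmxBl mul1mx -scalemxAl -mulmxA -scalerA; congr (_ - _ *: _).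
rewrite [_ *m x]mx11_scalar -/(lorentz e x).
by apply/matrixP => i j; rewrite !mxE big_ord1 !mxE !ord1 eqxx mulr1n mulrC.
Qed.

Definition reflections : set 'M[R]_3 :=
  [set A | exists2 e, lorentz e e = 1 & A = reflection e].

Definition reflection_group Gam : Prop :=
  exists2 S : set 'M[R]_3, S `<=` reflections & Gam = generated_subgroup S.

Definition finite_index_in Gam H : Prop :=
  Gam `<=` H /\ finite_set [set [set g * h | h in Gam] | g in H].

Definition maximal_reflection_group Gam : Prop :=
  reflection_group Gam /\
  forall Gam', reflection_group Gam' ->
    (finite_index_in Gam Gam' <-> Gam' = Gam).

Definition conjugacy_class Gam : set (set 'M[R]_3) :=
  [set [set g * h * g^-1 | h in Gam] | g in @isom_group R].

End SubgroupsOfIsom.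

Section FieldOfDefinition.
Variable R : realType.

Definition generated_subfield (S : set R) : set R :=
  smallest (fun F : set R => divring_closed (mem F)) S.

Definition so_map (X : 'M[R]_3) : 'M[R]_3 :=
  X^T *m lorentz_form R + lorentz_form R *m X.

Fact so_map_is_linear : linear so_map.
Proof.
by move=> a X Y; rewrite /so_map linearP mulmxDl mulmxDr -scalemxAl -scalemxAr
  scalerDr addrACA.
Qed.
HB.instance Definition _ :=
  GRing.isLinear.Build R 'M[R]_3 'M[R]_3 _ so_map so_map_is_linear.

(* The Lie algebra so_{2,1} of Isom H^2. *)
Definition so_algebra : {vspace 'M[R]_3} := lker (linfun so_map).

Lemma mem_so_algebra (X : 'M[R]_3) :
  (X \in so_algebra) = (X^T *m lorentz_form R + lorentz_form R *m X == 0).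
Proof. by rewrite memv_ker lfunE. Qed.

Definition Ad (g X : 'M[R]_3) : 'M[R]_3 := g * X * g^-1.

(* Trace of Ad g on so_{2,1}, computed in a basis. *)
Definition trace_Ad (g : 'M[R]_3) : R :=
  \sum_(i < \dim so_algebra)
    coord (vbasis so_algebra) i (Ad g (vbasis so_algebra)`_i).

Definition field_of_definition (Gam : set 'M[R]_3) : set R :=
  generated_subfield [set trace_Ad g | g in Gam].

(* Finite extensions of rat are exactly the number fields. *)
Definition totally_real (L : fieldExtType rat) : Prop :=
  forall (f : {rmorphism L -> R[i]}) (x : L), complex.Im (f x) = 0.

End FieldOfDefinition.

Section CoxeterPolygons.
Variables (R : realType) (N : nat) (e : 'I_N -> 'cV[R]_3).

Definition polygon : set 'cV[R]_3 :=
  [set x | hyperbolic_plane x /\ forall i, lorentz x (e i) <= 0].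

Definition side (i : 'I_N) : set 'cV[R]_3 :=
  polygon `&` [set x | lorentz x (e i) = 0].

(* The e i are exactly the unit outer normals, without repetition, to the sides
   of a convex polygon with nonempty interior: each line e_i^\perp contains a
   point of the polygon lying on none of the other lines. *)
Definition is_convex_polygon : Prop :=
  [/\ forall i, lorentz (e i) (e i) = 1,
      exists2 x, hyperbolic_plane x & forall i, lorentz x (e i) < 0 &
      forall i, exists2 x, side i x & forall j, j != i -> lorentz x (e j) < 0].

Definition dihedral_angle (i j : 'I_N) : R := acos (- lorentz (e i) (e j)).

Definition is_coxeter_polygon : Prop :=
  is_convex_polygon /\
  forall i j, i != j -> side i `&` side j !=set0 ->
    exists2 m : nat, (2 <= m)%N & dihedral_angle i j = pi / m%:R.

Definition polygon_group : set 'M[R]_3 :=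
  generated_subgroup [set reflection (e i) | i in [set: 'I_N]].

Definition gram : 'M[R]_N := \matrix_(i, j) lorentz (e i) (e j).

Definition gram_field : set R :=
  generated_subfield [set x | exists i j, x = gram i j].

(* g_{c_1 c_2} g_{c_2 c_3} ... g_{c_s c_1}; ordS is the cyclic successor. *)
Definition cyclic_product (s : nat) (c : 'I_s -> 'I_N) : R :=
  \prod_(j < s) gram (c j) (c (ordS j)).

Definition cyclic_field : set R :=
  generated_subfield [set x | exists s (c : 'I_s -> 'I_N), x = cyclic_product c].

Definition pos_semidef (A : 'M[R]_N) : Prop :=
  forall v : 'cV[R]_N, 0 <= (v^T *m A *m v) ord0 ord0.

(* K = gram_field is presented as the image of an abstract number field L under
   an embedding iota; A is then the Gram matrix with entries in L, and the
   embeddings of K into R are the morphisms L -> R. *)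
Definition quasi_arithmetic_polygon : Prop :=
  exists (L : fieldExtType rat) (iota : {rmorphism L -> R}) (A : 'M[L]_N),
    [/\ gram_field = range iota,
        gram = map_mx iota A,
        totally_real R L &
        forall sigma : {rmorphism L -> R},
          ~ (forall x, cyclic_field (iota x) -> sigma x = iota x) ->
          pos_semidef (map_mx sigma A)].

End CoxeterPolygons.

Definition quasi_arithmetic_reflection_group (R : realType)
    (Gam : set 'M[R]_3) : Prop :=
  exists (N : nat) (e : 'I_N -> 'cV[R]_3),
    [/\ is_coxeter_polygon e,
        (hyperbolic_area (polygon e) < +oo)%E,
        Gam = polygon_group e &
        quasi_arithmetic_polygon e].

(* Main.v *)
(* The groups are generated by the reflections in the sides of the quadrilaterals with
   angles pi/2, pi/3, pi/2, pi/3. They form a one-parameter family: if x and y are the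
   hyperbolic cosines of the distances between opposite sides, (x - 1)(y - 1) = 1/4.
   Let x = iota lx with 1 < x < 3/2. The Gram matrix has entries in k, it is generated by
   lx, and its conjugate under sigma is positive semidefinite as soon as
   sigma(lx)^2 <= 3/4. The group is thus quasi-arithmetic, and its field of definition,
   computed from Ad (r_a r_c), is k if lx^2 generates k.

   Maximality. Let Gam' be a reflection group containing Gam = Gam(x) with finite index.
   A suitable power of any conjugate in Gam' of the translation r_a r_c lies in Gam; hence
   every mirror f of Gam' has products <f, g><f, h> in k with the normals of the
   quadrilateral P. Two crossing mirrors cross at an angle with cosine in a set F which is
   finite and independent of x: the squared cosine lies in k and comes from a root of unity
   of degree at most 2d over the rationals. If f crosses two adjacent sides of P without
   passing through their vertex, then xi (x^2 - 3/4) is a nonzero square in k for one of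
   finitely many xi given by F, so it suffices to choose x with x^2 - 3/4 outside finitely
   many square classes; crossing two opposite sides forces x or y into a finite set. For
   the remaining x no mirror of Gam' meets the interior of P, so all mirrors are translates
   of the sides and Gam' = Gam. The same fact recovers P from Gam, so conjugate groups have
   the same x.

   Choice of x. Choose h generating k with |sigma h| >= 9 h for the other embeddings and put
   x = rho / (2 h) with rho rational near 2 h. Up to squares x^2 - 3/4 is rho^2 - 3 h^2,
   whose norm is the value at rho of a separable rational polynomial; some large prime p
   divides it exactly once at an integer n, and then divides it exactly once for all rho
   which are p-adically close to n. Such a norm is not a square times one of the finitely
   many norms of the xi. *)
From HB Require Import structures.
Require Import Defs.
From mathcomp Require Import all_boot all_order all_algebra all_field.
From mathcomp Require Import complex.
From mathcomp Require Import all_classical all_reals all_analysis.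
From mathcomp Require Import measurable_realfun.
From mathcomp Require Import ring lra zify.
Import Order.TTheory GRing.Theory Num.Theory.
Local Open Scope classical_set_scope.
Local Open Scope ring_scope.
Set Implicit Arguments.
Unset Strict Implicit.
Unset Printing Implicit Defensive.

(** * Arithmetic of the base field *)

(** The number x^2 - 3/4 is minus the Gram determinant of the normals a, b, c, which explains its
    two roles: the sign of its conjugates decides whether a conjugate Gram matrix is semidefinite,
    and its square class decides whether an unwanted mirror can exist. The obstacle is that a mirror
    of a larger group has no reason to have a normal defined over k. Only products of two of its
    coordinates lie in k, so the normal is known up to an unknown square root, and the argument has
    to be about square classes. The finite list of factors depends on k alone and is therefore
    available before x is chosen. The role of discreteness is taken by a torsion bound: an element
    of Gam fixing a point of the plane has order dividing 6, by Tits' positivity of roots together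
    with the covering of the plane by translates of P. The bound x < 3/2 places x below the fixed
    point of the involution x -> y, so that x is recovered from the unordered pair {x, y}. *)

Section Cyclotomic.

(** Each prime power [p ^ e] exactly dividing [n] is at most [2 * (p - 1) * p ^ (e - 1)], twice its
    totient, hence at most [2 * D]. This gives one exponent for all roots of unity of bounded
    degree. *)
Lemma totient_bound_dvd_fact n D : (0 < n)%N -> (totient n <= D)%N -> (n %| (2 * D)`!)%N.
Proof.
move=> n0 hD; apply/(dvdn_partP _ n0) => p hp.
have pr : prime p by move: hp; rewrite mem_primes => /andP[].
have e0 : (0 < logn p n)%N by rewrite logn_gt0.
rewrite p_part; apply: dvdn_fact; rewrite expn_gt0 prime_gt0 //=.
have : (totient (p ^ logn p n) <= totient n)%N.
  rewrite -[X in (_ <= totient X)%N](partnC p n0) p_part totient_coprime.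
    by rewrite -[X in (X <= _)%N]muln1 leq_mul2l totient_gt0 part_gt0 orbT.
  by rewrite -p_part coprime_partC.
rewrite totient_pfactor // => h.
have h2 : (p <= 2 * p.-1)%N by have := prime_gt1 pr; lia.
rewrite -[logn p n]prednK // expnS.
apply: leq_trans (_ : (2 * p.-1 * p ^ (logn p n).-1 <= _)%N).
  by rewrite leq_mul2r h2 orbT.
by rewrite -mulnA leq_mul2l /=; apply: leq_trans hD.
Qed.

(* The cyclotomic polynomials are irreducible over rat; the library states this in algC only. *)
Lemma totient_le_degree (C : closedFieldType) (iC : {rmorphism rat -> C}) n (z : C) (P : {poly rat}) :
  n.-primitive_root z -> P != 0 -> root (map_poly iC P) z -> (totient n < size P)%N.
Proof.
move=> hz P0 Pz; have n0 := prim_order_gt0 hz.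
pose Phi : {poly rat} := map_poly intr 'Phi_n.
have Phi0 : Phi != 0.
  rewrite map_poly_eq0_id0 ?monic_neq0 ?Cyclotomic_monic // intr_eq0 lead_coef_eq0.
  by rewrite monic_neq0 ?Cyclotomic_monic.
have iCZ (q : {poly int}) : map_poly iC (map_poly intr q) = map_poly intr q.
  by rewrite -map_poly_comp; apply: eq_map_poly => i /=; rewrite rmorph_int.
have Phiz : root (map_poly iC Phi) z.
  rewrite iCZ.
  have : root (map_poly intr (\prod_(d <- divisors n) 'Phi_d)) z.
    rewrite prod_Cyclotomic // rmorphB /= map_polyXn rmorph1 /root !hornerE.
    by rewrite prim_expr_order // subrr.
  rewrite rmorph_prod /= => hr.
  have [d hd hdz] : exists2 d, d \in divisors n & root (map_poly intr 'Phi_d) z.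
    elim: (divisors n) hr => [|d s IH]; first by rewrite big_nil (negbTE (root1 _)).
    rewrite big_cons rootM => /orP[h|/IH[d' h1 h2]]; first by exists d; rewrite ?mem_head.
    by exists d' => //; rewrite inE h1 orbT.
  have dn : (d %| n)%N by move: hd; rewrite -dvdn_divisors.
  have d0 : (0 < d)%N by apply: dvdn_gt0 dn.
  suff -> : n = d by [].
  apply/eqP; rewrite eqn_dvd dn andbT (prim_order_dvd hz).
  have : root (map_poly intr (\prod_(d' <- divisors d) 'Phi_d')) z.
    rewrite (big_rem d) /=; last by rewrite -dvdn_divisors.
    by rewrite rmorphM rootM hdz.
  by rewrite prod_Cyclotomic // rmorphB /= map_polyXn rmorph1 /root !hornerE subr_eq0.
(* The gcd is computed over [rat], so it can be inspected in two fields: [z] shows that it is not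
   constant, hence it has a root [w] in [algC], where the minimal polynomial of a primitive [n]-th
   root of unity is known to be cyclotomic. *)
have gz : root (map_poly iC (gcdp Phi P)) z by rewrite gcdp_map root_gcd Phiz Pz.
have g0 : gcdp Phi P != 0 by rewrite gcdp_eq0 (negbTE Phi0).
have gs : size (map_poly (ratr : rat -> algC) (gcdp Phi P)) != 1%N.
  rewrite size_map_poly -(size_map_poly iC); apply: contraTneq gz => h.
  by have /size_poly1P[c c0 ->] : size (map_poly iC (gcdp Phi P)) == 1%N by [rewrite h]; rewrite rootC.
have /closed_rootP[w] := gs; rewrite gcdp_map root_gcd => /andP[Pw1 Pw2].
have [z0 hz0] := C_prim_root_exists n0.
have hw : n.-primitive_root w.
  rewrite -(root_cyclotomic hz0) -(Cintr_Cyclotomic hz0).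
  move: Pw1; rewrite /Phi -map_poly_comp; congr (root _ w); apply: eq_map_poly => i /=.
  by rewrite rmorph_int.
have [q [eq _] hq] := minCpolyP w.
have := hq P; rewrite Pw2 => /esym/(dvdp_leq P0).
by rewrite -(size_map_poly (ratr : {rmorphism rat -> algC})) -eq (minCpoly_cyclotomic hw) size_cyclotomic.
Qed.

(** This is [z ^ deg q * q (z + z^-1)] with denominators cleared; it turns an equation for a trace
    [z + z^-1] into one of twice the degree for [z]. *)
Definition symmetrized (q : {poly rat}) : {poly rat} :=
  \sum_(i < size q) q`_i *: (('X^2 + 1) ^+ i * 'X^((size q).-1 - i)).

(** At 0 only the top term survives, since every other one keeps a factor ['X]; the value is the
    leading coefficient of [q]. *)
Lemma symmetrized_neq0 q : q != 0 -> symmetrized q != 0.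
Proof.
move=> q0; apply/eqP => /(congr1 (fun p => p.[0])); rewrite horner0 /symmetrized.
have s0 : (0 < size q)%N by rewrite size_poly_gt0.
have hl : ((size q).-1 < size q)%N by rewrite prednK.
rewrite horner_sum (bigD1 (Ordinal hl)) //= big1 => [|i hi].
  have X1 : ('X^2 + 1 : {poly rat}).[0] = 1 by rewrite hornerD hornerXn hornerC expr0n add0r.
  rewrite addr0 subnn expr0 mulr1 hornerZ horner_exp X1 expr1n mulr1.
  by apply/eqP; rewrite -lead_coefE lead_coef_eq0.
rewrite hornerZ hornerM hornerXn expr0n subn_eq0.
suff -> : ((size q).-1 <= i)%N = false by rewrite !mulr0.
apply/negbTE; rewrite -ltnNge ltn_neqAle -ltnS prednK // ltn_ord andbT.
by apply: contra hi => /eqP hi; apply/eqP/val_inj.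
Qed.

Lemma size_symmetrized q : (size (symmetrized q) <= 2 * (size q).-1 + 1)%N.
Proof.
apply: leq_trans (size_sum _ _ _) _; apply/bigmax_leqP => i _.
apply: leq_trans (size_scale_leq _ _) _.
apply: leq_trans (size_polyMleq _ _) _.
rewrite size_polyXn.
have h1 : (size (('X^2 + 1 : {poly rat}) ^+ i) <= 2 * i + 1)%N.
  apply: leq_trans (size_poly_exp_leq _ _) _.
  by rewrite -[1]polyC1 size_XnaddC // mulnC addn1.
have hi := ltn_ord i; lia.
Qed.

Lemma symmetrized_root (C : fieldType) (iC : {rmorphism rat -> C}) q (z : C) : z != 0 ->
  root (map_poly iC q) (z + z^-1) -> root (map_poly iC (symmetrized q)) z.
Proof.
move=> z0 /rootP h; apply/rootP.
transitivity (z ^+ (size q).-1 * (map_poly iC q).[z + z^-1]); last by rewrite h mulr0.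
rewrite /symmetrized rmorph_sum /= horner_sum [in RHS]horner_coef mulr_sumr size_map_poly.
apply: eq_bigr => i _.
rewrite linearZ /= hornerZ rmorphM hornerM /= rmorphXn horner_exp rmorphD rmorph1 /= !map_polyXn.
rewrite !hornerE coef_map /=.
have -> : z ^+ 2 + 1 = z * (z + z^-1) by rewrite mulrDr divff // expr2.
have -> : z ^+ (size q).-1 = z ^+ i * z ^+ ((size q).-1 - i).
  rewrite -exprD subnKC // -ltnS prednK ?(leq_ltn_trans _ (ltn_ord i)) //; exact: ltn_ord.
rewrite exprMn; move: (z ^+ i) (z ^+ _) (_ ^+ i) (iC _) => a b c e; ring.
Qed.

End Cyclotomic.

(** * Parity of p-adic valuations *)

Section ValuationParity.
Variable p : nat.

Definition odd_val (a : rat) : bool := odd (logn p `|numq a|) (+) odd (logn p `|denq a|).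

Lemma odd_val_frac (m n : int) : m != 0 -> n != 0 ->
  odd_val (m%:~R / n%:~R) = odd (logn p `|m|) (+) odd (logn p `|n|).
Proof.
move=> m0 n0; set a : rat := _ / _.
have a0 : a != 0 by rewrite mulf_neq0 ?invr_eq0 ?intr_eq0.
have e : (numq a * n = m * denq a)%R.
  apply: (@intr_inj rat); rewrite !intrM numqE -[X in X * _ * _]/(m%:~R / n%:~R) mulrAC divfK //.
  by rewrite intr_eq0.
have := congr1 (fun z : int => odd (logn p `|z|)) e; rewrite /= !abszM !lognM ?absz_gt0 ?numq_eq0 ?denq_eq0 //.
rewrite !oddD /odd_val; by case: (odd _) (odd _) (odd _) (odd _) => [] [] [] [].
Qed.

Lemma odd_valM (a b : rat) : a != 0 -> b != 0 -> odd_val (a * b) = odd_val a (+) odd_val b.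
Proof.
move=> a0 b0; have -> : a * b = (numq a * numq b)%:~R / (denq a * denq b)%:~R.
  by rewrite -{1}[a]divq_num_den -{1}[b]divq_num_den !intrM; field; rewrite !intr_eq0 !denq_eq0.
rewrite odd_val_frac ?mulf_neq0 ?numq_eq0 ?denq_eq0 // !abszM !lognM ?absz_gt0 ?numq_eq0 ?denq_eq0 //.
by rewrite !oddD /odd_val; do 4 case: (odd _).
Qed.

Lemma odd_val_sqr (a : rat) : a != 0 -> odd_val (a ^+ 2) = false.
Proof. by move=> a0; rewrite expr2 odd_valM // addbb. Qed.

End ValuationParity.

Lemma odd_val_small p (a : rat) : a != 0 -> (`|numq a| < p)%N -> (`|denq a| < p)%N -> odd_val p a = false.
Proof.
move=> a0 h1 h2; rewrite /odd_val.
have lz m : (0 < m)%N -> (m < p)%N -> logn p m = 0%N.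
  move=> m0 mp; apply/eqP; rewrite eqn0Ngt logn_gt0 mem_primes m0 /=.
  by apply/negP => /andP[_ /(dvdn_leq m0)]; rewrite leqNgt mp.
by rewrite !lz // absz_gt0 ?numq_eq0 ?denq_eq0.
Qed.

(** * Prime divisors of values of a polynomial *)

Section Hensel.

Lemma taylor2 (A : comNzRingType) (G : {poly A}) (t h : A) :
  exists c, G.[t + h] = G.[t] + h * G^`().[t] + h ^+ 2 * c.
Proof.
elim/poly_ind: G => [|G a [c hc]]; first by exists 0; rewrite deriv0 !horner0; ring.
exists (G^`().[t] + c * (t + h)).
rewrite derivD derivM derivX derivC !hornerE hc; ring.
Qed.

(** Euclid's argument: at a multiple of [G(0) * Q] with [Q] a factorial, the value is [G(0)] times
    an integer [s] congruent to 1 modulo [Q], so every prime factor of [s] is large. If its square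
    divides the value, moving the argument by [p] destroys this, because the Bezout relation keeps
    [p] from dividing the derivative too. *)
Lemma exists_simple_prime_value (G U V : {poly int}) (r : int) (B : nat) :
  (1 < size G)%N -> G`_0 != 0 -> r != 0 -> U * G + V * G^`() = r%:P ->
  exists p n, [/\ prime p, (B < p)%N, (p%:Z %| G.[n])%Z & ~~ (p%:Z ^+ 2 %| G.[n])%Z].
Proof.
move=> sG G0 r0 hUV.
pose Q := (maxn (maxn B `|r|) 2)`!.
pose t (j : nat) : int := G`_0 * Q%:Z * j%:Z.
(* Away from the roots of [H] the value is not [G(0)] up to sign, so the cofactor [s] is not a unit
   and has a prime factor. *)
pose H := (G - (G`_0)%:P) * (G + (G`_0)%:P).
have nc c : G + c%:P != 0.
  have : size (G + c%:P) = size G.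
    rewrite size_polyDl // size_polyC; apply: leq_ltn_trans sG; exact: leq_b1.
  by move=> h; rewrite -size_poly_eq0 h -lt0n; apply: leq_trans sG.
have H0 : H != 0 by rewrite mulf_neq0 ?nc // -polyCN nc.
have Q2 : (2 <= Q)%N by rewrite (leq_trans _ (fact_geq _)) // leq_max orbT.
have [j hj] : exists j : nat, ~~ root H (t j).
  pose rs := [seq t j | j <- iota 1 (size H)].
  have urs : uniq rs.
    have tq0 : G`_0 * Q%:Z != 0.
      by rewrite mulf_neq0 // eqz_nat -lt0n; apply: leq_trans Q2.
    by rewrite map_inj_uniq ?iota_uniq // => i j /(mulfI tq0)[].
  have : ~~ all (root H) rs.
    apply/negP => hall; have := max_poly_roots H0 hall urs.
    by rewrite size_map size_iota ltnn.
  by move=> /allPn[_ /mapP[j _ ->] h]; exists j.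
pose W := (drop_poly 1 G).[t j].
pose s : int := 1 + Q%:Z * j%:Z * W.
have Gt : G.[t j] = G`_0 * s.
  rewrite -{1}[G](poly_take_drop 1) hornerD hornerM hornerXn expr1 -/W.
  have -> : take_poly 1 G = (G`_0)%:P.
    by apply/polyP => i; rewrite coef_take_poly coefC; case: i.
  by rewrite hornerC /s /t; ring.
have s1 : (`|s| != 1)%N.
  apply: contra hj => /eqP hs; rewrite /root /H hornerM hornerD hornerN hornerD !hornerC Gt.
  have : s = 1 \/ s = -1 by lia.
  by case=> ->; rewrite ?mulr1 ?mulrN1 ?subrr ?mul0r // addNr mulr0.
have s0 : s != 0.
  apply/eqP => hs; have : (Q%:Z %| 1)%Z.
    have -> : 1 = - (Q%:Z * (j%:Z * W)) :> int by move: hs; rewrite /s; lia.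
    by rewrite rpredN dvdz_mulr.
  by rewrite dvdz1 /= => /eqP h; move: Q2; rewrite h.
have s2 : (1 < `|s|)%N by rewrite ltn_neqAle eq_sym s1 absz_gt0.
pose p := pdiv `|s|.
have pp : prime p by apply: pdiv_prime.
have ps : (p%:Z %| s)%Z by rewrite dvdzE absz_nat; exact: pdiv_dvd.
have pQ : ~~ (p %| Q)%N.
  apply/negP => h; have : (p%:Z %| 1)%Z.
    have -> : 1 = s - Q%:Z * (j%:Z * W) :> int by rewrite /s; ring.
    by rewrite rpredB // dvdz_mulr.
  by rewrite dvdz1 /= => /eqP h1; move: pp; rewrite h1.
have pbig : (maxn (maxn B `|r|) 2 < p)%N.
  rewrite ltnNge; apply: contra pQ => h; apply: dvdn_fact; by rewrite prime_gt0.
have pB : (B < p)%N by apply: leq_ltn_trans pbig; rewrite !leq_max leqnn.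
have pr : ~~ (p%:Z %| r)%Z.
  apply/negP; rewrite /dvdz /= => /dvdn_leq; rewrite absz_gt0 => /(_ r0).
  by rewrite leqNgt (leq_ltn_trans _ pbig) // !leq_max leqnn orbT.
have pG : (p%:Z %| G.[t j])%Z by rewrite Gt dvdz_mull.
exists p; case: (boolP (p%:Z ^+ 2 %| G.[t j])%Z) => h2; last by exists (t j).
have pG' : ~~ (p%:Z %| G^`().[t j])%Z.
  apply: contra pr => h; have := congr1 (horner^~ (t j)) hUV.
  by rewrite /= hornerD !hornerM hornerC => <-; rewrite rpredD // dvdz_mull.
have [c hc] := taylor2 G (t j) p%:Z.
exists (t j + p%:Z); split=> //.
  rewrite hc; apply: rpredD; first apply: rpredD => //; first exact: dvdz_mulr.
  by rewrite expr2 -mulrA dvdz_mulr.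
rewrite hc; apply: contra pG' => h.
have h3 : (p%:Z ^+ 2 %| p%:Z * G^`().[t j])%Z.
  have -> : p%:Z * G^`().[t j] = (G.[t j] + p%:Z * G^`().[t j] + p%:Z ^+ 2 * c) - G.[t j] - p%:Z ^+ 2 * c by ring.
  by rewrite rpredB ?rpredB // dvdz_mulr.
by move: h3; rewrite expr2 dvdz_mul2l // eqz_nat -lt0n prime_gt0.
Qed.

(** Homogenizing [G] with the denominator [E] gives an integer congruent to [E ^ D * G(n)] modulo
    [p ^ 2]. As [p] is prime to [E], it divides this integer exactly once. *)
Lemma odd_val_value (G : {poly int}) (p : nat) (n u : int) (E : nat) :
  prime p -> (p%:Z %| G.[n])%Z -> ~~ (p%:Z ^+ 2 %| G.[n])%Z -> coprime p E -> (0 < E)%N ->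
  let x : rat := n%:~R + (p%:Z ^+ 2 * u)%:~R / E%:R in
  (map_poly intr G).[x] != 0 /\ odd_val p (map_poly intr G).[x].
Proof.
move=> pp h1 h2 cE E0 x.
pose m : int := n * E%:Z + p%:Z ^+ 2 * u.
pose D := (size G).-1.
pose hom (m : int) : int := \sum_(i < size G) G`_i * m ^+ i * E%:Z ^+ (D - i).
have EQ : (E%:R : rat) != 0 by rewrite pnatr_eq0 -lt0n.
have xE : x = m%:~R / E%:R by rewrite /x /m intrD intrM; field.
have iD (i : 'I_(size G)) : (i <= D)%N by rewrite /D -ltnS prednK ?(leq_ltn_trans _ (ltn_ord i)) // ltn_ord.
have homE : (map_poly intr G).[x] = (hom m)%:~R / (E%:Z ^+ D)%:~R.
  rewrite horner_coef size_map_poly_id0 ?intr_eq0 ?lead_coef_eq0; last first.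
    by apply: contraNneq h2 => ->; rewrite horner0 dvdz0.
  rewrite /hom rmorph_sum /= mulr_suml; apply: eq_bigr => i _.
  rewrite coef_map /= !rmorphM !rmorphXn /= xE expr_div_n.
  have -> : (E%:~R : rat) ^+ D = E%:R ^+ i * E%:R ^+ (D - i) by rewrite -exprD subnKC.
  by field; rewrite !expf_neq0.
have hom0 : hom (n * E%:Z) = E%:Z ^+ D * G.[n].
  rewrite /hom horner_coef mulr_sumr; apply: eq_bigr => i _.
  by rewrite exprMn -[in RHS](subnKC (iD i)) exprD; ring.
have cong : (p%:Z ^+ 2 %| hom m - hom (n * E%:Z))%Z.
  rewrite /hom -sumrB; apply: rpred_sum => i _.
  rewrite -mulrBl -mulrBr; apply: dvdz_mulr; apply: dvdz_mull.
  rewrite subrXX; apply: dvdz_mulr.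
  by rewrite /m addrAC subrr add0r dvdz_mulr.
have cpE i j : coprimez (p%:Z ^+ i) (E%:Z ^+ j) by apply: coprimezXl; apply: coprimezXr; rewrite coprimezE.
have d1 : (p%:Z %| hom m)%Z.
  rewrite -(subrK (hom (n * E%:Z)) (hom m)) rpredD //; last by rewrite hom0 dvdz_mull.
  by apply: dvdz_trans cong; rewrite expr2 dvdz_mulr.
have d2 : ~~ (p%:Z ^+ 2 %| hom m)%Z.
  apply: contra h2 => h.
  rewrite -(Gauss_dvdzr _ (cpE 2%N D)) -hom0.
  have -> : hom (n * E%:Z) = hom m - (hom m - hom (n * E%:Z)) by ring.
  by rewrite rpredB.
have hm0 : hom m != 0 by apply: contraNneq d2 => ->; rewrite dvdz0.
have ED0 : E%:Z ^+ D != 0 by rewrite expf_neq0 // eqz_nat -lt0n.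
split; first by rewrite homE mulf_neq0 ?invr_eq0 ?intr_eq0.
rewrite homE odd_val_frac //.
have -> : logn p `|hom m| = 1%N.
  move: d1 d2; rewrite /dvdz abszX /= => d1 d2.
  apply/eqP; rewrite eqn_leq; apply/andP; split; last by rewrite -pfactor_dvdn ?absz_gt0 // expn1.
  by rewrite leqNgt -pfactor_dvdn ?absz_gt0.
have -> : logn p `|E%:Z ^+ D| = 0%N.
  by rewrite abszX /= lognX logn_coprime // muln0.
by [].
Qed.

End Hensel.

Lemma bezout_scale (A : comNzRingType) (P Q G1 G2 t x y : A) : t * (P * G2 + Q * G1) = 1 ->
  y * (x * (t * P)) * G2 + x * (y * (t * Q)) * G1 = x * y.
Proof. by move=> h; transitivity (x * y * (t * (P * G2 + Q * G1))); [ring|rewrite h mulr1]. Qed.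

(** * Norms, and parameters whose square class is controlled *)

Section Norm.
Import passmx.
Variable (k : fieldExtType rat).
Implicit Types (a b u : k) (r : rat).

Definition mulmat a := mxof (vbasis {:k}) (vbasis {:k}) (amulr a).

Definition field_norm a : rat := \det (mulmat a).

Lemma mulmatM a b : mulmat (a * b) = mulmat a *m mulmat b.
Proof.
rewrite /mulmat -mxof_comp ?vbasisP //; congr mxof; apply/lfunP => v.
by rewrite comp_lfunE !lfunE /= mulrA.
Qed.

Lemma mulmat_scalar r : mulmat r%:A = r%:M.
Proof.
rewrite /mulmat; have -> : amulr (r%:A : k) = r *: \1%VF.
  by apply/lfunP => v; rewrite !lfunE /= mulr_algr lfunE.
rewrite -scalemx1 -(mxof1 (basis_free (vbasisP {:k}))).
exact: linearZ.
Qed.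

Lemma mulmatB a b : mulmat (a - b) = mulmat a - mulmat b.
Proof. by rewrite /mulmat linearB; exact: linearB. Qed.

Lemma field_normM a b : field_norm (a * b) = field_norm a * field_norm b.
Proof. by rewrite /field_norm mulmatM det_mulmx. Qed.

Lemma field_norm_neq0 a : a != 0 -> field_norm a != 0.
Proof.
move=> a0; have : field_norm a * field_norm a^-1 = 1.
  by rewrite -field_normM divff // -[1](scale1r (1 : k)) /field_norm mulmat_scalar det1.
by move=> h; apply: contra_eq_neq h => ->; rewrite mul0r eq_sym oner_eq0.
Qed.

Lemma horner_char_poly r a : (char_poly (mulmat a)).[r] = field_norm (r%:A - a).
Proof.
rewrite /field_norm mulmatB mulmat_scalar /char_poly -[LHS]/(horner_eval r _) -det_map_mx.
congr (\det _); apply/matrixP => i j; rewrite !mxE /= /horner_eval !hornerE.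
by rewrite hornerMn hornerX.
Qed.

(** The basis of [k], read as a column with entries in [k], is an eigenvector of the multiplication
    matrix with eigenvalue [a]. *)
Lemma char_poly_root a : root (map_poly (GRing.in_alg k) (char_poly (mulmat a))) a.
Proof.
rewrite map_char_poly; set M := map_mx _ _.
pose e : 'cV[k]_(\dim {:k}) := \col_i (vbasis {:k})`_i.
have he : M *m e = a *: e.
  apply/colP => i; rewrite !mxE.
  have hb := coord_vbasis (memvf ((vbasis {:k})`_i * a)).
  rewrite mulrC hb; apply: eq_bigr => j _; rewrite !mxE /= vecof_delta lfunE /=.
  by rewrite mulr_algl.
have eA : map_mx (horner_eval a) (char_poly_mx M) = a%:M - M.
  apply/matrixP => i j; rewrite !mxE /= /horner_eval !hornerE.
  by rewrite hornerMn hornerX.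
rewrite /root /char_poly -[X in X == _]/(horner_eval a _) -det_map_mx eA -det_tr.
apply/det0P; exists e^T.
  have hdim : (0 < \dim {:k})%N by rewrite adim_gt0.
  apply/eqP => /matrixP/(_ 0 (Ordinal hdim)); rewrite !mxE => h0.
  have := basis_not0 (vbasisP {:k}) (mem_nth 0 (_ : (0 < size (vbasis {:k}))%N)).
  by rewrite size_tuple hdim => /(_ isT) /eqP; apply.
by rewrite -trmx_mul mulmxBl he mul_scalar_mx subrr trmx0.
Qed.

Lemma char_poly_minpoly u : <<1; u>>%VS = fullv ->
  map_poly (GRing.in_alg k) (char_poly (mulmat u)) = minPoly 1 u.
Proof.
move=> hu; have mon : map_poly (GRing.in_alg k) (char_poly (mulmat u)) \is monic.
  by rewrite map_monic char_poly_monic.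
have sz : size (minPoly 1 u) = size (map_poly (GRing.in_alg k) (char_poly (mulmat u))).
  rewrite size_minPoly size_map_poly size_char_poly.
  by have := dim_Fadjoin 1 u; rewrite hu dimv1 muln1 => <-.
have dv : minPoly 1 u %| map_poly (GRing.in_alg k) (char_poly (mulmat u)).
  by apply: minPoly_dvdp; [apply/polyOver1P; exists (char_poly (mulmat u))|exact: char_poly_root].
apply/eqP; rewrite eq_sym -eqp_monic ?monic_minPoly //.
by rewrite -dvdp_size_eqp // sz.
Qed.

(** For a generator the characteristic polynomial is the minimal one, hence irreducible; in
    characteristic 0 its derivative is nonzero of smaller degree, so the two share no factor. *)
Lemma char_poly_separable u : <<1; u>>%VS = fullv ->
  coprimep (char_poly (mulmat u)) (char_poly (mulmat u))^`().
Proof.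
move=> hu; set q := char_poly _; set g := gcdp q q^`().
have q0 : q != 0 by rewrite monic_neq0 ?char_poly_monic.
have gq : g %| q by rewrite dvdp_gcdl.
have sq : size q = (\dim {:k}).+1 by rewrite size_char_poly.
have hdim : (0 < \dim {:k})%N by rewrite adim_gt0.
have : (map_poly (GRing.in_alg k) g %= minPoly 1 u) || (map_poly (GRing.in_alg k) g %= 1).
  apply: minPoly_irr; first by apply/polyOver1P; exists g.
  by rewrite -char_poly_minpoly // dvdp_map.
rewrite -char_poly_minpoly // => /orP[].
  rewrite eqp_map => h; have : size g = size q by exact: eqp_size.
  have q'0 : q^`() != 0.
    apply/eqP => h0; have := coef_deriv q (\dim {:k}).-1.
    rewrite h0 coef0 prednK // -mulr_natr => /esym/eqP.
    rewrite mulf_eq0 pnatr_eq0 eqn0Ngt hdim orbF.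
    have -> : q`_(\dim {:k}) = lead_coef q by rewrite lead_coefE sq.
    by rewrite lead_coef_eq0 (negbTE q0).
  have : (size g <= size q^`())%N by apply: dvdp_leq => //; rewrite dvdp_gcdr.
  by have := lt_size_deriv q0; move=> h1 h2 h3; move: (leq_ltn_trans h2 h1); rewrite h3 ltnn.
have -> : (1 : {poly k}) = map_poly (GRing.in_alg k) 1 by rewrite rmorph1.
by rewrite eqp_map /coprimep -/g => /eqp_size ->; rewrite size_poly1.
Qed.

(* Multiplying by xi never makes rho^2 - u a square, since the valuation of its norm at p is odd. *)
Theorem nonsquare_parameter u (Xi : seq k) : <<1; u>>%VS = fullv -> u != 0 -> 0 \notin Xi ->
  exists (p : nat) (n : int), [/\ prime p, (2 < p)%N &
   forall (v : int) (E : nat), coprime p E -> (0 < E)%N ->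
     let rho := n%:~R + (p%:Z ^+ 2 * v)%:~R / E%:R in
     forall xi l, xi \in Xi -> xi * ((rho ^+ 2)%:A - u) != l ^+ 2].
Proof.
(* The value of [g] at [rho] is the norm of [rho ^ 2 - u]. Since [g' = 2 X chi'(X^2)], separability
   of [g] needs that of [chi] and [chi(0) != 0], that is [u != 0]. *)
move=> hu u0 hXi; pose chi := char_poly (mulmat u); pose g := chi \Po 'X^2.
have chi0 : chi.[0] != 0.
  by rewrite horner_char_poly scale0r sub0r field_norm_neq0 // oppr_eq0.
have cg : coprimep g g^`().
  rewrite /g deriv_comp coprimepMr; apply/andP; split.
    by apply: coprimep_comp_poly; exact: char_poly_separable.
  rewrite derivXn /= expr1 -scaler_nat coprimepZr ?pnatr_eq0 // coprimepX /root horner_comp.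
  by rewrite hornerXn expr0n.
have sg : (1 < size g)%N.
  have := size_comp_poly chi 'X^2; rewrite size_polyXn /= size_char_poly /= -/g => h.
  have hdim : (0 < \dim {:k})%N by rewrite adim_gt0.
  by move: h hdim; case: (size g) => [|[|m]] //=; lia.
have [G [a a0 eG]] := rat_poly_scale g.
have aQ : (a%:~R : rat) != 0 by rewrite intr_eq0.
have eGQ : map_poly intr G = a%:~R *: g by rewrite eG scalerA divff // scale1r.
have sG : (1 < size G)%N.
  rewrite -(size_map_inj_poly (@intr_inj rat)) // eGQ size_scale //.
have G0 : G`_0 != 0.
  rewrite -(intr_eq0 rat) -(coef_map (intr : {rmorphism int -> rat})) /= eGQ coefZ mulf_neq0 //.
  by rewrite -horner_coef0 /g horner_comp hornerXn expr0n.
have cG : coprimep (map_poly intr G : {poly rat}) (map_poly intr G)^`().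
  by rewrite eGQ derivZ coprimepZl // coprimepZr.
have [U [V [r [r0 hUV]]]] : exists (U V : {poly int}) (r : int), r != 0 /\ U * G + V * G^`() = r%:P.
  have /Bezout_coprimepP[[P Q] /= hPQ] := cG.
  have /eqpP[[c1 c2] /= /andP[c10 c20] hc] := hPQ.
  have [P1 [b1 b10 eP]] := rat_poly_scale (c2^-1 * c1 *: P).
  have [Q1 [b2 b20 eQ]] := rat_poly_scale (c2^-1 * c1 *: Q).
  exists (b2 *: P1), (b1 *: Q1), (b1 * b2); split; first by rewrite mulf_neq0.
  have inj : injective (map_poly intr : {poly int} -> {poly rat}) by apply: map_inj_poly => //; exact: intr_inj.
  apply: inj; rewrite rmorphD !rmorphM /= !map_polyZ map_polyC /= -deriv_map.
  have b1Q : (b1%:~R : rat) != 0 by rewrite intr_eq0.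
  have b2Q : (b2%:~R : rat) != 0 by rewrite intr_eq0.
  have eP' : map_poly intr P1 = b1%:~R *: (c2^-1 * c1 *: P) by rewrite eP scalerA divff // scale1r.
  have eQ' : map_poly intr Q1 = b2%:~R *: (c2^-1 * c1 *: Q) by rewrite eQ scalerA divff // scale1r.
  have hc' : (c2^-1 * c1)%:P * (P * map_poly intr G + Q * (map_poly intr G)^`()) = 1.
    by rewrite mul_polyC -scalerA hc scalerA mulVf // scale1r.
  rewrite eP' eQ' -!mul_polyC; apply: etrans (bezout_scale _ _ hc') _.
  by rewrite map_polyC.
(* A prime above [B] divides neither the norms of the [xi], nor their denominators, nor the scaling
   factor [a], so that only the value of [g] contributes to the parity. The summand 2 makes [p] odd,
   which later allows powers of 2 as denominators. *)
pose B := (\max_(xi <- Xi) maxn `|numq (field_norm xi)| `|denq (field_norm xi)| + `|a| + 2)%N.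
have [p [n [pp pB pG1 pG2]]] := exists_simple_prime_value B sG G0 r0 hUV.
exists p, n; split=> //; first by apply: leq_ltn_trans pB; rewrite /B leq_addl.
move=> v E cE E0 rho xi l hxi; apply/eqP => h.
have xi0 : xi != 0 by apply: contraNneq hXi => <-.
have [Gr oG] := @odd_val_value G p n v E pp pG1 pG2 cE E0.
rewrite -/rho in Gr oG.
have gr : g.[rho] = (map_poly intr G).[rho] / a%:~R by rewrite eGQ hornerZ mulrC mulrA mulVf ?mul1r.
have gr0 : g.[rho] != 0 by rewrite gr mulf_neq0 // invr_eq0.
have Ng : field_norm ((rho ^+ 2)%:A - u) = g.[rho].
  by rewrite -horner_char_poly /g horner_comp hornerXn.
have hl : field_norm xi * g.[rho] = field_norm l ^+ 2.
  by rewrite -Ng -field_normM h expr2 field_normM -expr2.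
have Nx := field_norm_neq0 xi0.
have Nl : field_norm l != 0.
  by rewrite -sqrf_eq0 -hl mulf_neq0.
have := congr1 (odd_val p) hl; rewrite odd_val_sqr // odd_valM // gr odd_valM ?invr_eq0 // oG.
rewrite odd_val_small //; last first.
- apply: leq_ltn_trans pB; rewrite /B -addnA; apply: leq_trans (leq_addr _ _).
  by apply: leq_trans (leq_bigmax_seq _ hxi _) => //; rewrite leq_maxr.
- apply: leq_ltn_trans pB; rewrite /B -addnA; apply: leq_trans (leq_addr _ _).
  by apply: leq_trans (leq_bigmax_seq _ hxi _) => //; rewrite leq_maxl.
suff -> : odd_val p (a%:~R)^-1 = false by [].
have -> : (a%:~R)^-1 = 1%:~R / a%:~R :> rat by rewrite div1r.
rewrite odd_val_frac //= logn1 /=.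
have -> : logn p `|a| = 0%N; last by [].
apply/eqP; rewrite eqn0Ngt logn_gt0 mem_primes absz_gt0 a0 pp /=.
apply/negP => /dvdn_leq; rewrite absz_gt0 a0 => /(_ isT).
rewrite leqNgt (leq_ltn_trans _ pB) // /B addnAC; exact: leq_addl.
Qed.

End Norm.

(** * Generators of the field and its embeddings *)

Section Generators.
Variable (k : fieldExtType rat).
Implicit Types (x y z w : k).

Lemma field_generator : exists t : k, <<1; t>>%VS = fullv.
Proof.
exists (separable_generator 1 {:k}%AS).
rewrite -eq_adjoin_separable_generator ?sub1v //.
apply/separableP => y _; apply: pcharf0_separable => p.
by rewrite (pchar_lalg k) pchar_num.
Qed.

Lemma rmorph_rat (F : fieldType) (s : {rmorphism k -> F}) (r : rat) : s r%:A = ratr r.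
Proof. exact: (fmorph_eq_rat (s \o GRing.in_alg k)). Qed.

(** One rational polynomial computes all images of [z]. In particular an embedding is determined by
    its value on a generator. *)
Lemma generated_value w z : z \in <<1; w>>%VS -> exists q : {poly rat},
  forall (F : fieldType) (s : {rmorphism k -> F}), s z = (map_poly ratr q).[s w].
Proof.
case/Fadjoin_polyP => p /polyOver1P[q ->] ->; exists q => F s.
rewrite -horner_map -map_poly_comp; congr (_.[_]); apply: eq_map_poly => r /=.
exact: rmorph_rat.
Qed.

(** In characteristic 0 the minimal polynomial over [K] has distinct roots; having only one, it is
    linear. *)
Lemma single_root_mem (C : closedFieldType) (s : {rmorphism k -> C}) (K : {subfield k}) x :
  (forall r, root (map_poly s (minPoly K x)) r -> r = s x) -> x \in K.
Proof.
move=> h; have [rs e] := closed_field_poly_normal (map_poly s (minPoly K x)).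
have hs : separable_element K x.
  by apply: pcharf0_separable => p; rewrite (pchar_lalg k) pchar_num.
have lc : lead_coef (map_poly s (minPoly K x)) = 1 by apply/monicP; rewrite map_monic monic_minPoly.
rewrite lc scale1r in e.
have urs : uniq rs by rewrite -separable_prod_XsubC -e separable_map.
have hrs r : r \in rs -> r = s x by move=> hr; apply: h; rewrite e root_prod_XsubC.
have szrs : (size rs <= 1)%N.
  case: rs urs hrs {e} => [|r1 [|r2 rs]] //= /andP[]; rewrite inE negb_or => /andP[+ _] _ h1.
  by rewrite (h1 r1) ?mem_head // (h1 r2) ?eqxx // !inE eqxx orbT.
have : size (map_poly s (minPoly K x)) = (size rs).+1 by rewrite e size_prod_XsubC.
rewrite size_map_poly size_minPoly => -[h1].
have h2 : (0 < adjoin_degree K x)%N by rewrite /adjoin_degree.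
by rewrite -adjoin_deg_eq1; move: h2 szrs; rewrite h1; case: (size rs) => [|[|]].
Qed.

End Generators.

Section Dominant.
Variables (R : realType) (k : fieldExtType rat) (iota : {rmorphism k -> R}).
Local Notation C := R[i].

Lemma root_separation (rs : seq C) (z : C) : exists2 eta : R, 0 < eta &
  forall r, r \in rs -> r != z -> eta%:C%C <= `|r - z|.
Proof.
elim: rs => [|r rs [eta e0 IH]]; first by exists 1.
have [->|rz] := eqVneq r z.
  exists eta => // r'; rewrite inE => /orP[/eqP ->|hr]; first by rewrite eqxx.
  exact: IH.
have n0 : 0 < `|r - z| by rewrite normr_gt0 subr_eq0.
have eN : (complex.Re `|r - z|)%:C%C = `|r - z| by apply: RRe_real; exact: normr_real.
exists (Num.min eta (complex.Re `|r - z|)).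
  by rewrite lt_min e0 /= -ltcR eN.
move=> r'; rewrite inE => /orP[/eqP ->|hr] hz.
  by rewrite -eN lecR ge_min lexx orbT.
by apply: le_trans (IH _ hr hz); rewrite lecR ge_min lexx.
Qed.

Lemma norm_real_complex (r : R) : `|r%:C%C| = `|r|%:C%C.
Proof.
case: (lerP 0 r) => hr; first by rewrite !ger0_norm // lecR.
by rewrite !ltr0_norm ?ltcR // rmorphN.
Qed.

(* Take a generator minus a rational number very close to its image under iota. *)
Theorem dominated_element : exists h : k, [/\ 0 < iota h, <<1; h ^+ 2>>%VS = fullv &
  forall s : {rmorphism k -> R}, (exists z, s z <> iota z) -> 9 * iota h <= `|s h|].
Proof.
have [t ht] := field_generator k.
pose sC (s : {rmorphism k -> R}) : {rmorphism k -> C} := @real_complex R \o s.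
pose P := map_poly (sC iota) (minPoly 1 t).
have Pmorph (s : {rmorphism k -> C}) : map_poly s (minPoly 1 t) = P.
  rewrite /P; have /polyOver1P[q ->] : minPoly 1 t \is a polyOver 1%VS by exact: minPolyOver.
  rewrite -!map_poly_comp; apply: eq_map_poly => r /=.
  by rewrite rmorph_rat; apply/esym; exact: (rmorph_rat (sC iota)).
have P0 : P != 0 by rewrite map_poly_eq0 monic_neq0 ?monic_minPoly.
have [rs eP] := closed_field_poly_normal P.
have Prs r : root P r -> r \in rs.
  by rewrite eP rootZ ?lead_coef_eq0 // root_prod_XsubC.
have [eta e0 heta] := root_separation rs (sC iota t).
(* The 10 yields the factor 9: other conjugates of [t] are at distance at least [eta > 10 * iota h],
   and subtracting [q] costs at most [iota h]. *)
have hlt : iota t - eta / 10 < iota t by lra.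
have [q] := rat_in_itvoo hlt.
rewrite in_itv /= => /andP[q1 q2].
pose h := t - q%:A.
have hE (s : {rmorphism k -> R}) : s h = s t - ratr q by rewrite rmorphB /= rmorph_rat.
have h0 : 0 < iota h by rewrite hE subr_gt0.
have h1 : iota h < eta / 10 by rewrite hE; lra.
exists h; split=> //.
- apply/eqP; rewrite eqEsubv subvf /= -ht; apply/FadjoinP; split; first exact: sub1v.
  (* A conjugate [r] of [t] over the field of [h ^ 2] satisfies [(r - q) ^ 2 = h ^ 2], so it lies
     within [2 * iota h < eta] of [iota t] and must equal it. *)
  apply: (single_root_mem (s := sC iota)) => r hr.
  have rP : r \in rs.
    apply: Prs; move: hr; rewrite /P -!dvdp_XsubCl => hr; apply: dvdp_trans hr _.
    by rewrite dvdp_map minPolyS // sub1v.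
  apply/eqP; apply/negPn/negP => hne; have hge := heta _ rP hne.
  have : root (map_poly (sC iota) (('X - (q%:A)%:P) ^+ 2 - (h ^+ 2)%:P)) r.
    move: hr; rewrite -!dvdp_XsubCl => hr; apply: dvdp_trans hr _.
    rewrite dvdp_map; apply: minPoly_dvdp.
      apply: rpredB; last by rewrite polyOverC memv_adjoin.
      by apply: rpredX; apply: rpredB; rewrite ?polyOverX // polyOverC; apply: (subvP (sub1v _)); rewrite rpredZ // mem1v.
    by rewrite /root !hornerE subrr.
  rewrite rmorphB rmorphXn rmorphB /= map_polyX !map_polyC /root !hornerE /= subr_eq0 => /eqP hsq.
  have hn : `|r - (sC iota (q%:A))| = (iota h)%:C%C.
    have : `|r - sC iota q%:A| ^+ 2 = (iota h)%:C%C ^+ 2.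
      have -> : (iota h)%:C%C = `|sC iota h| by rewrite ger0_norm // lecR ltW.
      by rewrite -!normrX hsq -(rmorphXn (sC iota)).
    by move/eqP; rewrite eqrXn2 ?normr_ge0 // ?lecR ?ltW // => /eqP.
  have : `|r - sC iota t| <= (iota h)%:C%C + (iota h)%:C%C.
    have -> : r - sC iota t = (r - sC iota q%:A) - sC iota h.
      by rewrite /h (rmorphB (sC iota)); ring.
    apply: le_trans (ler_normB _ _) _; rewrite hn lerD2l.
    by rewrite ger0_norm // lecR ltW.
  move=> /(le_trans hge); rewrite -rmorphD /= lecR; lra.
- move=> s [z hz].
  have st : s t != iota t.
    apply/eqP => e; apply: hz.
    have zt : z \in <<1; t>>%VS by rewrite ht memvf.
    have [p hp] := generated_value zt.
    by rewrite !hp e.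
  have rt : (s t)%:C%C \in rs.
    by apply: Prs; rewrite -(Pmorph (sC s)) (fmorph_root (sC s)) root_minPoly.
  have := heta _ rt; rewrite /= (inj_eq (@complexI R)) => /(_ st).
  rewrite -rmorphB norm_real_complex lecR => h2; rewrite (hE s).
  have := ler_normB (s t - ratr q) (iota t - ratr q).
  rewrite (_ : s t - ratr q - _ = s t - iota t); last by ring.
  by rewrite -[iota t - _]hE (gtr0_norm h0); lra.
Qed.

End Dominant.

(** * Lorentzian linear algebra in dimension three *)

Section Lorentz.
Variable R : realType.
Local Notation V := 'cV[R]_3.
Implicit Types (u v w e f z : V) (a b c : R).

Lemma lorentzC u v : lorentz u v = lorentz v u.
Proof. by rewrite !lorentzE; ring. Qed.

Lemma lorentzDl u v w : lorentz (u + v) w = lorentz u w + lorentz v w.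
Proof. by rewrite !lorentzE !mxE; ring. Qed.

Lemma lorentzDr u v w : lorentz w (u + v) = lorentz w u + lorentz w v.
Proof. by rewrite lorentzC lorentzDl !(lorentzC w). Qed.

Lemma lorentzZl a u v : lorentz (a *: u) v = a * lorentz u v.
Proof. by rewrite !lorentzE !mxE; ring. Qed.

Lemma lorentzZr a u v : lorentz v (a *: u) = a * lorentz v u.
Proof. by rewrite lorentzC lorentzZl lorentzC. Qed.

Lemma lorentzNl u v : lorentz (- u) v = - lorentz u v.
Proof. by rewrite -scaleN1r lorentzZl mulN1r. Qed.

Lemma lorentzNr u v : lorentz v (- u) = - lorentz v u.
Proof. by rewrite lorentzC lorentzNl lorentzC. Qed.

Lemma lorentz0l v : lorentz 0 v = 0.
Proof. by rewrite -(scale0r 0) lorentzZl mul0r. Qed.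

Definition lorentz_lin := (lorentzDl, lorentzDr, lorentzNl, lorentzNr, lorentzZl, lorentzZr).

Lemma vec3P u v : u 0 0 = v 0 0 -> u 1 0 = v 1 0 -> u 2%:R 0 = v 2%:R 0 -> u = v.
Proof.
move=> h0 h1 h2; apply/matrixP => i j; rewrite (ord1 j).
case: i => [[|[|[|//]]]] Hi.
- by rewrite (_ : Ordinal Hi = 0) //; exact/val_inj.
- by rewrite (_ : Ordinal Hi = 1) //; exact/val_inj.
- by rewrite (_ : Ordinal Hi = 2%:R) //; exact/val_inj.
Qed.

Lemma lorentz_reflection e u v : lorentz e e = 1 ->
  lorentz (reflection e *m u) (reflection e *m v) = lorentz u v.
Proof. by move=> h; rewrite !reflectionE !lorentz_lin h (lorentzC u e); ring. Qed.

Lemma lorentz_reflectionl e u v :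
  lorentz (reflection e *m u) v = lorentz u v - 2 * lorentz e u * lorentz e v.
Proof. by rewrite !reflectionE !lorentz_lin. Qed.

Lemma reflectionK e v : lorentz e e = 1 -> reflection e *m (reflection e *m v) = v.
Proof.
move=> h; rewrite !reflectionE !lorentz_lin h.
by apply: vec3P; rewrite !mxE; ring.
Qed.

Lemma mulmx_ext (A B : 'M[R]_3) : (forall v, A *m v = B *m v) -> A = B.
Proof.
move=> h; apply/matrixP => i j.
have := h (delta_mx j 0); rewrite -!colE => /matrixP/(_ i 0).
by rewrite !mxE.
Qed.

Lemma reflection_sqr e : lorentz e e = 1 -> reflection e * reflection e = 1.
Proof.
by move=> h; apply: mulmx_ext => v; rewrite -mulmxA reflectionK// mul1mx.
Qed.

Lemma reflectionN e : reflection (- e) = reflection e.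
Proof.
by apply: mulmx_ext => v; rewrite !reflectionE lorentzNl scalerN mulrN scaleNr opprK.
Qed.

(** The open cone over the hyperbolic plane. It is stable under sums and positive multiples, so
    points can be moved without being normalized again. *)
Definition future z := lorentz z z < 0 /\ 0 < z 0 0.

Lemma hyperbolic_future z : hyperbolic_plane z -> future z.
Proof. by case=> h1 h2; split; rewrite ?h1 // ltrN10. Qed.

(** By Cauchy-Schwarz the spatial part of the product is smaller in absolute value than the product
    of the two time coordinates, which therefore decides the sign. *)
Lemma timelike_lorentz_neg z w : future z -> lorentz w w < 0 ->
  (lorentz z w < 0) = (0 < w 0 0).
Proof.
rewrite /future !lorentzE => -[h1 h2] h3.
set a := z 0 0 in h1 h2 *; set b := z 1 0 in h1 *; set c := z 2 0 in h1 *.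
set d := w 0 0 in h3 *; set e := w 1 0 in h3 *; set f := w 2 0 in h3 *.
have cs : (b * e + c * f) ^+ 2 < (a * d) ^+ 2.
  have h : (b * e + c * f) ^+ 2 <= (b ^+ 2 + c ^+ 2) * (e ^+ 2 + f ^+ 2).
    rewrite -subr_ge0 (_ : _ - _ = (b * f - c * e) ^+ 2) ?sqr_ge0 //; ring.
  apply: le_lt_trans h _; rewrite exprMn; apply: ltr_pM.
  - by rewrite addr_ge0 ?sqr_ge0.
  - by rewrite addr_ge0 ?sqr_ge0.
  - lra.
  - lra.
apply/idP/idP => h.
- rewrite ltNge; apply/negP => hd.
  have : `|b * e + c * f| < `|a * d| by rewrite -ltr_sqr ?nnegrE ?normr_ge0 // !real_normK ?num_real.
  have ad : a * d <= 0 by rewrite pmulr_rle0.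
  rewrite (ler0_norm ad) ltr_norml => /andP[h5 _]; lra.
- have : `|b * e + c * f| < `|a * d| by rewrite -ltr_sqr ?nnegrE ?normr_ge0 // !real_normK ?num_real.
  have ad : 0 < a * d by rewrite mulr_gt0.
  rewrite (gtr0_norm ad) ltr_norml => /andP[_ h5]; lra.
Qed.

Lemma future_lorentz z w : future z -> future w -> lorentz z w < 0.
Proof. by move=> hz [hw1 hw2]; rewrite timelike_lorentz_neg. Qed.

Lemma futureD z w : future z -> future w -> future (z + w).
Proof.
move=> hz hw; have h := future_lorentz hz hw.
case: hz hw => h1 h2 [h3 h4]; split; last by rewrite mxE addr_gt0.
by rewrite !lorentz_lin (lorentzC w z); lra.
Qed.

Lemma futureZ a z : 0 < a -> future z -> future (a *: z).
Proof.
move=> ha [h1 h2]; split; last by rewrite mxE mulr_gt0.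
by rewrite !lorentz_lin pmulr_rlt0 // pmulr_rlt0.
Qed.

Lemma reflection_future e z : lorentz e e = 1 -> future z -> future (reflection e *m z).
Proof.
move=> he hz; have h : lorentz (reflection e *m z) (reflection e *m z) < 0.
  by rewrite lorentz_reflection //; case: hz.
split=> //; rewrite -(timelike_lorentz_neg hz h) lorentzC lorentz_reflectionl.
have := sqr_ge0 (lorentz e z); case: hz; lra.
Qed.

Lemma future_normalize z : future z ->
  exists2 c, 0 < c & hyperbolic_plane (c *: z).
Proof.
move=> hz; have [h1 h2] := hz; exists (Num.sqrt (- lorentz z z))^-1.
  by rewrite invr_gt0 sqrtr_gt0 oppr_gt0.
split; last by rewrite mxE mulr_gt0 // invr_gt0 sqrtr_gt0 oppr_gt0.
rewrite !lorentz_lin mulrA -expr2 exprVn sqr_sqrtr ?oppr_ge0 ?ltW //.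
by rewrite invrN mulNr mulVf ?lt_eqF.
Qed.

Definition gram3 u v w : R :=
  lorentz u u * (lorentz v v * lorentz w w - lorentz v w ^+ 2)
  - lorentz u v * (lorentz u v * lorentz w w - lorentz v w * lorentz u w)
  + lorentz u w * (lorentz u v * lorentz v w - lorentz v v * lorentz u w).

Definition det3 u v w : R :=
  u 0 0 * (v 1 0 * w 2 0 - v 2 0 * w 1 0)
  - u 1 0 * (v 0 0 * w 2 0 - v 2 0 * w 0 0)
  + u 2 0 * (v 0 0 * w 1 0 - v 1 0 * w 0 0).

Lemma gram3_det u v w : gram3 u v w = - det3 u v w ^+ 2.
Proof. by rewrite /gram3 /det3 !lorentzE; ring. Qed.

(** The Euclidean cross product followed by the form matrix, so that pairing with it is the
    determinant ([lorentz_cross]). *)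
Definition cross u v : V := \col_(i < 3) nth 0
  [:: - (u 1 0 * v 2 0 - u 2 0 * v 1 0);
      - (u 0 0 * v 2 0 - u 2 0 * v 0 0);
      u 0 0 * v 1 0 - u 1 0 * v 0 0] i.

Lemma lorentz_cross w u v : lorentz w (cross u v) = det3 w u v.
Proof. by rewrite lorentzE /det3 !mxE /=; ring. Qed.

Lemma lorentz_crossl u v : lorentz u (cross u v) = 0.
Proof. by rewrite lorentz_cross /det3; ring. Qed.

Lemma lorentz_crossr u v : lorentz v (cross u v) = 0.
Proof. by rewrite lorentz_cross /det3; ring. Qed.

Lemma lorentz_crosscross u v :
  lorentz (cross u v) (cross u v) = lorentz u v ^+ 2 - lorentz u u * lorentz v v.
Proof. by rewrite !lorentzE !mxE /=; ring. Qed.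

Lemma lorentz_sep u v w z : det3 u v w != 0 ->
  lorentz u z = 0 -> lorentz v z = 0 -> lorentz w z = 0 -> z = 0.
Proof.
move=> hd; rewrite !lorentzE => h1 h2 h3.
have H (a : R) : det3 u v w * a = 0 -> a = 0.
  by move=> /eqP; rewrite mulf_eq0 (negbTE hd) => /eqP.
apply: vec3P; rewrite !mxE; apply: H; rewrite /det3.
- transitivity (- ((- (u 0 0 * z 0 0) + u 1 0 * z 1 0 + u 2 0 * z 2 0) * (v 1 0 * w 2 0 - v 2 0 * w 1 0)
   + (- (v 0 0 * z 0 0) + v 1 0 * z 1 0 + v 2 0 * z 2 0) * (w 1 0 * u 2 0 - w 2 0 * u 1 0)
   + (- (w 0 0 * z 0 0) + w 1 0 * z 1 0 + w 2 0 * z 2 0) * (u 1 0 * v 2 0 - u 2 0 * v 1 0))); first ring.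
  by rewrite h1 h2 h3; ring.
- transitivity (- ((- (u 0 0 * z 0 0) + u 1 0 * z 1 0 + u 2 0 * z 2 0) * (v 0 0 * w 2 0 - v 2 0 * w 0 0)
   + (- (v 0 0 * z 0 0) + v 1 0 * z 1 0 + v 2 0 * z 2 0) * (w 0 0 * u 2 0 - w 2 0 * u 0 0)
   + (- (w 0 0 * z 0 0) + w 1 0 * z 1 0 + w 2 0 * z 2 0) * (u 0 0 * v 2 0 - u 2 0 * v 0 0))); first ring.
  by rewrite h1 h2 h3; ring.
- transitivity (((- (u 0 0 * z 0 0) + u 1 0 * z 1 0 + u 2 0 * z 2 0) * (v 0 0 * w 1 0 - v 1 0 * w 0 0)
   + (- (v 0 0 * z 0 0) + v 1 0 * z 1 0 + v 2 0 * z 2 0) * (w 0 0 * u 1 0 - w 1 0 * u 0 0)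
   + (- (w 0 0 * z 0 0) + w 1 0 * z 1 0 + w 2 0 * z 2 0) * (u 0 0 * v 1 0 - u 1 0 * v 0 0))); first ring.
  by rewrite h1 h2 h3; ring.
Qed.

Lemma det3Z (a b c : R) u v w :
  det3 (a *: u) (b *: v) (c *: w) = a * b * c * det3 u v w.
Proof. by rewrite /det3 !mxE; ring. Qed.

Lemma det3_neq0 u v w : gram3 u v w != 0 -> det3 u v w != 0.
Proof. by rewrite gram3_det; apply: contraNneq => ->; rewrite expr0n /= oppr0. Qed.

(* The orthogonal complement of a timelike vector is positive definite, so this is
   the strict Cauchy-Schwarz inequality. *)
Lemma crossing_lt1 z e f : lorentz z z < 0 -> lorentz e e = 1 -> lorentz f f = 1 ->
  lorentz e z = 0 -> lorentz f z = 0 -> f != e -> f != - e ->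
  lorentz e f ^+ 2 < 1.
Proof.
move=> hz he hf hez hfz h1 h2; rewrite ltNge; apply/negP => hge.
have hg : gram3 z e f = lorentz z z * (1 - lorentz e f ^+ 2).
  by rewrite /gram3 he hf (lorentzC z e) (lorentzC z f) hez hfz; ring.
have g0 : gram3 z e f = 0.
  apply/eqP; rewrite eq_le gram3_det oppr_le0 sqr_ge0 /= -gram3_det hg.
  by apply: mulr_le0; [exact: ltW | rewrite subr_le0].
have : 1 - lorentz e f ^+ 2 = 0.
  by apply/eqP; move/eqP: g0; rewrite hg mulf_eq0 lt_eqF.
move=> /eqP; rewrite subr_eq0 eq_sym sqrf_eq1 => /orP hs.
have key g : lorentz g g = 1 -> lorentz g z = 0 -> lorentz e g = 1 -> g = e.
  move=> hgg hgz heg; apply/eqP; rewrite -subr_eq0; apply/eqP.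
  have hd : lorentz (g - e) (g - e) = 0 by rewrite !lorentz_lin hgg he (lorentzC g e) heg; ring.
  have hdz : lorentz z (g - e) = 0 by rewrite !lorentz_lin !(lorentzC z) hgz hez; ring.
  have pos w : lorentz z w = 0 -> lorentz w w = 0 -> w = 0.
    rewrite !lorentzE in hz * => hw0 hw1.
    set a := z 0 0 in hz hw0 *; set b := z 1 0 in hz hw0 *; set c := z 2 0 in hz hw0 *.
    set p := w 0 0 in hw0 hw1 *; set q := w 1 0 in hw0 hw1 *; set r := w 2 0 in hw0 hw1 *.
    have e1 : a * p = b * q + c * r by lra.
    have e2 : p * p = q * q + r * r by lra.
    have e3 : (b * r - c * q) ^+ 2 + (a * a - b * b - c * c) * (q * q + r * r) = 0.
      transitivity (a * a * (q * q + r * r) - (b * q + c * r) * (b * q + c * r)); first ring.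
      by rewrite -e1 -e2; ring.
    have qr0 : q * q + r * r = 0.
      have := sqr_ge0 (b * r - c * q); have := sqr_ge0 q; have := sqr_ge0 r.
      have : 0 < a * a - b * b - c * c by lra.
      rewrite !expr2 => ha hr hq hbr; apply/eqP; rewrite eq_le; apply/andP; split; last lra.
      by rewrite -(pmulr_rle0 _ ha); lra.
    have z0 (s : R) : s * s = 0 -> s = 0 by move=> /eqP; rewrite mulf_eq0 orbb => /eqP.
    have := sqr_ge0 q; have := sqr_ge0 r; rewrite !expr2 => hr hq.
    have hp0 : p * p = 0 by lra.
    have hq0 : q * q = 0 by lra.
    have hr0 : r * r = 0 by lra.
    by apply: vec3P; rewrite [RHS]mxE; apply: z0.
  exact: pos.
case: hs => /eqP hs.
- by move/negP: h1; apply; rewrite (key f).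
- move/negP: h2; apply; rewrite -(key (- f)) ?opprK //; rewrite ?lorentz_lin ?hf ?hfz ?hs; lra.
Qed.

End Lorentz.

(** * Reflection groups and Tits' theorem *)

Section Subgroups.
Variable R : realType.
Local Notation V := 'cV[R]_3.
Implicit Types (e : V) (H : set 'M[R]_3).

Lemma isom1 : isom_group (1 : 'M[R]_3).
Proof. by split=> [x y|x]; rewrite ?mul1mx. Qed.

Lemma isomM (A B : 'M[R]_3) : isom_group A -> isom_group B -> isom_group (A * B).
Proof.
move=> [h1 h2] [h3 h4]; split=> [x y|x hx]; rewrite -!mulmxA ?h1 ?h3 //.
by apply: h2; apply: h4.
Qed.

Lemma lorentz_form_sqr : lorentz_form R *m lorentz_form R = 1%:M.
Proof.
rewrite /lorentz_form mulmx_diag -diag_const_mx; congr diag_mx.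
by apply/rowP => j; rewrite !mxE; case: ifP; rewrite ?mulrNN mulr1.
Qed.

Lemma isom_tr (A : 'M[R]_3) : isom_group A ->
  A^T *m lorentz_form R *m A = lorentz_form R.
Proof.
case=> h _; apply/matrixP => i j.
have dl (M : 'M[R]_3) a b : ((delta_mx a 0 : 'cV[R]_3)^T *m M *m (delta_mx b 0 : 'cV[R]_3)) 0 0 = M a b.
  rewrite -colE mxE mxE (bigD1 a) //= big1 ?addr0 => [|i' /negbTE hi].
    by rewrite !mxE !eqxx mul1r.
  by rewrite !mxE hi mul0r.
move: (h (delta_mx i 0) (delta_mx j 0)).
rewrite /lorentz (dl (lorentz_form R)) => <-.
by rewrite -[LHS]dl trmx_mul -!mulmxA.
Qed.

Lemma isom_inv (A : 'M[R]_3) : isom_group A ->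
  (A \is a GRing.unit) * (A^-1 = lorentz_form R *m A^T *m lorentz_form R).
Proof.
move=> hA; have h : (lorentz_form R *m A^T *m lorentz_form R) * A = 1.
  rewrite -[LHS]/(_ *m _) -!mulmxA (mulmxA A^T) isom_tr //.
  by rewrite lorentz_form_sqr.
have [u1 u2] := mulmx1_unit h.
split=> //; apply: (mulIr (u2 : A \is a GRing.unit)).
by rewrite h mulVr.
Qed.

Lemma isomV (A : 'M[R]_3) : isom_group A -> isom_group A^-1.
Proof.
move=> hA; have [u _] := isom_inv hA; have [h1 h2] := hA.
have hK x : A *m (A^-1 *m x) = x by rewrite mulmxA -[A *m _]/(A * _) mulrV // mul1mx.
have h3 x y : lorentz (A^-1 *m x) (A^-1 *m y) = lorentz x y by rewrite -h1 !hK.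
split=> // x [hx1 hx2]; split; first by rewrite h3.
pose p : 'cV[R]_3 := delta_mx 0 0.
have hp : hyperbolic_plane p.
  by split; rewrite ?lorentzE !mxE /=; [ring|exact: ltr01].
have := h2 p hp => /hyperbolic_future hAp.
rewrite -(timelike_lorentz_neg (hyperbolic_future hp)); last by rewrite h3 hx1; lra.
by rewrite -h1 hK; apply: future_lorentz => //; apply: hyperbolic_future.
Qed.

Lemma subgroupP H : is_subgroup H <->
  [/\ H `<=` @isom_group R, H 1, (forall A B, H A -> H B -> H (A * B)) &
      forall A, H A -> H A^-1].
Proof.
split=> [[hi [h1 hd]]|[hi h1 hm hv]].
  have h1' : H 1 by move: h1; rewrite inE.
  have hd' A B : H A -> H B -> H (A / B).
    by move=> hA hB; have := hd A B; rewrite !inE; apply.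
  have hv A : H A -> H A^-1 by move=> hA; rewrite -div1r; apply: hd'.
  split=> // A B hA hB; rewrite -(invrK B); apply: hd' => //; exact: hv.
split=> //; split; first by rewrite inE.
by move=> A B; rewrite !inE => hA hB; apply: hm => //; apply: hv.
Qed.

Lemma isom_subgroup : is_subgroup (@isom_group R).
Proof. by apply/subgroupP; split=> //; [exact: isom1|exact: isomM|exact: isomV]. Qed.

Lemma reflection_isom e : lorentz e e = 1 -> isom_group (reflection e).
Proof.
move=> he; split=> [x y|x [h1 h2]]; first exact: lorentz_reflection.
split; first by rewrite lorentz_reflection.
by have [] := @reflection_future _ e x he (hyperbolic_future (conj h1 h2)).
Qed.

Lemma generated_subgroup_is_subgroup (S : set 'M[R]_3) : S `<=` @isom_group R ->
  is_subgroup (generated_subgroup S).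
Proof.
move=> hS; apply/subgroupP; split.
- by move=> A; apply; split=> //; apply: isom_subgroup.
- by move=> M [/subgroupP[]].
- by move=> A B hA hB M hM; case: (hM) => /subgroupP[_ _ hm _] _; apply: hm; [apply: hA|apply: hB].
- by move=> A hA M hM; case: (hM) => /subgroupP[_ _ _ hv] _; apply: hv; apply: hA.
Qed.

Lemma reflection_conj (A : 'M[R]_3) e : isom_group A ->
  reflection (A *m e) = A * reflection e * A^-1.
Proof.
move=> hA; have [u _] := isom_inv hA; apply: (mulIr u); rewrite mulrVK //.
apply: mulmx_ext => v; rewrite -[_ * A]/(_ *m _) -[A * _]/(_ *m _) -!mulmxA !reflectionE.
by rewrite (proj1 hA) mulmxBr -scalemxAr.
Qed.

Lemma isom_future (A : 'M[R]_3) z : isom_group A -> future z -> future (A *m z).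
Proof.
move=> [h1 h2] hz; have [c hc /h2 hcz] := future_normalize hz.
have := futureZ (eqbRL (invr_gt0 c) hc : 0 < c^-1) (hyperbolic_future hcz).
by rewrite -scalemxAr scalerA mulVf ?gt_eqF // scale1r.
Qed.

End Subgroups.

(** * Words in the reflections and positivity of roots *)

Section Words.
Variable R : realType.
Local Notation V := 'cV[R]_3.
Variables (N : nat) (e : 'I_N -> V).
Hypothesis hn : forall i, lorentz (e i) (e i) = 1.
Implicit Types (w u v : seq 'I_N) (s t i : 'I_N).

Definition ev w : 'M[R]_3 := \prod_(i <- w) reflection (e i).

Lemma ev_nil : ev [::] = 1. Proof. exact: big_nil. Qed.
Lemma ev_cons i w : ev (i :: w) = reflection (e i) * ev w. Proof. exact: big_cons. Qed.
Lemma ev_cat w w' : ev (w ++ w') = ev w * ev w'. Proof. exact: big_cat. Qed.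
Lemma ev_seq1 i : ev [:: i] = reflection (e i). Proof. exact: big_seq1. Qed.
Lemma ev_rcons w i : ev (rcons w i) = ev w * reflection (e i).
Proof. by rewrite -cats1 ev_cat ev_seq1. Qed.

Lemma ev_rev w : ev w * ev (rev w) = 1.
Proof.
elim: w => [|i w IH]; first by rewrite ev_nil mulr1.
rewrite rev_cons ev_rcons ev_cons -mulrA (mulrA (ev w)) IH mul1r.
exact: reflection_sqr.
Qed.

Lemma ev_isom w : isom_group (ev w).
Proof.
elim: w => [|i w IH]; first by rewrite ev_nil; exact: isom1.
by rewrite ev_cons; apply: isomM => //; apply: reflection_isom.
Qed.

Lemma evV w : (ev w)^-1 = ev (rev w).
Proof.
have [u _] := isom_inv (ev_isom w).
by apply: (mulrI u); rewrite mulrV // ev_rev.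
Qed.

Lemma polygon_groupP g : polygon_group e g <-> exists w, g = ev w.
Proof.
have hs : is_subgroup (polygon_group e).
  by apply: generated_subgroup_is_subgroup => _ [i _ <-]; apply: reflection_isom.
split=> [|[w ->]]; last first.
  have [_ h1 hm _] := (subgroupP _).1 hs.
  elim: w => [|i w IH]; first by rewrite ev_nil.
  by rewrite ev_cons; apply: hm => // M [_ hM]; apply: hM; exists i.
move=> h; apply: (h [set g' | exists w, g' = ev w]); split=> [|_ [i _ <-]]; last first.
  by exists [:: i]; rewrite ev_seq1.
apply/subgroupP; split.
- by move=> _ [w ->]; exact: ev_isom.
- by exists [::]; rewrite ev_nil.
- by move=> _ _ [w ->] [w' ->]; exists (w ++ w'); rewrite ev_cat.
- by move=> _ [w ->]; exists (rev w); rewrite evV.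
Qed.

Lemma det3_reflection (f a b c : V) : lorentz f f = 1 ->
  det3 (reflection f *m a) (reflection f *m b) (reflection f *m c) = - det3 a b c.
Proof.
move=> hf; transitivity (det3 a b c * (1 - 2 * lorentz f f)); last by rewrite hf; ring.
by rewrite !reflectionE /det3 !mxE !lorentzE; ring.
Qed.

(** Every reflection has determinant -1. *)
Lemma ev_parity w w' : ev w = ev w' -> odd (size w) = odd (size w').
Proof.
move=> h.
have key u a b c : det3 (ev u *m a) (ev u *m b) (ev u *m c) = (-1) ^+ odd (size u) * det3 a b c.
  elim: u => [|i u IH]; first by rewrite ev_nil !mul1mx mul1r.
  rewrite ev_cons -[_ * ev u]/(_ *m _) -!mulmxA det3_reflection // IH /=.
  by case: (odd _) => /=; rewrite ?expr0 ?expr1; ring.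
have h1 : det3 (delta_mx 0 0 : V) (delta_mx 1 0) (delta_mx 2 0) = 1.
  by rewrite /det3 !mxE /=; ring.
have := key w (delta_mx 0 0) (delta_mx 1 0) (delta_mx 2 0).
rewrite h key h1 !mulr1.
by case: (odd _) (odd _) => [] [] //=; rewrite ?expr0 ?expr1; lra.
Qed.

Definition reduced w := forall w', ev w' = ev w -> (size w <= size w')%N.

Lemma exists_reduced w : exists2 w', reduced w' & ev w' = ev w.
Proof.
pose P n := `[< exists2 w', size w' = n & ev w' = ev w >].
have exP : exists n, P n by exists (size w); apply/asboolP; exists w.
case: (ex_minnP exP) => n /asboolP[w' hs he] hmin.
exists w' => // u hu; rewrite hs; apply: hmin; apply/asboolP.
by exists u => //; rewrite hu he.
Qed.

Lemma reduced_catl w w' : reduced (w ++ w') -> reduced w.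
Proof.
move=> h u hu; have := h (u ++ w'); rewrite !ev_cat hu => /(_ erefl).
by rewrite !size_cat leq_add2r.
Qed.

Lemma reduced_catr w w' : reduced (w ++ w') -> reduced w'.
Proof.
move=> h u hu; have := h (w ++ u); rewrite !ev_cat hu => /(_ erefl).
by rewrite !size_cat leq_add2l.
Qed.

Lemma reduced_rconsl w s : reduced (rcons w s) -> reduced w.
Proof. by rewrite -cats1; exact: reduced_catl. Qed.

(* The cone containing the positive roots of the Coxeter group. *)
Definition pos (a : V) := exists2 c : 'I_N -> R, (forall i, 0 <= c i) & a = \sum_i c i *: e i.

Lemma pos_e i : pos (e i).
Proof.
exists (fun j => (j == i)%:R) => [j|]; first exact: ler0n.
rewrite (bigD1 i) //= eqxx scale1r big1 ?addr0 // => j /negbTE ->.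
by rewrite scale0r.
Qed.

Lemma pos_comb x y a b : 0 <= x -> 0 <= y -> pos a -> pos b -> pos (x *: a + y *: b).
Proof.
move=> hx hy [c hc ->] [d hd ->]; exists (fun i => x * c i + y * d i).
  by move=> i; rewrite addr_ge0 // mulr_ge0.
rewrite !scaler_sumr -big_split; apply: eq_bigr => i _ /=.
by rewrite scalerDl !scalerA.
Qed.

Lemma pos_lorentz z a : (forall i, lorentz z (e i) <= 0) -> pos a -> lorentz z a <= 0.
Proof.
move=> hz [c hc ->].
rewrite (_ : lorentz z _ = \sum_i c i * lorentz z (e i)).
  by apply: sumr_le0 => i _; rewrite mulr_ge0_le0.
elim/big_ind2: _ => [|x1 x2 y1 y2 <- <-|i _]; first by rewrite lorentzC lorentz0l.
- by rewrite lorentzDr.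
- by rewrite lorentzZr.
Qed.

Hypothesis hcox : forall i j, i != j ->
  [\/ lorentz (e i) (e j) = 0, lorentz (e i) (e j) = - 2^-1 | lorentz (e i) (e j) <= -1].

Lemma dihedral_comm s t : lorentz (e s) (e t) = 0 ->
  ev [:: s; t; s] = ev [:: t].
Proof.
move=> h; rewrite !ev_cons ev_nil !mulr1; apply: mulmx_ext => x.
rewrite -!mulmxA; rewrite !reflectionE !lorentz_lin !hn (lorentzC (e t) (e s)) h.
by apply: vec3P; rewrite !mxE; ring.
Qed.

Lemma dihedral_braid s t : lorentz (e s) (e t) = - 2^-1 ->
  ev [:: t; s; t; s] = ev [:: s; t].
Proof.
move=> h; rewrite !ev_cons ev_nil !mulr1; apply: mulmx_ext => x.
rewrite -!mulmxA; rewrite !reflectionE !lorentz_lin !hn (lorentzC (e t) (e s)) h.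
by apply: vec3P; rewrite !mxE; field.
Qed.

(** In the infinite dihedral case, the coefficient changed last dominates: from [a <= b] and
    [c <= -1] follows [- a - 2 * c * b >= 2 * b - a >= b]. The condition on [head s u] records which
    coefficient that is; for the empty word the default [s] matches the vector [e s] itself. *)
Lemma dihedral_alternating s t u : lorentz (e s) (e t) <= -1 ->
  all (fun i => (i == s) || (i == t)) u -> sorted (fun i j => i != j) (rcons u s) ->
  exists a b, [/\ ev u *m e s = a *: e s + b *: e t, 0 <= a, 0 <= b &
    if head s u == s then b <= a else a <= b].
Proof.
move=> hst; elim: u => [|h u IH] /=.
  move=> _ _; exists 1, 0; rewrite ev_nil mul1mx scale1r scale0r addr0.
  by rewrite eqxx ler01 lexx.
move=> /andP[hh hall] hp.
have hnext : h != head s u by move: hp; case: (u) => [|x u'] /= /andP[].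
have [a [b [hu ha hb hab]]] := IH hall (path_sorted hp).
rewrite ev_cons -[_ * ev u]/(_ *m _) -mulmxA hu mulmxDr -!scalemxAr !reflectionE.
set c := lorentz (e s) (e t) in hst *.
have [hs|hs] := eqVneq h s.
  have hab' : a <= b by move: hab hnext; rewrite hs eq_sym => + /negbTE h'; rewrite h'.
  exists (- a - 2 * c * b), b; rewrite hs hn; split => //.
  - by apply: vec3P; rewrite !mxE /c; ring.
  - by have : 0 <= b * (-1 - c) by [rewrite mulr_ge0 // subr_ge0]; lra.
  - by have : 0 <= b * (-1 - c) by [rewrite mulr_ge0 // subr_ge0]; lra.
have ht : h = t by move: hh; rewrite (negbTE hs) => /eqP.
have hab' : b <= a.
  move: hab; case: eqP => // hx.
  have : all (fun i => (i == s) || (i == t)) (rcons u s) by rewrite all_rcons eqxx hall.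
  move: hnext hx; case: (u) => [|x u'] //= + hx /andP[+ _].
  by rewrite ht => h1 /orP[/eqP //|/eqP h2]; rewrite h2 eqxx in h1.
exists a, (- b - 2 * c * a); rewrite ht hn; split => //.
- by rewrite (lorentzC (e t) (e s)) -/c; apply: vec3P; rewrite !mxE; ring.
- by have : 0 <= a * (-1 - c) by [rewrite mulr_ge0 // subr_ge0]; lra.
- by have : 0 <= a * (-1 - c) by [rewrite mulr_ge0 // subr_ge0]; lra.
Qed.

Lemma sorted_suffix (T : Type) (r : rel T) (p q : seq T) : sorted r (p ++ q) -> sorted r q.
Proof. by move=> /cat_sorted2[]. Qed.

Lemma reduced_sorted w : reduced w -> sorted (fun i j => i != j) w.
Proof.
elim: w => [//|i w IH] hr /=.
have hw : reduced w by apply: (@reduced_catr [:: i]).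
case: w IH hr hw => [//|j w] IH hr hw /=; rewrite [path _ _ _](IH hw) andbT.
apply/negP => /eqP hij; subst j.
have := hr w; rewrite !ev_cons mulrA reflection_sqr // mul1r => /(_ erefl) /=.
by rewrite ltnNge leqnSn.
Qed.

(** For product 0 or -1/2 the group of [s] and [t] has order 4 or 6, and the reduced words ending in
    [s] can be listed: at most one, respectively two, letters precede [s], since a longer word is
    shortened by the commutation or braid relation. *)
Lemma dihedral_positive s t u : s != t ->
  all (fun i => (i == s) || (i == t)) u -> reduced (rcons u s) ->
  exists a b, [/\ ev u *m e s = a *: e s + b *: e t, 0 <= a & 0 <= b].
Proof.
move=> st hall hred; have hsort := reduced_sorted hred.
case: (hcox st) => h; last 2 first.
- case/lastP: u hall hred hsort => [|u x].
    by exists 1, 0; rewrite ev_nil mul1mx scale1r scale0r addr0 ler01 lexx.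
  rewrite all_rcons => /andP[hx hall] hred hsort.
  have xt : x = t.
    move: hsort; rewrite -!cats1 -!catA => /sorted_suffix /=; rewrite andbT.
    by move: hx => /orP[] /eqP -> //; rewrite eqxx.
  subst x; have hrt : ev [:: t] *m e s = 1 *: e s + 1 *: e t.
    by rewrite ev_seq1 reflectionE (lorentzC (e t)) h; apply: vec3P; rewrite !mxE; field.
  case/lastP: u hall hred hsort => [|u x].
    by exists 1; exists 1; rewrite [rcons _ _]/= hrt; split; rewrite ?ler01.
  rewrite all_rcons => /andP[hx' hall] hred hsort.
  have xs : x = s.
    move: hsort; rewrite -!cats1 -!catA => /sorted_suffix /= /andP[+ _].
    by move: hx' => /orP[] /eqP -> //; rewrite eqxx.
  subst x; case/lastP: u hall hred hsort => [|u x].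
    exists 0, 1; rewrite ler01 lexx; split=> //.
    rewrite (_ : rcons (rcons [::] s) t = s :: [:: t]) // ev_cons -[_ * _]/(_ *m _) -mulmxA hrt.
    by rewrite mulmxDr -!scalemxAr !reflectionE hn h; apply: vec3P; rewrite !mxE; field.
  rewrite all_rcons => /andP[hx'' hall] hred hsort.
  have xt : x = t.
    move: hsort; rewrite -!cats1 -!catA => /sorted_suffix /= /andP[+ _].
    by move: hx'' => /orP[] /eqP -> //; rewrite eqxx.
  subst x; move: hred; rewrite -!cats1 -!catA /= => /reduced_catr hred.
  by have := hred [:: s; t]; rewrite (dihedral_braid h) => /(_ erefl).
- by have [a [b [h1 h2 h3 _]]] := dihedral_alternating h hall hsort; exists a, b.
- case/lastP: u hall hred hsort => [|u x].
    by exists 1, 0; rewrite ev_nil mul1mx scale1r scale0r addr0 ler01 lexx.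
  rewrite all_rcons => /andP[hx hall] hred hsort.
  have xt : x = t.
    move: hsort; rewrite -!cats1 -!catA => /sorted_suffix /=; rewrite andbT.
    by move: hx => /orP[] /eqP -> //; rewrite eqxx.
  subst x; case/lastP: u hall hred hsort => [|u x].
    exists 1, 0; rewrite ler01 lexx; split=> //.
    rewrite (_ : rcons [::] t = [:: t]) // ev_seq1 reflectionE (lorentzC (e t)) h; apply: vec3P; rewrite !mxE; ring.
  rewrite all_rcons => /andP[hx' hall] hred hsort.
  have xs : x = s.
    move: hsort; rewrite -!cats1 -!catA => /sorted_suffix /= /andP[+ _].
    by move: hx' => /orP[] /eqP -> //; rewrite eqxx.
  subst x; move: hred; rewrite -!cats1 -!catA /= => /reduced_catr hred.
  by have := hred [:: t]; rewrite (dihedral_comm h) => /(_ erefl).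
Qed.

(** Tits' argument. With [t] the last letter of the word, write the element as [v u] with [u] in the
    dihedral group of [s] and [t] and [v] as short as possible. Then [u] sends [e s] to a
    nonnegative combination of [e s] and [e t], and induction applies to [v] followed by either
    letter. *)
Theorem reduced_positive w s : reduced (rcons w s) -> pos (ev w *m e s).
Proof.
have [n] := ubnP (size w); elim: n => // n IHn in w s *; rewrite ltnS => hsz hred.
case/lastP: w hsz hred => [|w1 t] hsz hred.
  by rewrite ev_nil mul1mx; apply: pos_e.
have st : s != t.
  have := reduced_sorted hred; rewrite -!cats1 -!catA => /sorted_suffix /=; rewrite andbT.
  by rewrite eq_sym.
pose P m := `[< exists v u, [/\ size v = m, all (fun i => (i == s) || (i == t)) u,
   ev v * ev u = ev (rcons w1 t) & (size v + size u = size (rcons w1 t))%N] >].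
have hP1 : P (size w1).
  apply/asboolP; exists w1, [:: t]; rewrite /= eqxx orbT ev_rcons ev_seq1 size_rcons addn1.
  by split.
have exP : exists m, P m by exists (size w1).
case: (ex_minnP exP) => m /asboolP[v [u [hm hall hev hsize]]] hmin.
have hw := reduced_rconsl hred.
have hredvu : reduced (v ++ u).
  by move=> w' hw'; rewrite size_cat hsize; apply: hw; rewrite hw' ev_cat hev.
have hredvus : reduced (v ++ rcons u s).
  move=> w' hw'; rewrite size_cat size_rcons addnS hsize -[X in (X <= _)%N](size_rcons _ s).
  by apply: hred; rewrite hw' ev_cat (ev_rcons u) mulrA hev -ev_rcons.
have hv := reduced_catl hredvu.
have hvw : (size v <= size w1)%N by rewrite hm; apply: hmin.
have hvn : (size v < n)%N by apply: leq_ltn_trans hvw _; move: hsz; rewrite size_rcons.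
(* If [v] followed by [x] were not reduced, parity would give a word strictly shorter than [v] for
   it; moving [x] into [u] would contradict the minimality of [v]. *)
have key x : (x == s) || (x == t) -> reduced (rcons v x).
  move=> hx v' hv'; rewrite size_rcons ltnNge; apply/negP => hle.
  have hpar : odd (size v') = ~~ odd (size v).
    by rewrite (ev_parity hv') size_rcons.
  have hlt : (size v' < size v)%N.
    by rewrite ltn_neqAle hle andbT; apply/eqP => h'; move: hpar; rewrite h'; case: odd.
  have hev' : ev v' * ev (x :: u) = ev (rcons w1 t).
    rewrite hv' ev_rcons ev_cons mulrA -(mulrA (ev v)) reflection_sqr // mulr1; exact: hev.
  have := hw (v' ++ x :: u); rewrite ev_cat hev' => /(_ erefl); rewrite size_cat /= -hsize => h2.
  have : (m <= size v')%N.
    apply: hmin; apply/asboolP; exists v', (x :: u); split => //=; first by rewrite hx.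
    by rewrite -hsize; lia.
  by rewrite -hm leqNgt hlt.
have [a [b [hu ha hb]]] := dihedral_positive st hall (reduced_catr hredvus).
rewrite -hev -[_ * _]/(_ *m _) -mulmxA hu mulmxDr -!scalemxAr.
by apply: pos_comb => //; apply: IHn => //; apply: key; rewrite eqxx ?orbT.
Qed.

Theorem chamber_stabilizer w z :
  (forall i, lorentz z (e i) <= 0) -> (forall i, lorentz (ev w *m z) (e i) <= 0) ->
  ev w *m z = z /\ exists2 w', ev w' = ev w & all (fun i => lorentz z (e i) == 0) w'.
Proof.
have [w0 hr <-] := exists_reduced w; move: w0 hr => {}w hr hz.
have [n] := ubnP (size w); elim: n => // n IHn in w hr *; rewrite ltnS => hsz hwz.
case/lastP: w hsz hr hwz => [|w s] hsz hr hwz.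
  by rewrite ev_nil mul1mx; split=> //; exists [::]; rewrite ?ev_nil.
have hp := pos_lorentz hwz (reduced_positive hr).
have h0 : lorentz z (e s) = 0.
  apply/eqP; rewrite eq_le hz /=; move: hp.
  rewrite ev_rcons -[_ * _]/(_ *m _) -mulmxA (proj1 (ev_isom w)) lorentz_reflectionl hn.
  by rewrite (lorentzC (e s)); lra.
have hsz' : reflection (e s) *m z = z.
  by rewrite reflectionE lorentzC h0 mulr0 scale0r subr0.
have hevz : ev (rcons w s) *m z = ev w *m z.
  by rewrite ev_rcons -[_ * _]/(_ *m _) -mulmxA hsz'.
have [] := IHn w; first exact: reduced_rconsl hr.
- by move: hsz; rewrite size_rcons.
- by move=> i; rewrite -hevz.
rewrite hevz => h1 [w' h2 h3]; split=> //.
exists (rcons w' s); first by rewrite !ev_rcons h2.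
by rewrite all_rcons h3 h0 eqxx.
Qed.

End Words.

(** * Quadrilaterals and their interior points *)

Section Quadrilaterals.
Variable R : realType.
Local Notation V := 'cV[R]_3.
Implicit Types (a b c d f g h z w u n : V) (x y : R).

Lemma null_lorentz_neg z w : future z -> lorentz w w = 0 -> lorentz z w < 0 -> 0 < w 0 0.
Proof.
rewrite /future !lorentzE => -[h1 h2] h3 h4.
set p := z 0 0 in h1 h2 h4 *; set q := z 1 0 in h1 h4 *; set r := z 2 0 in h1 h4 *.
set k := w 0 0 in h3 h4 *; set l := w 1 0 in h3 h4 *; set m := w 2 0 in h3 h4 *.
rewrite ltNge; apply/negP => hk.
have hpk : 0 <= - (p * k) by rewrite -mulrN mulr_ge0 // ?oppr_ge0 // ltW.
have cs : (q * l + r * m) ^+ 2 <= (p * k) ^+ 2.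
  have e1 : (q * l + r * m) ^+ 2 <= (q ^+ 2 + r ^+ 2) * (l ^+ 2 + m ^+ 2).
    by rewrite -subr_ge0 (_ : _ - _ = (q * m - r * l) ^+ 2) ?sqr_ge0 //; ring.
  apply: le_trans e1 _; rewrite exprMn (_ : l ^+ 2 + m ^+ 2 = k ^+ 2); last lra.
  by rewrite ler_wpM2r ?sqr_ge0 //; lra.
have : `|q * l + r * m| <= `|p * k|.
  by rewrite -ler_sqr ?nnegrE ?normr_ge0 // !real_normK ?num_real.
by rewrite -(normrN (p * k)) (ger0_norm hpk) ler_norml => /andP[h5 _]; lra.
Qed.

(* Outer normals to the consecutive sides of a quadrilateral with angles pi/2, pi/3,
   pi/2, pi/3; the last relation makes the Gram matrix singular, as it must be in R^3. *)
Definition quad_gram a b c d x y :=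
  [/\ [/\ lorentz a a = 1, lorentz b b = 1, lorentz c c = 1 & lorentz d d = 1],
      [/\ lorentz a b = 0, lorentz b c = - 2^-1, lorentz c d = 0 & lorentz d a = - 2^-1],
      lorentz a c = - x /\ lorentz b d = - y &
      [/\ 1 < x, 1 < y & (x - 1) * (y - 1) = 4^-1]].

(* No null vector lies in the cone, i.e. the quadrilateral has no ideal point
   (the conclusion contradicts the second hypothesis). *)
Definition compact_cone a b c d := forall n, 0 < n 0 0 -> lorentz n n = 0 ->
  lorentz n a <= 0 -> lorentz n b <= 0 -> lorentz n c <= 0 -> lorentz n d <= 0 ->
  lorentz n n < 0.

Lemma quad_gram_rot a b c d x y : quad_gram a b c d x y -> quad_gram c d a b x y.
Proof.
move=> [[h1 h2 h3 h4] [h5 h6 h7 h8] [h9 h10] [h11 h12 h13]]; split; split => //; by rewrite lorentzC.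
Qed.

Lemma quad_gram_flip a b c d x y : quad_gram a b c d x y -> quad_gram b a d c y x.
Proof.
move=> [[h1 h2 h3 h4] [h5 h6 h7 h8] [h9 h10] [h11 h12 h13]]; split; split => //; rewrite 1?lorentzC //.
by rewrite mulrC.
Qed.

Lemma compact_cone_rot a b c d : compact_cone a b c d -> compact_cone c d a b.
Proof. by move=> h n *; apply: h. Qed.

Lemma compact_cone_flip a b c d : compact_cone a b c d -> compact_cone b a d c.
Proof. by move=> h n *; apply: h. Qed.

Definition interior_point a b c d z :=
  future z /\ [/\ lorentz z a < 0, lorentz z b < 0, lorentz z c < 0 & lorentz z d < 0].

Lemma interior_rot a b c d z : interior_point a b c d z -> interior_point c d a b z.
Proof. by move=> [h [h1 h2 h3 h4]]; split. Qed.

Lemma interior_flip a b c d z : interior_point a b c d z -> interior_point b a d c z.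
Proof. by move=> [h [h1 h2 h3 h4]]; split. Qed.

Lemma small_neg (p q : R) : p < 0 ->
  exists2 r, 0 < r & forall t, 0 < t -> t <= r -> p + t * q < 0.
Proof.
move=> hp; exists (- p / (2 * (`|q| + 1))).
  by rewrite divr_gt0 ?oppr_gt0 // mulr_gt0 // ltr_wpDl.
move=> t ht htr; have hq := ler_norm q; have hq0 := normr_ge0 q.
have h2 : 0 < 2 * (`|q| + 1) by rewrite mulr_gt0 // ltr_wpDl.
move: htr; rewrite ler_pdivlMr // => htr.
have : t * q <= t * `|q| by rewrite ler_pM2l.
have : 0 <= t * `|q| by rewrite mulr_ge0 // ltW.
lra.
Qed.

Lemma future_perturb w u : future w ->
  exists2 r, 0 < r & forall t, 0 < t -> t <= r -> future (w + t *: u).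
Proof.
move=> [h1 h2].
have [r1 hr1 H1] := @small_neg (- w 0 0) (- u 0 0) (eqbRL (oppr_lt0 _) h2).
have [r2 hr2 H2] := @small_neg (lorentz w w) (2 * lorentz w u + `|lorentz u u|) h1.
exists (Num.min (Num.min r1 r2) 1); first by rewrite !lt_min hr1 hr2 ltr01.
move=> t ht; rewrite !le_min => /andP[/andP[t1 t2] t3]; split.
  have := H2 t ht t2; rewrite !lorentz_lin (lorentzC u w).
  have : t * lorentz u u <= `|lorentz u u|.
    apply: le_trans (ler_norm _) _; rewrite normrM (gtr0_norm ht).
    by rewrite ler_piMl.
  move=> hle; have : t * (t * lorentz u u) <= t * `|lorentz u u| by rewrite ler_pM2l.
  lra.
by have := H1 t ht t1; rewrite !mxE; lra.
Qed.

Lemma neg_perturb w u g : lorentz w g < 0 ->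
  exists2 r, 0 < r & forall t, 0 < t -> t <= r -> lorentz (w + t *: u) g < 0.
Proof.
move=> /(small_neg (lorentz u g))[r hr H]; exists r => // t ht htr.
by rewrite !lorentz_lin; exact: H.
Qed.

(** Serves to slide a boundary point into the interior along a mirror: [u] is then chosen tangent to
    the mirror and pointing inwards at the sides through [w]. *)
Lemma interior_perturb w u (s : seq V) : future w ->
  (forall g, g \in s -> lorentz w g < 0 \/ lorentz w g = 0 /\ lorentz u g < 0) ->
  exists t, [/\ 0 < t, future (w + t *: u) & forall g, g \in s -> lorentz (w + t *: u) g < 0].
Proof.
move=> hw hs; have [r0 hr0 H0] := future_perturb u hw.
have [r hr H] : exists2 r, 0 < r & forall t, 0 < t -> t <= r -> forall g, g \in s -> lorentz (w + t *: u) g < 0.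
  elim: s hs => [|k s IH] hs; first by exists 1.
  have [|r1 hr1 H1] := IH; first by move=> g hg; apply: hs; rewrite inE hg orbT.
  have [r2 hr2 H2] : exists2 r, 0 < r & forall t, 0 < t -> t <= r -> lorentz (w + t *: u) k < 0.
    case: (hs k (mem_head _ _)) => [/neg_perturb //|[h1 h2]].
    by exists 1 => // t ht _; rewrite !lorentz_lin h1 add0r pmulr_rlt0.
  exists (Num.min r1 r2); first by rewrite lt_min hr1.
  move=> t ht; rewrite le_min => /andP[t1 t2] g; rewrite inE => /orP[/eqP ->|hg]; first exact: H2.
  exact: H1.
exists (Num.min r0 r); split.
- by rewrite lt_min hr0.
- by apply: H0; rewrite ?lt_min ?hr0 // ge_min lexx.
- by apply: H; rewrite ?lt_min ?hr0 // ge_min lexx orbT.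
Qed.

(** The square norm of [e] in the orthonormal frame [z], [f], [cross z f]. Hence
    [lorentz e f ^+ 2 < 1], the crossing of the two lines, is read off from the products of [e] with
    [z] and the tangent vector [cross z f]. *)
Lemma lorentz_frame z f e : lorentz z z = -1 -> lorentz f f = 1 -> lorentz f z = 0 ->
  lorentz e e = 1 ->
  lorentz e (cross z f) ^+ 2 = 1 + lorentz e z ^+ 2 - lorentz e f ^+ 2.
Proof.
move=> hz hf hfz he; have := gram3_det e z f; rewrite lorentz_cross.
rewrite /gram3 he hz hf (lorentzC z f) hfz => h.
by rewrite -[LHS]opprK -h; ring.
Qed.

End Quadrilaterals.

(** * A generic quadrilateral is not cut by a mirror *)

Section NoCutting.
Variable R : realType.
Local Notation V := 'cV[R]_3.
Implicit Types (a b c d f g h z w u n : V) (x y : R).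
Variables (L : fieldType) (iota : {rmorphism L -> R}) (F : set R) (M : set V).

Definition rational_mirror f e1 e2 := exists l : L, lorentz f e1 * lorentz f e2 = iota l.

(* A unit vector f with products p, q with two adjacent normals has
   <f, n>^2 = kappa0 p q * (x^2 - 3/4) (right angle), resp. kappa1 p q * (x^2 - 3/4)
   (angle pi/3), for a suitably scaled n orthogonal to both. *)
Definition kappa0 (p q : R) := p ^+ 2 + q ^+ 2 - 1.
Definition kappa1 (p q : R) := 16 / 9 * (p ^+ 2 + q ^+ 2 + p * q) - 4 / 3.

(* F is the finite set of possible products of two crossing mirrors. The second and
   third conditions force a mirror crossing two adjacent sides through their vertex, the
   last two exclude mirrors crossing two opposite sides. *)
Definition generic_param x :=
  [/\ (exists l, x = iota l),
      forall p q l, F p -> F q ->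
        p ^+ 2 * kappa0 p q * (x ^+ 2 - 3 / 4) = iota l ^+ 2 -> p ^+ 2 * kappa0 p q = 0,
      forall p q l, F p -> F q ->
        p ^+ 2 * kappa1 p q * (x ^+ 2 - 3 / 4) = iota l ^+ 2 -> p ^+ 2 * kappa1 p q = 0,
      forall p q q', F p -> F q -> F q' -> 2 * x * p = q' - q -> p = 0 &
      ~ F (1 - (4 * (x + 1))^-1)].

Definition mirror_hyps a b c d :=
  [/\ (forall f, M f -> lorentz f f = 1),
      (forall f g, M f -> M g -> M (reflection f *m g)),
      [/\ M a, M b, M c & M d],
      (forall f, M f -> forall g h, g \in [:: a; b; c; d] -> h \in [:: a; b; c; d] ->
         rational_mirror f g h) &
      (forall f g, M f -> g \in [:: a; b; c; d] -> lorentz f g ^+ 2 < 1 -> F (lorentz f g))].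

Lemma mirror_hyps_rot a b c d : mirror_hyps a b c d -> mirror_hyps c d a b.
Proof.
have hp k : (k \in [:: c; d; a; b]) = (k \in [:: a; b; c; d]).
  by rewrite !inE; do 4 case: (k == _).
move=> [h1 h2 [m1 m2 m3 m4] h3 h4]; split=> //.
- by move=> f hf g h; rewrite !hp; apply: h3.
- by move=> f g hf; rewrite hp; apply: h4.
Qed.

Lemma mirror_hyps_flip a b c d : mirror_hyps a b c d -> mirror_hyps b a d c.
Proof.
have hp k : (k \in [:: b; a; d; c]) = (k \in [:: a; b; c; d]).
  by rewrite !inE; do 4 case: (k == _).
move=> [h1 h2 [m1 m2 m3 m4] h3 h4]; split=> //.
- by move=> f hf g h; rewrite !hp; apply: h3.
- by move=> f g hf; rewrite hp; apply: h4.
Qed.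

(** The component of [f] off the plane of [a] and [b] is measured by [phi = lorentz f n]. Its square
    is [kappa0] times [x ^+ 2 - 3 / 4], while [phi] times any coordinate of [f] lies in the field;
    genericity forces [phi = 0]. *)
Lemma right_corner a b c d x y f : quad_gram a b c d x y -> generic_param x ->
  mirror_hyps a b c d -> M f -> lorentz f a ^+ 2 < 1 -> lorentz f b ^+ 2 < 1 ->
  exists p q, f = p *: a + q *: b.
Proof.
move=> [[haa hbb hcc hdd] [hab hbc hcd hda] [hac hbd] [hx hy hxy]] [[lx hlx] gp0 gp1 gp2 gp3].
move=> [munit mrefl _ mrat mF] hf fa fb.
have D0 : 0 < x ^+ 2 - 3 / 4.
  have : 0 < (x - 1) * (x + 1) by apply: mulr_gt0; lra.
  lra.
have Dn : x ^+ 2 * 4 - 3 != 0 by apply: lt0r_neq0; lra.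
have Dn0 := lt0r_neq0 D0.
(* The orthogonal projection of [c] off the span of the orthonormal pair [a], [b]. *)
pose n := c + x *: a + 2^-1 *: b.
have na : lorentz n a = 0 by rewrite !lorentz_lin haa (lorentzC b a) hab (lorentzC c a) hac; ring.
have nb : lorentz n b = 0 by rewrite !lorentz_lin hbb hab (lorentzC c b) hbc; ring.
have nc : lorentz n c = - (x ^+ 2 - 3 / 4) by rewrite !lorentz_lin hcc hac hbc; field.
have en : n = c + x *: a + 2^-1 *: b by [].
clearbody n.
have hd : det3 a b c != 0.
  apply: det3_neq0; rewrite /gram3 haa hbb hcc hab hac hbc.
  rewrite (_ : _ + _ = - (x ^+ 2 - 3 / 4)); last by field.
  by rewrite oppr_eq0.
pose phi := lorentz f n.
have ef : f = lorentz f a *: a + lorentz f b *: b - (phi / (x ^+ 2 - 3 / 4)) *: n.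
  apply/eqP; rewrite -subr_eq0; apply/eqP; apply: (lorentz_sep hd).
  - by rewrite !lorentz_lin haa hab (lorentzC a n) na (lorentzC a f); ring.
  - by rewrite !lorentz_lin hbb (lorentzC b a) hab (lorentzC b n) nb (lorentzC b f); ring.
  - rewrite !lorentz_lin (lorentzC c a) (lorentzC c b) (lorentzC c n) nc hac hbc (lorentzC c f) /phi.
    by rewrite en !lorentz_lin; field; exact: Dn.
have phi2 : phi ^+ 2 = kappa0 (lorentz f a) (lorentz f b) * (x ^+ 2 - 3 / 4).
  have := munit _ hf; rewrite {2}ef !lorentz_lin -/phi /kappa0 => h.
  have : phi * phi / (x ^+ 2 - 3 / 4) = lorentz f a ^+ 2 + lorentz f b ^+ 2 - 1.
    rewrite -[X in _ = _ - X]h; field; exact: Dn.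
  move=> <-; field; exact: Dn.
have Fa : F (lorentz f a) by apply: mF => //; rewrite !inE eqxx.
have Fb : F (lorentz f b) by apply: mF => //; rewrite !inE eqxx orbT.
have rat g h := mrat f hf g h.
have phi_rat g : g \in [:: a; b; c; d] -> exists l, lorentz f g * phi = iota l.
  move=> hg; have [l1 e1] := rat g c hg (mem_nth 0 (isT : (2 < size [:: a; b; c; d])%N)).
  have [l2 e2] := rat g a hg (mem_nth 0 (isT : (0 < size [:: a; b; c; d])%N)).
  have [l3 e3] := rat g b hg (mem_nth 0 (isT : (1 < size [:: a; b; c; d])%N)).
  move: e1 e2 e3 => /= e1 e2 e3.
  exists (l1 + lx * l2 + 2^-1 * l3).
  rewrite !rmorphD !rmorphM fmorphV rmorph_nat -e1 -e2 -e3 -hlx /phi en !lorentz_lin; ring.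
suff phi0 : phi = 0.
  by exists (lorentz f a), (lorentz f b); rewrite {1}ef phi0 mul0r scale0r subr0.
apply/eqP; rewrite -sqrf_eq0 phi2.
(* Only [phi] times a coordinate is known to lie in the field, so a nonzero coordinate is needed. If
   both vanish, [kappa0] is -1 and [phi ^+ 2] would be negative. *)
have [fa0|fa0] := eqVneq (lorentz f a) 0; last first.
  have [l hl] := phi_rat a (mem_head _ _).
  have := gp0 _ _ l Fa Fb; rewrite -hl exprMn phi2 mulrA => /(_ erefl) /eqP.
  by rewrite mulf_eq0 sqrf_eq0 (negbTE fa0) /= => /eqP ->; rewrite mul0r.
have [fb0|fb0] := eqVneq (lorentz f b) 0; last first.
  have [l hl] := phi_rat b (mem_nth 0 (isT : (1 < size [:: a; b; c; d])%N)).
  have := gp0 _ _ l Fb Fa; rewrite -hl /= exprMn phi2 mulrA.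
  rewrite (_ : kappa0 (lorentz f b) _ = kappa0 (lorentz f a) (lorentz f b)); last by rewrite /kappa0; ring.
  by move=> /(_ erefl) /eqP; rewrite mulf_eq0 sqrf_eq0 (negbTE fb0) /= => /eqP ->; rewrite mul0r.
have := sqr_ge0 phi; rewrite phi2 fa0 fb0 /kappa0; lra.
Qed.

Lemma acute_corner a b c d x y f : quad_gram a b c d x y -> generic_param x ->
  mirror_hyps a b c d -> M f -> lorentz f b ^+ 2 < 1 -> lorentz f c ^+ 2 < 1 ->
  exists p q, f = p *: b + q *: c.
Proof.
move=> [[haa hbb hcc hdd] [hab hbc hcd hda] [hac hbd] [hx hy hxy]] [[lx hlx] gp0 gp1 gp2 gp3].
move=> [munit mrefl _ mrat mF] hf fb fc.
have D0 : 0 < x ^+ 2 - 3 / 4.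
  have : 0 < (x - 1) * (x + 1) by apply: mulr_gt0; lra.
  lra.
have Dn : x ^+ 2 * 4 - 3 != 0 by apply: lt0r_neq0; lra.
have Dn0 := lt0r_neq0 D0.
(* The orthogonal projection of [a] off the span of [b] and [c], whose Gram matrix has determinant
   3/4. *)
pose n := a + (2 * x / 3) *: b + (4 * x / 3) *: c.
have nb : lorentz n b = 0 by rewrite !lorentz_lin hbb hab (lorentzC c b) hbc; field.
have nc : lorentz n c = 0 by rewrite !lorentz_lin hcc hac hbc; field.
have na : lorentz n a = - (4 / 3 * (x ^+ 2 - 3 / 4)).
  by rewrite !lorentz_lin haa (lorentzC b a) hab (lorentzC c a) hac; field.
have en : n = a + (2 * x / 3) *: b + (4 * x / 3) *: c by [].
clearbody n.
have hd : det3 a b c != 0.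
  apply: det3_neq0; rewrite /gram3 haa hbb hcc hab hac hbc.
  rewrite (_ : _ + _ = - (x ^+ 2 - 3 / 4)); last by field.
  by rewrite oppr_eq0.
pose phi := lorentz f n.
have ef : f = (4 / 3 * (lorentz f b + lorentz f c / 2)) *: b + (4 / 3 * (lorentz f c + lorentz f b / 2)) *: c
     - (3 / 4 * phi / (x ^+ 2 - 3 / 4)) *: n.
  apply/eqP; rewrite -subr_eq0; apply/eqP; apply: (lorentz_sep hd).
  - rewrite !lorentz_lin hab hac (lorentzC a n) na (lorentzC a f) /phi.
    by rewrite en !lorentz_lin; field; exact: Dn.
  - by rewrite !lorentz_lin hbb hbc (lorentzC b n) nb (lorentzC b f); field.
  - by rewrite !lorentz_lin hcc (lorentzC c b) hbc (lorentzC c n) nc (lorentzC c f); field.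
have phi2 : phi ^+ 2 = kappa1 (lorentz f b) (lorentz f c) * (x ^+ 2 - 3 / 4).
  have := munit _ hf; rewrite {2}ef !lorentz_lin -/phi /kappa1 => h.
  have : phi * phi / (x ^+ 2 - 3 / 4) = 16 / 9 * (lorentz f b ^+ 2 + lorentz f c ^+ 2 + lorentz f b * lorentz f c) - 4 / 3.
    rewrite -[X in _ = _ - X]mulr1 -[X in _ = _ - _ * X]h; field; exact: Dn.
  move=> <-; field; exact: Dn.
have Fb : F (lorentz f b) by apply: mF => //; rewrite !inE eqxx orbT.
have Fc : F (lorentz f c) by apply: mF => //; rewrite !inE eqxx !orbT.
have rat g h := mrat f hf g h.
have phi_rat g : g \in [:: a; b; c; d] -> exists l, lorentz f g * phi = iota l.
  move=> hg; have [l1 e1] := rat g c hg (mem_nth 0 (isT : (2 < size [:: a; b; c; d])%N)).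
  have [l2 e2] := rat g a hg (mem_nth 0 (isT : (0 < size [:: a; b; c; d])%N)).
  have [l3 e3] := rat g b hg (mem_nth 0 (isT : (1 < size [:: a; b; c; d])%N)).
  move: e1 e2 e3 => /= e1 e2 e3.
  exists (l2 + (2 * lx / 3) * l3 + (4 * lx / 3) * l1).
  rewrite !rmorphD !rmorphM !fmorphV !rmorph_nat -e1 -e2 -e3 -hlx /phi en !lorentz_lin; ring.
suff phi0 : phi = 0.
  exists (4 / 3 * (lorentz f b + lorentz f c / 2)), (4 / 3 * (lorentz f c + lorentz f b / 2)).
  by rewrite {1}ef phi0 mulr0 mul0r scale0r subr0.
apply/eqP; rewrite -sqrf_eq0 phi2.
have [fb0|fb0] := eqVneq (lorentz f b) 0; last first.
  have [l hl] := phi_rat b (mem_nth 0 (isT : (1 < size [:: a; b; c; d])%N)).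
  have := gp1 _ _ l Fb Fc; rewrite -hl /= exprMn phi2 mulrA => /(_ erefl) /eqP.
  by rewrite mulf_eq0 sqrf_eq0 (negbTE fb0) /= => /eqP ->; rewrite mul0r.
have [fc0|fc0] := eqVneq (lorentz f c) 0; last first.
  have [l hl] := phi_rat c (mem_nth 0 (isT : (2 < size [:: a; b; c; d])%N)).
  have := gp1 _ _ l Fc Fb; rewrite -hl /= exprMn phi2 mulrA.
  rewrite (_ : kappa1 (lorentz f c) _ = kappa1 (lorentz f b) (lorentz f c)); last by rewrite /kappa1; ring.
  by move=> /(_ erefl) /eqP; rewrite mulf_eq0 sqrf_eq0 (negbTE fc0) /= => /eqP ->; rewrite mul0r.
have := sqr_ge0 phi; rewrite phi2 fb0 fc0 /kappa1; lra.
Qed.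

(** A line through an interior point and the common point of two sides crosses both of them there,
    hence in the same direction. *)
Lemma no_adjacent_exit f z u g h p q : f = p *: g + q *: h -> lorentz f f = 1 ->
  lorentz g z < 0 -> lorentz h z < 0 -> lorentz f z = 0 -> lorentz f u = 0 ->
  0 < lorentz g u -> lorentz h u < 0 -> False.
Proof.
move=> ef hf hg hh; rewrite ef !lorentz_lin => h1 h2 gu hu.
have e : p * (lorentz g u * lorentz h z - lorentz g z * lorentz h u) = 0.
  transitivity ((p * lorentz g u + q * lorentz h u) * lorentz h z - (p * lorentz g z + q * lorentz h z) * lorentz h u); first ring.
  by rewrite h1 h2; ring.
have hneg : lorentz g u * lorentz h z - lorentz g z * lorentz h u < 0.
  have : lorentz g u * lorentz h z < 0 by rewrite pmulr_rlt0.
  have : 0 < lorentz g z * lorentz h u by rewrite nmulr_rgt0.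
  lra.
have p0 : p = 0 by apply/eqP; move/eqP: e; rewrite mulf_eq0 (lt_eqF hneg) orbF.
have q0 : q = 0.
  by apply/eqP; move/eqP: h1; rewrite p0 mul0r add0r mulf_eq0 (lt_eqF hh) orbF.
by move/eqP: hf; rewrite ef p0 q0 !scale0r addr0 lorentz0l eq_sym oner_eq0.
Qed.

(* The line of f leaves the quadrilateral through the opposite sides on a and c. *)
Definition crosses_opposite a b c d f :=
  [/\ lorentz f a ^+ 2 < 1, lorentz f c ^+ 2 < 1, 1 <= lorentz f b ^+ 2, 1 <= lorentz f d ^+ 2 &
    exists w, [/\ future w, lorentz f w = 0, lorentz w a = 0 & [/\ lorentz w b < 0, lorentz w c < 0 & lorentz w d < 0]]].

(** Here [u] is the unit tangent of the line of [f] at [z]. A side [e] is crossed on the way to the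
    ideal point [z + u] when [- lorentz e z < lorentz e u], and on the way to [z - u] when
    [lorentz e u < lorentz e z]. Given a forward exit through [a], the corner lemmas forbid a
    backward exit through a neighbour of [a], then a forward exit through a neighbour of [c]. *)
Lemma cut_type_aux a b c d x y f z u :
  quad_gram a b c d x y -> compact_cone a b c d -> generic_param x -> generic_param y ->
  mirror_hyps a b c d -> M f -> interior_point a b c d z -> lorentz z z = -1 ->
  lorentz f z = 0 -> lorentz f u = 0 -> lorentz z u = 0 -> lorentz u u = 1 ->
  (forall e, lorentz e e = 1 -> lorentz e u ^+ 2 = 1 + lorentz e z ^+ 2 - lorentz e f ^+ 2) ->
  - lorentz a z < lorentz a u -> crosses_opposite a b c d f /\ lorentz c u < lorentz c z.
Proof.
move=> hq hcone gx gy mh hf [hz [za zb zc zd]] hzz fz fu zu uu frame au.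
have [munit _ _ _ _] := mh.
have [[haa hbb hcc hdd] _ _ _] := hq.
have ff := munit _ hf.
have az : lorentz a z < 0 by rewrite lorentzC.
have bz : lorentz b z < 0 by rewrite lorentzC.
have cz : lorentz c z < 0 by rewrite lorentzC.
have dz : lorentz d z < 0 by rewrite lorentzC.
have crs e : lorentz e e = 1 -> lorentz e z ^+ 2 < lorentz e u ^+ 2 -> lorentz f e ^+ 2 < 1.
  by move=> he; rewrite frame // (lorentzC f e); lra.
have ncrs e : lorentz e e = 1 -> lorentz e u ^+ 2 <= lorentz e z ^+ 2 -> 1 <= lorentz f e ^+ 2.
  by move=> he; rewrite frame // (lorentzC f e); lra.
have sqlt (p q : R) : p < 0 -> - p < q -> p ^+ 2 < q ^+ 2.
  by move=> hp hpq; rewrite -(sqrrN p) ltr_sqr ?nnegrE; lra.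
have fa : lorentz f a ^+ 2 < 1 by apply: crs => //; apply: sqlt.
have ab_corner := right_corner hq gx mh hf.
have da_corner := acute_corner (quad_gram_rot hq) gx (mirror_hyps_rot mh) hf.
have cd_corner := right_corner (quad_gram_rot hq) gx (mirror_hyps_rot mh) hf.
have bc_corner := acute_corner hq gx mh hf.
have au0 : 0 < lorentz a u by lra.
have sqN (p q : R) : p < 0 -> q < p -> p ^+ 2 < q ^+ 2.
  by move=> hp hpq; rewrite -(sqrrN q) -(sqrrN p) ltr_sqr ?nnegrE; lra.
have nb : ~ (lorentz b u < lorentz b z).
  move=> hbu; have [||p [q ef]] := ab_corner => //; first by apply: crs => //; apply: sqN.
  by apply: (@no_adjacent_exit f z u a b p q) => //; lra.
have nd : ~ (lorentz d u < lorentz d z).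
  move=> hbu; have [||p [q ef]] := da_corner => //; first by apply: crs => //; apply: sqN.
  by apply: (@no_adjacent_exit f z u a d q p) => //; [rewrite addrC|lra].
(* Otherwise no side is crossed backwards and the null vector [z - u] lies in the cone, against
   compactness. *)
have hc : lorentz c u < lorentz c z.
  rewrite ltNge; apply/negP => hcu.
  have nzu : lorentz (z - u) (z - u) = 0 by rewrite !lorentz_lin hzz uu (lorentzC u z) zu; ring.
  have : lorentz (z - u) (z - u) < 0.
    apply: hcone => //; first by apply: (null_lorentz_neg hz nzu); rewrite !lorentz_lin hzz zu; lra.
    - by rewrite !lorentz_lin (lorentzC z a) (lorentzC u a); lra.
    - by rewrite !lorentz_lin (lorentzC z b) (lorentzC u b); lra.
    - by rewrite !lorentz_lin (lorentzC z c) (lorentzC u c); lra.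
    - by rewrite !lorentz_lin (lorentzC z d) (lorentzC u d); lra.
  by rewrite nzu ltxx.
have fc : lorentz f c ^+ 2 < 1 by apply: crs => //; apply: sqN.
have nb' : ~ (- lorentz b z < lorentz b u).
  move=> hbu; have [||p [q ef]] := bc_corner => //; first by apply: crs => //; apply: sqlt.
  by apply: (@no_adjacent_exit f z u b c p q) => //; lra.
have nd' : ~ (- lorentz d z < lorentz d u).
  move=> hbu; have [||p [q ef]] := cd_corner => //; first by apply: crs => //; apply: sqlt.
  by apply: (@no_adjacent_exit f z u d c q p) => //; [rewrite addrC|lra|lra].
have sqle (p q : R) : ~ (- p < q) -> ~ (q < p) -> q ^+ 2 <= p ^+ 2.
  move=> /negP; rewrite -leNgt => h1 /negP; rewrite -leNgt => h2.
  by rewrite -subr_ge0 subr_sqr mulr_le0 //; lra.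
split=> //; split=> //.
- by apply: ncrs => //; apply: sqle.
- by apply: ncrs => //; apply: sqle.
(* The time at which the line reaches the side on [a]; it is less than 1, so the point [z + s *: u]
   is still timelike. *)
pose s := - lorentz a z / lorentz a u.
have s0 : 0 < s by rewrite divr_gt0 // oppr_gt0.
have s1 : s < 1 by rewrite ltr_pdivrMr // mul1r.
have bound e : lorentz e z < 0 -> lorentz e u <= - lorentz e z -> lorentz (z + s *: u) e < 0.
  move=> e1 e2; rewrite !lorentz_lin (lorentzC z e) (lorentzC u e).
  have : s * lorentz e u <= s * - lorentz e z by rewrite ler_pM2l.
  have : s * - lorentz e z < - lorentz e z by rewrite gtr_pMl // oppr_gt0.
  lra.
have le_of_not (p q : R) : ~ (p < q) -> q <= p by move=> /negP; rewrite -leNgt.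
exists (z + s *: u); split.
- have tl : lorentz (z + s *: u) (z + s *: u) < 0.
    rewrite !lorentz_lin hzz uu (lorentzC u z) zu.
    have : s * s < 1 by rewrite -expr2 expr_lt1 // ltW.
    lra.
  split=> //; rewrite -(timelike_lorentz_neg hz tl) !lorentz_lin hzz zu; lra.
- by rewrite !lorentz_lin fz fu; ring.
- rewrite !lorentz_lin (lorentzC z a) (lorentzC u a) /s; field; exact: lt0r_neq0.
- by split; apply: bound => //; [exact: le_of_not|lra|exact: le_of_not].
Qed.

(** The ideal endpoint [z + u] of the line of [f] is not in the compact polygon, so one of the four
    sides is crossed before it. Reversing [u] then gives the statement seen from the opposite
    side. *)
Lemma cut_type a b c d x y f z :
  quad_gram a b c d x y -> compact_cone a b c d -> generic_param x -> generic_param y ->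
  mirror_hyps a b c d -> M f -> interior_point a b c d z -> lorentz f z = 0 ->
  (crosses_opposite a b c d f /\ crosses_opposite c d a b f) \/
  (crosses_opposite b a d c f /\ crosses_opposite d c b a f).
Proof.
move=> hq hcone gx gy mh hf [hz zint] fz.
have [munit _ _ _ _] := mh.
have ff := munit _ hf.
wlog hzz : z hz zint fz / lorentz z z = -1.
  move=> H; have [r hr hrz] := future_normalize hz.
  have [h1 _] := hrz; apply: (H (r *: z)) => //.
  - exact: hyperbolic_future.
  - by case: zint => ? ? ? ?; split; rewrite !lorentz_lin pmulr_rlt0.
  - by rewrite !lorentz_lin fz mulr0.
pose u := cross z f.
have fu : lorentz f u = 0 by exact: lorentz_crossr.
have zu : lorentz z u = 0 by exact: lorentz_crossl.
have uu : lorentz u u = 1 by rewrite lorentz_crosscross (lorentzC z f) fz hzz ff; ring.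
have frame e : lorentz e e = 1 -> lorentz e u ^+ 2 = 1 + lorentz e z ^+ 2 - lorentz e f ^+ 2.
  exact: lorentz_frame.
have aux a' b' c' d' x' y' v : quad_gram a' b' c' d' x' y' -> compact_cone a' b' c' d' ->
  generic_param x' -> generic_param y' -> mirror_hyps a' b' c' d' -> interior_point a' b' c' d' z ->
  v = u \/ v = - u ->
  - lorentz a' z < lorentz a' v -> crosses_opposite a' b' c' d' f /\ lorentz c' v < lorentz c' z.
  move=> q1 q2 q3 q4 q5 q6 hv; apply: (cut_type_aux q1 q2 q3 q4 q5 hf q6) => //.
  - by case: hv => ->; rewrite ?lorentzNr fu ?oppr0.
  - by case: hv => ->; rewrite ?lorentzNr zu ?oppr0.
  - by case: hv => ->; rewrite ?lorentzNr ?lorentzNl uu ?opprK.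
  - by move=> e he; case: hv => ->; rewrite ?lorentzNr ?sqrrN frame.
have key a' b' c' d' x' y' : quad_gram a' b' c' d' x' y' -> compact_cone a' b' c' d' ->
  generic_param x' -> generic_param y' -> mirror_hyps a' b' c' d' -> interior_point a' b' c' d' z ->
  - lorentz a' z < lorentz a' u -> crosses_opposite a' b' c' d' f /\ crosses_opposite c' d' a' b' f.
  move=> q1 q2 q3 q4 q5 q6 ha.
  have [h1 h2] := aux _ _ _ _ _ _ u q1 q2 q3 q4 q5 q6 (or_introl erefl) ha; split=> //.
  have hN : - lorentz c' z < lorentz c' (- u) by rewrite lorentzNr; lra.
  by have [] := aux _ _ _ _ _ _ (- u) (quad_gram_rot q1) (compact_cone_rot q2) q3 q4
    (mirror_hyps_rot q5) (interior_rot q6) (or_intror erefl) hN.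
have nn : lorentz (z + u) (z + u) = 0.
  by rewrite !lorentz_lin hzz uu (lorentzC u z) zu; ring.
have n0 : 0 < (z + u) 0 0.
  by apply: (null_lorentz_neg hz nn); rewrite !lorentz_lin hzz zu; lra.
have hI : interior_point a b c d z by split.
case: (ltP (- lorentz a z) (lorentz a u)) => [ha|ha].
  by left; apply: (key _ _ _ _ x y hq hcone gx gy mh hI).
case: (ltP (- lorentz c z) (lorentz c u)) => [hc|hc].
  left; apply/and_comm; exact: (key _ _ _ _ x y (quad_gram_rot hq) (compact_cone_rot hcone)
    gx gy (mirror_hyps_rot mh) (interior_rot hI) hc).
case: (ltP (- lorentz b z) (lorentz b u)) => [hb|hb].
  right; exact: (key _ _ _ _ y x (quad_gram_flip hq) (compact_cone_flip hcone)
    gy gx (mirror_hyps_flip mh) (interior_flip hI) hb).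
case: (ltP (- lorentz d z) (lorentz d u)) => [hd|hd].
  right; apply/and_comm; exact: (key _ _ _ _ y x (quad_gram_flip (quad_gram_rot hq))
    (compact_cone_flip (compact_cone_rot hcone)) gy gx (mirror_hyps_flip (mirror_hyps_rot mh))
    (interior_flip (interior_rot hI)) hd).
have := hcone (z + u) n0 nn; rewrite nn ltxx !lorentz_lin !(lorentzC z) !(lorentzC u) => H.
by exfalso; apply: notF; apply: H; lra.
Qed.

(** A billiard argument: the mirror [f' = reflection a *m f] enters the polygon at the point where
    [f] leaves it, so it also runs from [a] to [c]. Its product with [c] differs from that of [f] by
    [2 * x * lorentz f a], which genericity allows only for [lorentz f a = 0]. *)
Lemma opposite_orthogonal a b c d x y f :
  quad_gram a b c d x y -> compact_cone a b c d -> generic_param x -> generic_param y ->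
  mirror_hyps a b c d -> M f -> crosses_opposite a b c d f -> lorentz f a = 0.
Proof.
move=> hq hcone gx gy mh hf [fa fc _ _ [w [hw fw wa [wb wc wd]]]].
have [[haa hbb hcc hdd] [hab hbc hcd hda] [hac hbd] [hx hy hxy]] := hq.
have [munit mrefl [ma mb mc md] mrat mF] := mh.
pose f' := reflection a *m f.
have hf' : M f' by apply: mrefl.
have ff' := munit _ hf'.
have f'a : lorentz f' a = - lorentz f a.
  by rewrite lorentz_reflectionl haa (lorentzC a f); ring.
have f'c : lorentz f' c = lorentz f c + 2 * x * lorentz f a.
  by rewrite lorentz_reflectionl hac (lorentzC a f); ring.
have f'w : lorentz f' w = 0 by rewrite lorentz_reflectionl fw (lorentzC a w) wa; ring.
clearbody f'.
(* The projection of [- a] to the line of [f'], pointing into the polygon. *)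
pose u := lorentz f' a *: f' - a.
have uf' : lorentz u f' = 0 by rewrite !lorentz_lin ff' (lorentzC a f'); ring.
have ua : lorentz u a < 0 by rewrite !lorentz_lin haa f'a; lra.
clearbody u.
have hs g : g \in [:: a; b; c; d] -> lorentz w g < 0 \/ lorentz w g = 0 /\ lorentz u g < 0.
  by rewrite !inE => /or4P[] /eqP ->; [right|left|left|left].
have [t [ht hfut hneg]] := interior_perturb hw hs.
have h1 : lorentz f' (w + t *: u) = 0 by rewrite !lorentz_lin f'w (lorentzC f') uf'; ring.
have hint : interior_point a b c d (w + t *: u).
  by split=> //; split; apply: hneg; rewrite !inE eqxx ?orbT.
have f'a1 : lorentz f' a ^+ 2 < 1 by rewrite f'a sqrrN.
case: (cut_type hq hcone gx gy mh hf' hint h1) => [[[_ f'c1 _ _ _] _]|[[_ _ + _ _] _]]; last by lra.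
have [_ _ _ gp2 _] := gx.
apply: (gp2 _ (lorentz f c) (lorentz f' c)).
- by apply: mF => //; rewrite !inE eqxx.
- by apply: mF => //; rewrite !inE eqxx !orbT.
- by apply: mF => //; rewrite !inE eqxx !orbT.
- by rewrite f'c; ring.
Qed.

(** Such an [f] is the common perpendicular of [a] and [c]. The reflected side [reflection f *m b]
    is again a mirror and crosses [d] with product [1 - (4 * (x + 1))^-1], the value excluded by
    [generic_param]. *)
Lemma crosses_oppositeF a b c d x y f :
  quad_gram a b c d x y -> compact_cone a b c d -> generic_param x -> generic_param y ->
  mirror_hyps a b c d -> M f -> crosses_opposite a b c d f -> crosses_opposite c d a b f -> False.
Proof.
move=> hq hcone gx gy mh hf h1 h2.
have fa := opposite_orthogonal hq hcone gx gy mh hf h1.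
have fc := opposite_orthogonal (quad_gram_rot hq) (compact_cone_rot hcone) gx gy (mirror_hyps_rot mh) hf h2.
have [[haa hbb hcc hdd] [hab hbc hcd hda] [hac hbd] [hx hy hxy]] := hq.
have [munit mrefl [ma mb mc md] mrat mF] := mh.
have ff := munit _ hf.
have x1 : x - 1 != 0 by apply: lt0r_neq0; lra.
have x2 : x + 1 != 0 by apply: lt0r_neq0; lra.
have xx : x ^+ 2 - 1 != 0 by rewrite (_ : _ - _ = (x - 1) * (x + 1)) ?mulf_neq0 //; ring.
have ey : y = 1 + (4 * (x - 1))^-1.
  have -> : y = 1 + (x - 1) * (y - 1) / (x - 1) by field.
  by rewrite hxy; field.
have hd : det3 a c f != 0.
  apply: det3_neq0; rewrite /gram3 haa hcc ff hac (lorentzC a f) (lorentzC c f) fa fc.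
  by rewrite (_ : _ + _ = - (x ^+ 2 - 1)) ?oppr_eq0 //; ring.
have ef : b = (x / (2 * (x ^+ 2 - 1))) *: a + (2 * (x ^+ 2 - 1))^-1 *: c + lorentz f b *: f.
  apply/eqP; rewrite -subr_eq0; apply/eqP; apply: (lorentz_sep hd).
  - by rewrite !lorentz_lin haa hab hac (lorentzC a f) fa; field.
  - by rewrite !lorentz_lin hcc (lorentzC c a) (lorentzC c b) hbc hac (lorentzC c f) fc; field.
  - by rewrite !lorentz_lin ff fa fc; ring.
have fbfd : lorentz f b * lorentz f d = - y + x / (4 * (x ^+ 2 - 1)).
  have := hbd; rewrite {1}ef !lorentz_lin (lorentzC a d) hda hcd => <-; field; exact: xx.
pose g := reflection f *m b.
have hg : M g by apply: mrefl.
have gd : lorentz g d = 1 - (4 * (x + 1))^-1.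
  rewrite lorentz_reflectionl hbd -mulrA fbfd ey; field; by rewrite xx x2 x1.
have [_ _ _ _ gp3] := gx; apply: gp3; rewrite -gd; apply: mF => //; first by rewrite !inE eqxx !orbT.
have h0 : 0 < (4 * (x + 1))^-1 by rewrite invr_gt0; lra.
have h3 : (4 * (x + 1))^-1 < 1 by rewrite invf_lt1; lra.
by rewrite gd expr_lt1 //; lra.
Qed.

Theorem no_cutting_mirror a b c d x y f z :
  quad_gram a b c d x y -> compact_cone a b c d -> generic_param x -> generic_param y ->
  mirror_hyps a b c d -> M f -> interior_point a b c d z -> lorentz f z <> 0.
Proof.
move=> hq hcone gx gy mh hf hz fz.
case: (cut_type hq hcone gx gy mh hf hz fz) => [[h1 h2]|[h1 h2]].
  exact: (crosses_oppositeF hq hcone gx gy mh hf h1 h2).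
exact: (crosses_oppositeF (quad_gram_flip hq) (compact_cone_flip hcone) gy gx (mirror_hyps_flip mh) hf h1 h2).
Qed.

End NoCutting.

(** * The translates of the quadrilateral cover the plane *)

Section Covering.
Variable R : realType.
Local Notation V := 'cV[R]_3.
Implicit Types (a b c d f g h z w u n : V) (x y : R) (Gam : set 'M[R]_3).

Lemma orthogonal_timelike z n : future z -> lorentz z n = 0 -> 0 <= lorentz n n.
Proof.
move=> hz hzn; rewrite leNgt; apply/negP => hn.
have h1 := timelike_lorentz_neg hz hn.
have hn' : lorentz (- n) (- n) < 0 by rewrite !lorentz_lin opprK.
have h2 := timelike_lorentz_neg hz hn'.
move: h1 h2; rewrite lorentzNr hzn oppr0 ltxx mxE oppr_gt0 => /esym/negbT h1 /esym/negbT h2.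
have h0 : n 0 0 = 0 by apply/eqP; rewrite eq_le -!leNgt in h1 h2 *; rewrite h1 h2.
move: hn; rewrite lorentzE h0.
have := sqr_ge0 (n 1 0); have := sqr_ge0 (n 2 0); lra.
Qed.

Lemma reverse_cauchy_schwarz z w : future z -> lorentz z z * lorentz w w <= lorentz z w ^+ 2.
Proof.
move=> hz; rewrite -subr_ge0 -lorentz_crosscross.
by apply: (orthogonal_timelike hz); exact: lorentz_crossl.
Qed.

Definition folds_into Gam (s : seq V) z :=
  exists2 A, Gam A & forall g, g \in s -> lorentz (A *m z) g <= 0.

Lemma folds_into_mem Gam s s' z : s =i s' -> folds_into Gam s z -> folds_into Gam s' z.
Proof. by move=> hs [A hA h]; exists A => // g; rewrite -hs; exact: h. Qed.

Lemma folds_into_step Gam s z A : is_subgroup Gam -> Gam A -> folds_into Gam s (A *m z) ->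
  folds_into Gam s z.
Proof.
move=> /subgroupP[_ _ hm _] hA [B hB h]; exists (B * A); first exact: hm.
by move=> g hg; rewrite -[B * A]/(B *m A) -mulmxA; exact: h.
Qed.

Lemma folds_into_id Gam a b c d z : is_subgroup Gam -> lorentz z a <= 0 -> lorentz z b <= 0 ->
  lorentz z c <= 0 -> lorentz z d <= 0 -> folds_into Gam [:: a; b; c; d] z.
Proof.
move=> /subgroupP[_ h1 _ _] *; exists 1 => // g; rewrite mul1mx !inE.
by move=> /or4P[] /eqP ->.
Qed.

(** Near a vertex the finite group of the vertex, here of order 4, brings the point into the angle.
    Each reflection raises the products with the far sides by a bounded multiple of [eps], which the
    slack [4 * x + 4 * y + 4] absorbs. *)
Lemma right_fold Gam a b c d x y z eps : quad_gram a b c d x y -> is_subgroup Gam ->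
  Gam (reflection a) -> Gam (reflection b) -> 0 < eps ->
  lorentz z a <= eps -> lorentz z b <= eps ->
  lorentz z c + (4 * x + 4 * y + 4) * eps <= 0 ->
  lorentz z d + (4 * x + 4 * y + 4) * eps <= 0 ->
  folds_into Gam [:: a; b; c; d] z.
Proof.
move=> [[haa hbb hcc hdd] [hab hbc hcd hda] [hac hbd] [hx hy hxy]] hG ha hb he za zb zc zd.
have xe : eps < x * eps by rewrite ltr_pMl.
have ye : eps < y * eps by rewrite ltr_pMl.
have stepb w : lorentz w a <= 0 -> lorentz w b <= eps ->
  lorentz w c + (2 * x + 4 * y + 2) * eps <= 0 -> lorentz w d + (2 * x + 4 * y + 2) * eps <= 0 ->
  folds_into Gam [:: a; b; c; d] w.
  move=> wa wb wc wd; case: (leP (lorentz w b) 0) => wb0.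
    by apply: folds_into_id => //; lra.
  apply: (folds_into_step hG hb).
  have ywb : y * lorentz w b <= y * eps by rewrite ler_pM2l //; lra.
  by apply: folds_into_id => //; rewrite lorentz_reflectionl (lorentzC b w) ?hbb ?hbc ?hbd ?(lorentzC b a) ?hab; lra.
case: (leP (lorentz z a) 0) => za0; first by apply: stepb => //; lra.
apply: (folds_into_step hG ha).
have xza : x * lorentz z a <= x * eps by rewrite ler_pM2l //; lra.
by apply: stepb; rewrite lorentz_reflectionl (lorentzC a z) ?haa ?hab ?hac ?(lorentzC a d) ?hda; lra.
Qed.

(** The same at an angle of pi/3, where up to three reflections, the longest element of the group of
    order 6, are needed. *)
Lemma acute_fold Gam a b c d x y z eps : quad_gram a b c d x y -> is_subgroup Gam ->
  Gam (reflection b) -> Gam (reflection c) -> 0 < eps ->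
  lorentz z b <= eps -> lorentz z c <= eps ->
  lorentz z a + (4 * x + 4 * y + 4) * eps <= 0 ->
  lorentz z d + (4 * x + 4 * y + 4) * eps <= 0 ->
  folds_into Gam [:: a; b; c; d] z.
Proof.
move=> [[haa hbb hcc hdd] [hab hbc hcd hda] [hac hbd] [hx hy hxy]] hG hb hc he zb zc za zd.
have xe : eps < x * eps by rewrite ltr_pMl.
have ye : eps < y * eps by rewrite ltr_pMl.
have stepb w : folds_into Gam [:: a; b; c; d] (reflection b *m w) -> folds_into Gam [:: a; b; c; d] w.
  exact: folds_into_step.
have stepc w : folds_into Gam [:: a; b; c; d] (reflection c *m w) -> folds_into Gam [:: a; b; c; d] w.
  exact: folds_into_step.
have Rb w : [/\ lorentz (reflection b *m w) a = lorentz w a,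
   lorentz (reflection b *m w) b = - lorentz w b,
   lorentz (reflection b *m w) c = lorentz w c + lorentz w b &
   lorentz (reflection b *m w) d = lorentz w d + 2 * y * lorentz w b].
  by rewrite !lorentz_reflectionl (lorentzC b w) hbb hbc hbd (lorentzC b a) hab; split; field.
have Rc w : [/\ lorentz (reflection c *m w) a = lorentz w a + 2 * x * lorentz w c,
   lorentz (reflection c *m w) b = lorentz w b + lorentz w c,
   lorentz (reflection c *m w) c = - lorentz w c &
   lorentz (reflection c *m w) d = lorentz w d].
  by rewrite !lorentz_reflectionl (lorentzC c w) hcc hcd (lorentzC c a) hac (lorentzC c b) hbc; split; field.
have le2 (t s : R) : 1 < t -> s <= eps -> t * s <= t * eps by move=> ht hs; rewrite ler_pM2l //; lra.
have xb := le2 x _ hx zb; have xc := le2 x _ hx zc; have yb := le2 y _ hy zb; have yc := le2 y _ hy zc.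
case: (leP (lorentz z b) 0) => b0.
  case: (leP (lorentz z c) 0) => c0; first by apply: folds_into_id => //; lra.
  apply stepc; have [w1 w2 w3 w4] := Rc z; move: (reflection c *m z) w1 w2 w3 w4 => w w1 w2 w3 w4.
  case: (leP (lorentz w b) 0) => b1; first by apply: folds_into_id => //; lra.
  have yb1 := le2 y (lorentz w b) hy.
  apply stepb; have [v1 v2 v3 v4] := Rb w; apply: folds_into_id => //; lra.
apply stepb; have [w1 w2 w3 w4] := Rb z; move: (reflection b *m z) w1 w2 w3 w4 => w w1 w2 w3 w4.
case: (leP (lorentz w c) 0) => c1; first by apply: folds_into_id => //; lra.
apply stepc; have [v1 v2 v3 v4] := Rc w; move: (reflection c *m w) v1 v2 v3 v4 => v v1 v2 v3 v4.
have e1 : x * lorentz w c = x * lorentz z c + x * lorentz z b by rewrite w3; ring.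
case: (leP (lorentz v b) 0) => b2; first by apply: folds_into_id => //; lra.
apply stepb; have [u1 u2 u3 u4] := Rb v.
have e2 : y * lorentz v b = y * lorentz z c by congr (_ * _); lra.
apply: folds_into_id => //; lra.
Qed.

(** The vector [a + c] is timelike of square norm [2 - 2 * x], so the product of [z] with it is at
    most [- sqrt (2 * (x - 1))]. The bound [(x - 1) / x] is less than half of that root and involves
    no root. *)
Lemma opposite_sides_apart a b c d x y v z : quad_gram a b c d x y ->
  interior_point a b c d v -> hyperbolic_plane z ->
  lorentz z (a + c) < 0 /\ (lorentz z a <= - ((x - 1) / x) \/ lorentz z c <= - ((x - 1) / x)).
Proof.
move=> [[haa hbb hcc hdd] _ [hac hbd] [hx hy hxy]] [hv [va vb vc vd]] hz.
have ww : lorentz (a + c) (a + c) < 0 by rewrite !lorentz_lin haa hcc (lorentzC c a) hac; lra.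
have fw : future (a + c).
  by split=> //; rewrite -(timelike_lorentz_neg hv ww) lorentzDr; lra.
have fz := hyperbolic_future hz; have zw := future_lorentz fz fw.
split=> //.
have := reverse_cauchy_schwarz (a + c) fz.
have -> : lorentz z z = -1 by case: hz.
rewrite !lorentzDl !lorentzDr haa hcc (lorentzC c a) hac => cs.
set C := (x - 1) / x.
have x0 : 0 < x by lra.
have C0 : 0 < C by rewrite divr_gt0 // subr_gt0.
have C2 : 2 * C ^+ 2 < x - 1.
  rewrite /C exprMn exprVn mulrA ltr_pdivrMr ?exprn_gt0 //.
  have -> : 2 * (x - 1) ^+ 2 = (x - 1) * (2 * (x - 1)) by ring.
  rewrite ltr_pM2l ?subr_gt0 //; have := sqr_ge0 (x - 1); lra.
case: (leP (lorentz z a) (- C)) => h1; first by left.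
case: (leP (lorentz z c) (- C)) => h2; first by right.
exfalso; move: zw cs; rewrite lorentzDr; set s := _ + _ => zw cs.
have hs : - s < 2 * C by rewrite /s; lra.
have : s ^+ 2 < (2 * C) ^+ 2.
  by rewrite -(sqrrN s) ltr_sqr ?nnegrE //; lra.
lra.
Qed.

(** The point of the orbit nearest to [v] would lie in the polygon. The infimum is only approached,
    here within [2 * m * eps]: reflecting in a side violated by more than [eps] would gain more than
    that, so all sides hold up to [eps]. Opposite sides being far apart, at most two adjacent ones
    can fail, and folding at their vertex concludes. *)
Lemma covering Gam a b c d x y v z : quad_gram a b c d x y -> interior_point a b c d v ->
  is_subgroup Gam -> (forall g, g \in [:: a; b; c; d] -> Gam (reflection g)) ->
  future z -> folds_into Gam [:: a; b; c; d] z.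
Proof.
move=> hq hv hG hr fz.
wlog hz : z fz / hyperbolic_plane z.
  move=> H; have [r r0 hrz] := future_normalize fz.
  have [A hA h] := H _ (hyperbolic_future hrz) hrz; exists A => // g hg.
  by have := h g hg; rewrite -scalemxAr lorentzZl pmulr_rle0.
have [hx1 hy1] : 1 < x /\ 1 < y by case: hq => _ _ _ [].
have [hv0 [va vb vc vd]] := hv.
have [hsub h1 hm hV] := (subgroupP _).1 hG.
pose C := Num.min ((x - 1) / x) ((y - 1) / y).
have C0 : 0 < C by rewrite lt_min !divr_gt0 //; lra.
have Cx : C <= (x - 1) / x by rewrite ge_min lexx.
have Cy : C <= (y - 1) / y by rewrite ge_min lexx orbT.
pose k := 4 * x + 4 * y + 4.
have k0 : 0 < k by rewrite /k; lra.
pose eps := C / k.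
have e0 : 0 < eps by rewrite divr_gt0.
have ke : k * eps = C by rewrite /eps mulrC divfK // gt_eqF.
pose m := Num.min (Num.min (- lorentz v a) (- lorentz v b)) (Num.min (- lorentz v c) (- lorentz v d)).
have m0 : 0 < m by rewrite !lt_min !oppr_gt0 va vb vc vd.
have hmg g : g \in [:: a; b; c; d] -> m <= - lorentz v g.
  by rewrite !inE => /or4P[] /eqP ->; rewrite !ge_min lexx ?orbT.
pose S := [set - lorentz (A *m z) v | A in Gam].
have fA A : Gam A -> future (A *m z) by move=> hA; apply: isom_future => //; exact: hsub.
have lbS : lbound S 0.
  by move=> _ [A hA <-]; rewrite oppr_ge0 ltW //; apply: future_lorentz => //; apply: fA.
have iS : has_inf S by split; [exists (- lorentz (1 *m z) v), 1|exists 0].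
have [|_ [A hA <-] hlt] := @inf_adherent _ S (2 * m * eps) _ iS; first by rewrite mulr_gt0 // mulr_gt0.
have smallA g : g \in [:: a; b; c; d] -> lorentz (A *m z) g <= eps.
  move=> hg; have hle : inf S <= - lorentz ((reflection g * A) *m z) v.
    apply: ge_inf; first by exists 0.
    by exists (reflection g * A) => //; apply: hm => //; apply: hr.
  move: hle; rewrite -[_ * A]/(_ *m A) -mulmxA lorentz_reflectionl (lorentzC g v) (lorentzC g (A *m z)) => hle.
  have h3 := hmg g hg; rewrite leNgt; apply/negP => hgt.
  have : eps * m <= lorentz (A *m z) g * - lorentz v g by apply: ler_pM; lra.
  lra.
apply: (folds_into_step hG hA).
have hw : hyperbolic_plane (A *m z) by have [_ H] := hsub _ hA; exact: H.
move: (A *m z) hw smallA => {fA}w hw smallA.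
have [_ ac] := opposite_sides_apart hq hv hw.
have [_ bd] := opposite_sides_apart (quad_gram_flip hq) (interior_flip hv) hw.
have sa : lorentz w a <= eps by apply: smallA; rewrite !inE eqxx.
have sb : lorentz w b <= eps by apply: smallA; rewrite !inE eqxx !orbT.
have sc : lorentz w c <= eps by apply: smallA; rewrite !inE eqxx !orbT.
have sd : lorentz w d <= eps by apply: smallA; rewrite !inE eqxx !orbT.
have ga : Gam (reflection a) by apply: hr; rewrite !inE eqxx.
have gb : Gam (reflection b) by apply: hr; rewrite !inE eqxx !orbT.
have gc : Gam (reflection c) by apply: hr; rewrite !inE eqxx !orbT.
have gd : Gam (reflection d) by apply: hr; rewrite !inE eqxx !orbT.
have rotm : [:: c; d; a; b] =i [:: a; b; c; d] by move=> g; rewrite !inE; do 4 case: (g == _).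
case: ac => h4; case: bd => h5.
- apply: (folds_into_mem rotm).
  by apply: (right_fold (quad_gram_rot hq) hG gc gd e0) => //; rewrite -/k ke; lra.
- by apply: (acute_fold hq hG gb gc e0) => //; rewrite -/k ke; lra.
- apply: (folds_into_mem rotm).
  by apply: (acute_fold (quad_gram_rot hq) hG gd ga e0) => //; rewrite -/k ke; lra.
- by apply: (right_fold hq hG ga gb e0) => //; rewrite -/k ke; lra.
Qed.

End Covering.

(** * Torsion of the polygon group *)

Section FiniteOrder.
Variable R : realType.
Local Notation V := 'cV[R]_3.
Implicit Types (a b c d f g h z w u : V) (x y : R) (Gam : set 'M[R]_3).

Definition quad_normals a b c d (i : 'I_4) : V := nth 0 [:: a; b; c; d] i.

Lemma ord4_ind (P : 'I_4 -> Prop) : P 0 -> P 1 -> P 2%:R -> P 3%:R -> forall i, P i.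
Proof.
move=> h0 h1 h2 h3 [[|[|[|[|//]]]] hi].
- by rewrite (_ : Ordinal hi = 0) //; exact/val_inj.
- by rewrite (_ : Ordinal hi = 1) //; exact/val_inj.
- by rewrite (_ : Ordinal hi = 2%:R) //; exact/val_inj.
- by rewrite (_ : Ordinal hi = 3%:R) //; exact/val_inj.
Qed.

Lemma quad_normals_mem a b c d i : quad_normals a b c d i \in [:: a; b; c; d].
Proof. by apply: mem_nth; case: i. Qed.

Lemma mem_quad_normals a b c d g : g \in [:: a; b; c; d] -> exists i, g = quad_normals a b c d i.
Proof.
by rewrite !inE => /or4P[] /eqP ->; [exists 0|exists 1|exists 2%:R|exists 3%:R].
Qed.

Lemma quad_normals_unit a b c d x y : quad_gram a b c d x y ->
  forall i, lorentz (quad_normals a b c d i) (quad_normals a b c d i) = 1.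
Proof. by move=> [[haa hbb hcc hdd] _ _ _]; apply: ord4_ind. Qed.

Lemma quad_normals_coxeter a b c d x y : quad_gram a b c d x y ->
  forall i j, i != j ->
  [\/ lorentz (quad_normals a b c d i) (quad_normals a b c d j) = 0,
      lorentz (quad_normals a b c d i) (quad_normals a b c d j) = - 2^-1 |
      lorentz (quad_normals a b c d i) (quad_normals a b c d j) <= -1].
Proof.
move=> [[haa hbb hcc hdd] [hab hbc hcd hda] [hac hbd] [hx hy _]].
apply: ord4_ind; apply: ord4_ind; rewrite ?eqxx // /quad_normals /= => _;
  rewrite ?hab ?hbc ?hcd ?hda ?hac ?hbd ?(lorentzC b a) ?(lorentzC c b) ?(lorentzC d c) ?(lorentzC a d) ?(lorentzC c a) ?(lorentzC d b)
   ?hab ?hbc ?hcd ?hda ?hac ?hbd;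
  by [constructor 1|constructor 2|constructor 3; lra].
Qed.

(** A word is a power of [C] or such a power times [A], because [A] conjugates [C] to its inverse
    [C ^+ 5]. The exponent 6 serves the vertex groups of order 4 and 6 at once. *)
Lemma dihedral_order (A B : 'M[R]_3) (s : seq bool) : A * A = 1 -> B * B = 1 -> (A * B) ^+ 6 = 1 ->
  (\prod_(i <- s) if i then A else B) ^+ 6 = 1.
Proof.
move=> hA hB hAB; set C := A * B; set P := \prod_(i <- s) _.
have AC : A * C = C ^+ 5 * A.
  have : C ^+ 5 * A * B = 1 by rewrite -mulrA -/C -exprSr.
  move=> h; have : C ^+ 5 * A = B by rewrite -[LHS]mulr1 -hB mulrA h mul1r.
  by move=> ->; rewrite /C mulrA hA mul1r.
have hBC : B = C ^+ 5 * A by rewrite -AC /C mulrA hA mul1r.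
have ACn n : A * C ^+ n = C ^+ (5 * n) * A.
  elim: n => [|n IH]; first by rewrite muln0 !expr0 mulr1 mul1r.
  by rewrite exprS mulrA AC -mulrA IH mulrA -exprD mulnS.
have AA n : A * (C ^+ n * A) = C ^+ (5 * n) by rewrite mulrA ACn -mulrA hA mulr1.
have [n [] ->] : exists n, P = C ^+ n \/ P = C ^+ n * A.
- rewrite /P; elim: s {P} => [|i s [n IH]]; first by exists 0%N; rewrite big_nil expr0; left.
  rewrite big_cons; case: i; [exists (5 * n)%N|exists (5 + 5 * n)%N].
    by case: IH => ->; [right; rewrite ACn|left; rewrite AA].
  by case: IH => ->; [right; rewrite hBC exprD -!mulrA ACn|left; rewrite hBC exprD -!mulrA AA].
- by rewrite -exprM mulnC exprM hAB expr1n.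
- rewrite (_ : 6%N = (2 * 3)%N) // exprM expr2 -mulrA AA -exprD.
  have -> : (n + 5 * n = 6 * n)%N by lia.
  by rewrite exprM hAB !expr1n.
Qed.

Lemma stabilizer_finite_order a b c d x y v z (A : 'M[R]_3) :
  quad_gram a b c d x y -> interior_point a b c d v ->
  polygon_group (quad_normals a b c d) A -> future z ->
  (forall g, g \in [:: a; b; c; d] -> lorentz z g <= 0) -> A *m z = z -> A ^+ 6 = 1.
Proof.
move=> hq hv /(polygon_groupP (quad_normals_unit hq))[w ->] {A} fz hz hwz.
have hun := quad_normals_unit hq.
set e := quad_normals a b c d in hun hwz *.
have hze i : lorentz z (e i) <= 0 by apply: hz; exact: quad_normals_mem.
have [|_ [w' <- hall]] := chamber_stabilizer hun (quad_normals_coxeter hq) hze (w := w).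
  by rewrite hwz.
have [[haa hbb hcc hdd] [hab hbc hcd hda] [hac hbd] [hx hy _]] := hq.
have [r hr hrz] := future_normalize fz.
have [ac _] := opposite_sides_apart hq hv hrz.
have [bd _] := opposite_sides_apart (quad_gram_flip hq) (interior_flip hv) hrz.
rewrite lorentzZl pmulr_rlt0 // lorentzDr in ac.
rewrite lorentzZl pmulr_rlt0 // lorentzDr in bd.
(* One side from each opposite pair, since [z] cannot lie on both. If [z] lies on neither, the
   default is harmless: the two chosen sides are adjacent in every case. *)
pose i : 'I_4 := if lorentz z a == 0 then 0 else 2%:R.
pose j : 'I_4 := if lorentz z b == 0 then 1 else 3%:R.
have hij k : lorentz z (e k) == 0 -> e k = e i \/ e k = e j.
  move: k; apply: ord4_ind; rewrite /e /quad_normals /= => /eqP h0.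
  - by left; rewrite /i h0 eqxx.
  - by right; rewrite /j h0 eqxx.
  - left; rewrite /i; case: eqP => // h1; exfalso; move: ac; rewrite h0 h1; lra.
  - right; rewrite /j; case: eqP => // h1; exfalso; move: bd; rewrite h0 h1; lra.
have hord : (reflection (e i) * reflection (e j)) ^+ 6 = 1.
  have h2 : lorentz (e i) (e j) = 0 \/ lorentz (e i) (e j) = - 2^-1.
    by rewrite /i /j; case: ifP => _; case: ifP => _; rewrite /e /quad_normals /=;
      rewrite ?hab ?(lorentzC a d) ?hda ?(lorentzC c b) ?hbc ?hcd; [left|right|right|left].
  case: h2 => h2.
    have := dihedral_comm hun h2; rewrite !ev_cons ev_nil !mulr1 => h3.
    have h4 : (reflection (e i) * reflection (e j)) ^+ 2 = 1.
      by rewrite mulrA in h3; rewrite expr2 !mulrA h3 reflection_sqr.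
    by rewrite (_ : 6%N = (2 * 3)%N) // exprM h4 expr1n.
  have := dihedral_braid hun h2; rewrite !ev_cons ev_nil !mulr1.
  set A := reflection (e i); set B := reflection (e j) => h3.
  have AA : A * A = 1 by apply: reflection_sqr.
  have BB : B * B = 1 by apply: reflection_sqr.
  have h4 : (A * B) ^+ 3 = 1.
    have -> : (A * B) ^+ 3 = (A * B) * (A * B) * (B * (A * (B * A))).
      by rewrite h3 !exprS expr0 mulr1 mulrA.
    by rewrite -!mulrA (mulrA B B) BB mul1r (mulrA A A) AA mul1r (mulrA B B) BB mul1r AA.
  by rewrite (_ : 6%N = (3 * 2)%N) // exprM h4 expr1n.
have [s hs] : exists s : seq bool, ev e w' = \prod_(k <- s) if k then reflection (e i) else reflection (e j).
  elim: w' hall => [|k w' IH] /=; first by move=> _; exists [::]; rewrite ev_nil big_nil.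
  case/andP=> hk /IH[s hs]; rewrite ev_cons hs.
  by case: (hij k hk) => ->; [exists (true :: s)|exists (false :: s)]; rewrite big_cons.
by rewrite hs; apply: dihedral_order => //; apply: reflection_sqr.
Qed.

(** By [covering], the fixed point can be conjugated into the closed polygon, where the stabilizer
    is known. *)
Lemma elliptic_finite_order a b c d x y v z (A : 'M[R]_3) :
  quad_gram a b c d x y -> interior_point a b c d v ->
  polygon_group (quad_normals a b c d) A -> future z -> A *m z = z -> A ^+ 6 = 1.
Proof.
move=> hq hv hA fz hAz.
set e := quad_normals a b c d in hA.
have hun := quad_normals_unit hq.
have hsub : is_subgroup (polygon_group e).
  by apply: generated_subgroup_is_subgroup => _ [i _ <-]; apply: reflection_isom.
have [hi h1 hm hV] := (subgroupP _).1 hsub.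
have [|B hB hfold] := covering hq hv hsub _ fz.
  move=> g /mem_quad_normals[i ->]; apply/(polygon_groupP hun).
  by exists [:: i]; rewrite ev_seq1.
have [uB _] := isom_inv (hi _ hB).
have h6 : (B * A * B^-1) ^+ 6 = 1.
  apply: (stabilizer_finite_order hq hv (z := B *m z)) => //.
  - by apply (hm _ _); [apply (hm _ _)|apply (hV _)].
  - by apply: isom_future => //; apply: hi.
  - have BK : B^-1 *m (B *m z) = z.
      by rewrite mulmxA -[B^-1 *m B]/(B^-1 * B) mulVr // mul1mx.
    by rewrite -[_ * B^-1]/(_ *m _) -[B * A]/(_ *m _) -!mulmxA BK hAz.
have hconj n : (B * A * B^-1) ^+ n = B * A ^+ n * B^-1.
  elim: n => [|n IH]; first by rewrite !expr0 mulr1 mulrV.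
  by rewrite !exprS IH !mulrA (mulrVK uB).
move: h6; rewrite hconj => h6.
have uBV : B^-1 \is a GRing.unit by rewrite unitrV.
by apply: (mulrI uB); apply: (mulIr uBV); rewrite h6 mulr1 mulrV.
Qed.

(** Two of the cosets of the powers of [g] coincide. *)
Lemma finite_index_power (H G : set 'M[R]_3) (g : 'M[R]_3) : is_subgroup H -> is_subgroup G ->
  finite_index_in H G -> G g -> exists2 n : nat, (0 < n)%N & H (g ^+ n).
Proof.
move=> /subgroupP[hi h1 hm hV] /subgroupP[gi g1 gm gV] [hsub hfin] hg.
have hpow n : G (g ^+ n) by elim: n => [|n IH]; rewrite ?expr0 ?exprS //; apply: gm.
pose F n := [set g ^+ n * h | h in H].
have [m [n [hmn hF]]] : exists m n, (m < n)%N /\ F m = F n.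
  apply: contrapT => hno.
  have hinj : injective F.
    move=> m n hmn; have [hlt|hlt|//] := ltngtP m n; exfalso; apply: hno.
      by exists m, n.
    by exists n, m.
  apply: infinite_nat.
  have hsubF : range F `<=` [set [set k * h | h in H] | k in G].
    by move=> _ [n _ <-]; exists (g ^+ n).
  have hf : finite_set (range F) := sub_finite_set hsubF hfin.
  have := @finite_preimage _ _ (range F) F (in2W hinj) hf.
  by apply: sub_finite_set => n _; exists n.
exists (n - m)%N; first by rewrite subn_gt0.
have : F n (g ^+ n) by exists 1; rewrite ?mulr1.
rewrite -hF => -[h hh e].
have [u _] := isom_inv (gi _ (hpow m)).
suff -> : g ^+ (n - m) = h by [].
by apply: (mulrI u); rewrite e -exprD subnKC // ltnW.
Qed.

End FiniteOrder.

(** * Powers of a product of two reflections *)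

Section Chebyshev.
Variable R : realType.
Implicit Types (t s : R).

(* cheb (z + z^-1) n = z^n + z^-n *)
Fixpoint cheb t (n : nat) : R :=
  if n is m.+1 then (if m is k.+1 then t * cheb t m - cheb t k else t) else 2.

Lemma chebSS t n : cheb t n.+2 = t * cheb t n.+1 - cheb t n. Proof. by []. Qed.

Lemma cheb_gt2 t n : 2 < t -> 2 <= cheb t n /\ cheb t n < cheb t n.+1.
Proof.
move=> ht; elim: n => [|n [h1 h2]]; first by split=> //=; lra.
split; first lra.
rewrite chebSS; have : 2 * cheb t n.+1 < t * cheb t n.+1 by rewrite ltr_pM2r //; lra.
lra.
Qed.

End Chebyshev.

Section PowerSums.
Variable R : realType.
Local Notation V := 'cV[R]_3.
Implicit Types (g h u : V).

Lemma power_sum_eigen (A B : 'M[R]_3) u t : A * B = 1 -> B * A = 1 ->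
  A *m u + B *m u = t *: u -> forall n, A ^+ n *m u + B ^+ n *m u = cheb t n *: u.
Proof.
move=> hAB hBA hu.
have key n : A ^+ n *m u + B ^+ n *m u = cheb t n *: u /\
             A ^+ n.+1 *m u + B ^+ n.+1 *m u = cheb t n.+1 *: u.
  elim: n => [|n [h1 h2]].
    by rewrite !expr0 !expr1 mul1mx hu -mulr2n -scaler_nat.
  split=> //; rewrite chebSS scalerBl -scalerA -h2 -h1.
  have e1 : A ^+ n.+2 = A ^+ n.+1 * (A + B) - A ^+ n.
    by rewrite mulrDr -exprSr [A ^+ n.+1 * B](_ : _ = A ^+ n) ?addrK // exprSr -mulrA hAB mulr1.
  have e2 : B ^+ n.+2 = B ^+ n.+1 * (A + B) - B ^+ n.
    by rewrite mulrDr -exprSr [B ^+ n.+1 * A](_ : _ = B ^+ n) 1?addrAC ?subrr ?add0r // exprSr -mulrA hBA mulr1.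
  rewrite e1 e2 !mulmxBl -[_ ^+ n.+1 * _]/(_ *m _) -[B ^+ n.+1 * _]/(_ *m _) -!mulmxA mulmxDl hu.
  by rewrite -!scalemxAr scalerDr opprD addrACA.
by move=> n; have [] := key n.
Qed.

(** When the mirrors cross at angle theta, [4 * lorentz g h ^+ 2 - 2] is [2 cos (2 theta)], the
    trace on the plane of [g] and [h] of the rotation by twice the angle; for disjoint mirrors it is
    the trace of a translation. *)
Lemma reflection_pair_eigen g h : lorentz g g = 1 -> lorentz h h = 1 ->
  let A := reflection g * reflection h in let B := reflection h * reflection g in
  A *m g + B *m g = (4 * lorentz g h ^+ 2 - 2) *: g /\
  A *m h + B *m h = (4 * lorentz g h ^+ 2 - 2) *: h.
Proof.
move=> hg hh A B; rewrite /A /B -[reflection g * _]/(_ *m _) -[reflection h * _]/(_ *m _) -!mulmxA.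
rewrite !reflectionE !lorentz_lin hg hh (lorentzC h g).
by split; apply: vec3P; rewrite !mxE; ring.
Qed.

Lemma reflection_pair_inverse g h : lorentz g g = 1 -> lorentz h h = 1 ->
  reflection g * reflection h * (reflection h * reflection g) = 1.
Proof. by move=> hg hh; rewrite -mulrA (mulrA (reflection h)) reflection_sqr // mul1r reflection_sqr. Qed.

Lemma inverse_pow (A B : 'M[R]_3) n : A * B = 1 -> A ^+ n * B ^+ n = 1.
Proof.
move=> h; elim: n => [|n IH]; first by rewrite mul1r.
by rewrite exprSr exprS mulrA -(mulrA _ A) h mulr1.
Qed.

End PowerSums.

(** * The rational structure spanned by the normals *)

Section Rationality.
Variable R : realType.
Local Notation V := 'cV[R]_3.
Implicit Types (f g h z u : V).
Variables (L : fieldType) (iota : {rmorphism L -> R}).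

Definition krational (s : R) := exists l, s = iota l.

Lemma krational_iota l : krational (iota l). Proof. by exists l. Qed.
Lemma krationalD s t : krational s -> krational t -> krational (s + t).
Proof. by move=> [l ->] [m ->]; exists (l + m); rewrite rmorphD. Qed.
Lemma krationalM s t : krational s -> krational t -> krational (s * t).
Proof. by move=> [l ->] [m ->]; exists (l * m); rewrite rmorphM. Qed.
Lemma krationalN s : krational s -> krational (- s).
Proof. by move=> [l ->]; exists (- l); rewrite rmorphN. Qed.
Lemma krationalB s t : krational s -> krational t -> krational (s - t).
Proof. by move=> hs ht; apply: krationalD => //; apply: krationalN. Qed.
Lemma krationalV s : krational s -> krational s^-1.
Proof. by move=> [l ->]; exists l^-1; rewrite fmorphV. Qed.
Lemma krational_div s t : krational s -> krational t -> krational (s / t).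
Proof. by move=> hs ht; apply: krationalM => //; apply: krationalV. Qed.
Lemma krational_nat n : krational n%:R.
Proof. by exists n%:R; rewrite rmorph_nat. Qed.
Lemma krational0 : krational 0. Proof. exact: (krational_nat 0). Qed.
Lemma krational1 : krational 1. Proof. exact: (krational_nat 1). Qed.
Lemma krationalX s n : krational s -> krational (s ^+ n).
Proof. by move=> [l ->]; exists (l ^+ n); rewrite rmorphXn. Qed.
Lemma krational_divK s t : t != 0 -> krational t -> krational (s * t) -> krational s.
Proof. by move=> t0 ht hst; rewrite -(mulfK t0 s); apply: krational_div. Qed.
Lemma krational_cheb t n : krational t -> krational (cheb t n).
Proof.
move=> ht; suff [] : krational (cheb t n) /\ krational (cheb t n.+1) by [].
elim: n => [|n [h1 h2]]; first by split=> //; exact: (krational_nat 2).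
by split=> //; rewrite chebSS; apply: krationalB => //; apply: krationalM.
Qed.

Variables (a b c d : V) (x y : R).
Hypotheses (hq : quad_gram a b c d x y) (hx : krational x) (hy : krational y).

(** A form over [L] of the three-dimensional space, which the polygon group preserves
    ([krational_ev]). *)
Definition krational_vec u := exists p q r, [/\ krational p, krational q, krational r &
  u = p *: a + q *: b + r *: c].

Lemma krational_vecD u v : krational_vec u -> krational_vec v -> krational_vec (u + v).
Proof.
move=> [p [q [r [hp hq' hr ->]]]] [p' [q' [r' [hp' hq'' hr' ->]]]].
exists (p + p'), (q + q'), (r + r'); split; try exact: krationalD.
by apply: vec3P; rewrite !mxE; ring.
Qed.

Lemma krational_vecZ s u : krational s -> krational_vec u -> krational_vec (s *: u).
Proof.
move=> hs [p [q [r [hp hq' hr ->]]]].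
exists (s * p), (s * q), (s * r); split; try exact: krationalM.
by apply: vec3P; rewrite !mxE; ring.
Qed.

Lemma krational_vecB u v : krational_vec u -> krational_vec v -> krational_vec (u - v).
Proof.
move=> hu hv; rewrite -scaleN1r; apply: krational_vecD => //; apply: krational_vecZ => //.
by apply: krationalN; exact: krational1.
Qed.

Lemma krational_veca : krational_vec a.
Proof.
exists 1, 0, 0; split; rewrite ?scale1r ?scale0r ?addr0 //;
  by [exact: krational1|exact: krational0].
Qed.
Lemma krational_vecb : krational_vec b.
Proof.
exists 0, 1, 0; split; rewrite ?scale1r ?scale0r ?addr0 ?add0r //;
  by [exact: krational1|exact: krational0].
Qed.
Lemma krational_vecc : krational_vec c.
Proof.
exists 0, 0, 1; split; rewrite ?scale1r ?scale0r ?addr0 ?add0r //;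
  by [exact: krational1|exact: krational0].
Qed.

Lemma det3_abc : det3 a b c != 0.
Proof.
case: hq => [[haa hbb hcc hdd] [hab hbc hcd hda] [hac hbd] [hx1 hy1 hxy]].
apply: det3_neq0; rewrite /gram3 haa hbb hcc hab hac hbc.
have : 0 < (x - 1) * (x + 1) by apply: mulr_gt0; lra.
by move=> h; apply: ltr0_neq0; lra.
Qed.

Lemma krational_vec_dual u : krational (lorentz u a) -> krational (lorentz u b) ->
  krational (lorentz u c) -> krational_vec u.
Proof.
case: (hq) => [[haa hbb hcc hdd] [hab hbc hcd hda] [hac hbd] [hx1 hy1 hxy]] ha hb hc.
have D0 : 0 < x ^+ 2 - 3 / 4.
  have : 0 < (x - 1) * (x + 1) by apply: mulr_gt0; lra.
  lra.
have Dn : x ^+ 2 * 4 - 3 != 0 by apply: lt0r_neq0; lra.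
(* Up to sign the coefficient of [u] along [c + x *: a + 2^-1 *: b], the vector orthogonal to [a]
   and [b], whose square norm is [- (x ^+ 2 - 3 / 4)]. *)
pose s := (lorentz u c + x * lorentz u a + 2^-1 * lorentz u b) / (x ^+ 2 - 3 / 4).
have r2 : krational 2^-1 by apply: krationalV; exact: krational_nat.
have hs : krational s.
  apply: krational_div; first by do 2?[apply: krationalD => //]; apply: krationalM.
  apply: krationalB; first exact: krationalX.
  by apply: krational_div; exact: krational_nat.
exists (lorentz u a - s * x), (lorentz u b - s * 2^-1), (- s); split.
- by apply: krationalB => //; apply: krationalM.
- by apply: krationalB => //; apply: krationalM.
- exact: krationalN.
apply/eqP; rewrite -subr_eq0; apply/eqP; apply: (lorentz_sep det3_abc).
- by rewrite !lorentz_lin haa hab hac (lorentzC a u) /s; field.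
- by rewrite !lorentz_lin hbb (lorentzC b a) hab hbc (lorentzC b u) /s; field.
- by rewrite !lorentz_lin hcc (lorentzC c a) (lorentzC c b) hbc hac (lorentzC c u) /s; field.
Qed.

Lemma krational_vecd : krational_vec d.
Proof.
case: (hq) => [[haa hbb hcc hdd] [hab hbc hcd hda] [hac hbd] [hx1 hy1 hxy]].
apply: krational_vec_dual; rewrite ?hda ?(lorentzC d b) ?hbd ?(lorentzC d c) ?hcd.
- by apply: krationalN; apply: krationalV; exact: krational_nat.
- exact: krationalN.
- exact: krational0.
Qed.

Lemma krational_lorentz u v : krational_vec u -> krational_vec v -> krational (lorentz u v).
Proof.
case: (hq) => [[haa hbb hcc hdd] [hab hbc hcd hda] [hac hbd] [hx1 hy1 hxy]].
move=> [p [q [r [hp hq' hr ->]]]] [p' [q' [r' [hp' hq'' hr' ->]]]].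
rewrite !lorentz_lin haa hbb hcc hab (lorentzC b a) hab hac (lorentzC c a) hac (lorentzC c b) hbc.
have h2 : krational (- 2^-1) by apply: krationalN; apply: krationalV; exact: krational_nat.
have hx' := krationalN hx; have h0 := krational0; have h1 := krational1.
by do 3?[do ?[apply: krationalD]; do ?[apply: krationalM => //]].
Qed.

Lemma krational_mem g : g \in [:: a; b; c; d] -> krational_vec g.
Proof.
rewrite !inE => /or4P[] /eqP ->; by [exact: krational_veca|exact: krational_vecb|exact: krational_vecc|exact: krational_vecd].
Qed.

Lemma krational_reflection g u : krational_vec g -> krational_vec u -> krational_vec (reflection g *m u).
Proof.
move=> hg hu; rewrite reflectionE; apply: krational_vecB => //; apply: krational_vecZ => //.
by apply: krationalM; [exact: krational_nat|apply: krational_lorentz].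
Qed.

Lemma krational_ev w u : krational_vec u -> krational_vec (ev (quad_normals a b c d) w *m u).
Proof.
move=> hu; elim: w => [|i w IH]; first by rewrite ev_nil mul1mx.
rewrite ev_cons -[_ * _]/(_ *m _) -mulmxA; apply: krational_reflection => //.
by apply: krational_mem; exact: quad_normals_mem.
Qed.

(** The quotient is needed because [det3 a b c] is a square root of [x ^+ 2 - 3 / 4], which need not
    lie in the field. *)
Lemma krational_det3 u v w : krational_vec u -> krational_vec v -> krational_vec w ->
  krational (det3 u v w / det3 a b c).
Proof.
move=> [p [q [r [hp hq' hr ->]]]] [p' [q' [r' [hp' hq'' hr' ->]]]] [p1 [q1 [r1 [hp1 hq1 hr1 ->]]]].
have -> : det3 (p *: a + q *: b + r *: c) (p' *: a + q' *: b + r' *: c) (p1 *: a + q1 *: b + r1 *: c)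
  = (p * (q' * r1 - r' * q1) - q * (p' * r1 - r' * p1) + r * (p' * q1 - q' * p1)) * det3 a b c.
  by rewrite /det3 !mxE; ring.
rewrite mulfK ?det3_abc //.
by apply: krationalD; [apply: krationalB|]; apply: krationalM => //; apply: krationalB; apply: krationalM.
Qed.

Lemma cramer3 u n0 n1 n2 : det3 n0 n1 n2 != 0 ->
  u = (det3 u n1 n2 / det3 n0 n1 n2) *: n0 + (det3 n0 u n2 / det3 n0 n1 n2) *: n1
      + (det3 n0 n1 u / det3 n0 n1 n2) *: n2.
Proof.
move=> h; apply: (scalerI h); rewrite !scalerDr !scalerA !(mulrC (det3 n0 n1 n2)) !divfK //.
by apply: vec3P; rewrite !mxE /det3; ring.
Qed.

End Rationality.

(** * Mirrors of a commensurable reflection group *)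

Section Commensurability.
Variable R : realType.
Local Notation V := 'cV[R]_3.
Implicit Types (f g h z u : V).
Variables (L : fieldType) (iota : {rmorphism L -> R}).
Variables (a b c d v0 : V) (x y : R).
Hypotheses (hq : quad_gram a b c d x y) (hv0 : interior_point a b c d v0).
Hypotheses (hx : krational iota x) (hy : krational iota y).
Local Notation Gam := (polygon_group (quad_normals a b c d)).
Local Notation rat := (krational iota).
Local Notation ratv := (krational_vec iota a b c).

Lemma polygon_subgroup : is_subgroup Gam.
Proof.
apply: generated_subgroup_is_subgroup => _ [i _ <-]; apply: reflection_isom.
exact: (quad_normals_unit hq).
Qed.

Lemma polygon_reflection g : g \in [:: a; b; c; d] -> Gam (reflection g).
Proof.
move=> /mem_quad_normals[i ->]; apply/(polygon_groupP (quad_normals_unit hq)).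
by exists [:: i]; rewrite ev_seq1.
Qed.

(* normal to the common perpendicular of the sides a and c *)
Definition axis_normal : V :=
  b - (x / (2 * (x ^+ 2 - 1))) *: a - (2 * (x ^+ 2 - 1))^-1 *: c.

Let bet := 1 + (4 * (x ^+ 2 - 1))^-1.

Let xx0 : 0 < x ^+ 2 - 1.
Proof.
case: (hq) => _ _ _ [hx1 _ _].
have : 0 < (x - 1) * (x + 1) by apply: mulr_gt0; lra.
lra.
Qed.

Lemma axis_normalE : [/\ lorentz axis_normal a = 0, lorentz axis_normal c = 0,
  lorentz axis_normal b = bet, lorentz axis_normal d = - bet &
  lorentz axis_normal axis_normal = bet].
Proof.
case: (hq) => [[haa hbb hcc hdd] [hab hbc hcd hda] [hac hbd] [hx1 hy1 hxy]].
have xxn := lt0r_neq0 xx0.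
have x1 : x - 1 != 0 by apply: lt0r_neq0; lra.
have ey : y = 1 + (4 * (x - 1))^-1.
  have -> : y = 1 + (x - 1) * (y - 1) / (x - 1) by field.
  by rewrite hxy; field.
have na : lorentz axis_normal a = 0.
  by rewrite !lorentz_lin haa (lorentzC b a) hab (lorentzC c a) hac; field.
have nc : lorentz axis_normal c = 0.
  by rewrite !lorentz_lin hcc hbc hac; field.
have nb : lorentz axis_normal b = bet.
  by rewrite !lorentz_lin hbb hab (lorentzC c b) hbc /bet; field.
split=> //.
- rewrite !lorentz_lin hbd (lorentzC a d) hda hcd /bet ey; field.
  by rewrite xxn x1.
- transitivity (lorentz axis_normal (b - (x / (2 * (x ^+ 2 - 1))) *: a - (2 * (x ^+ 2 - 1))^-1 *: c)) => //.
  move: na nb nc; move: axis_normal => n na nb nc.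
  by rewrite !lorentz_lin na nb nc; ring.
Qed.

Let bet0 : 0 < bet.
Proof. by have h := xx0; rewrite /bet ltr_wpDr // invr_ge0; lra. Qed.

Let bet1 : 1 < bet.
Proof. by have h := xx0; rewrite /bet ltrDl invr_gt0; lra. Qed.

Let rat_bet : rat bet.
Proof.
apply: krationalD; first exact: krational1.
apply: krationalV; apply: krationalM; first exact: krational_nat.
by apply: krationalB; [apply: krationalX|exact: krational1].
Qed.

Lemma krational_axis_normal : ratv axis_normal.
Proof.
have h : rat (2 * (x ^+ 2 - 1)).
  apply: krationalM; first exact: krational_nat.
  by apply: krationalB; [apply: krationalX|exact: krational1].
apply: krational_vecB; first apply: krational_vecB.
- exact: krational_vecb.
- apply: krational_vecZ; last exact: krational_veca.
  exact: krational_div.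
- apply: krational_vecZ; last exact: krational_vecc.
  exact: krationalV.
Qed.

Variable Gam' : set 'M[R]_3.
Hypotheses (hG' : is_subgroup Gam') (hfin : finite_index_in Gam Gam').

Let gi' : Gam' `<=` @isom_group R. Proof. by case/subgroupP: hG'. Qed.
Let gm' A B : Gam' A -> Gam' B -> Gam' (A * B). Proof. by case/subgroupP: hG' => _ _ h _; exact: h. Qed.
Let gV' A : Gam' A -> Gam' A^-1. Proof. by case/subgroupP: hG' => _ _ _ h; exact: h. Qed.
Let gsub A : Gam A -> Gam' A. Proof. by case: hfin => h _; exact: h. Qed.

(* Conjugates of the translation r_a r_c have a power in the polygon group,
   whose axis is therefore defined over the field. *)
Lemma krational_axis (A : 'M[R]_3) u w : Gam' A -> ratv u -> ratv w ->
  rat (lorentz (A *m axis_normal) u * lorentz (A *m axis_normal) w).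
Proof.
move=> hA hu hw.
have [na nc nb nd nn] := axis_normalE; have hrn := krational_axis_normal.
move: axis_normal na nc nb nd nn hrn => n na nc nb nd nn hrn.
have [[haa hbb hcc hdd] [hab hbc hcd hda] [hac hbd] [hx1 hy1 hxy]] := hq.
have [uA _] := isom_inv (gi' hA).
pose T := reflection a * reflection c; pose T' := reflection c * reflection a.
have ga : Gam (reflection a) by apply: polygon_reflection; rewrite !inE eqxx.
have gc : Gam (reflection c) by apply: polygon_reflection; rewrite !inE eqxx ?orbT.
have TT' : T * T' = 1 by apply: reflection_pair_inverse.
have T'T : T' * T = 1 by apply: reflection_pair_inverse.
have hB : Gam' (A * T * A^-1).
  by apply (gm' (gm' hA (gm' (gsub ga) (gsub gc))) (gV' hA)).
have [N N0 hN] := finite_index_power polygon_subgroup hG' hfin hB.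
have hconj n0 S : (A * S * A^-1) ^+ n0 = A * S ^+ n0 * A^-1.
  elim: n0 => [|n0 IH]; first by rewrite !expr0 mulr1 mulrV.
  by rewrite !exprS IH !mulrA (mulrVK uA).
pose t := 4 * x ^+ 2 - 2.
have t2 : 2 < t by have h := xx0; rewrite /t; lra.
have tau2 : 2 < cheb t N.
  by case: N N0 {hN} => // N _; have [h1 h2] := cheb_gt2 N t2; lra.
have rt : rat (cheb t N).
  apply: krational_cheb; apply: krationalB; last exact: krational_nat.
  by apply: krationalM; [exact: krational_nat|apply: krationalX].
have [Ta Tc] := reflection_pair_eigen haa hcc.
rewrite hac sqrrN -/t -/T -/T' in Ta Tc.
have Pa := power_sum_eigen TT' T'T Ta N.
have Pc := power_sum_eigen TT' T'T Tc N.
have fixn g : lorentz g n = 0 -> reflection g *m n = n.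
  by move=> h; rewrite reflectionE h mulr0 scale0r subr0.
have Rna : reflection a *m n = n by apply: fixn; rewrite lorentzC.
have Rnc : reflection c *m n = n by apply: fixn; rewrite lorentzC.
have Tn k : T ^+ k *m n = n.
  elim: k => [|k IH]; first by rewrite mul1mx.
  by rewrite exprS -[_ * _]/(_ *m _) -mulmxA IH -[T]/(reflection a *m reflection c) -mulmxA Rnc Rna.
have T'n k : T' ^+ k *m n = n.
  elim: k => [|k IH]; first by rewrite mul1mx.
  by rewrite exprS -[_ * _]/(_ *m _) -mulmxA IH -[T']/(reflection c *m reflection a) -mulmxA Rna Rnc.
have hd : det3 a c n != 0.
  apply: det3_neq0; rewrite /gram3 haa hcc nn hac (lorentzC a n) (lorentzC c n) na nc.
  rewrite (_ : _ + _ = - (bet * (x ^+ 2 - 1))); last by ring.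
  by rewrite oppr_eq0 mulf_neq0 // lt0r_neq0.
have bn := lt0r_neq0 bet0.
(* The sum of the two powers is the scalar [cheb t N] on the span of [a] and [c] and the scalar 2 on
   the orthogonal vector [n]. *)
have key w0 : T ^+ N *m w0 + T' ^+ N *m w0 = cheb t N *: w0 + ((2 - cheb t N) * lorentz n w0 / bet) *: n.
  move: (Tn N) (T'n N) Pa Pc; move: (T ^+ N) (T' ^+ N) (cheb t N) => Q Q' tau Qn Q'n Pa Pc.
  have e := cramer3 w0 hd.
  have en : det3 a c w0 / det3 a c n = lorentz n w0 / bet.
    rewrite {2}e !lorentz_lin na nc nn; field; by rewrite bn hd.
  rewrite en in e; set p := _ / _ in e; set q := det3 a _ _ / _ in e; set r := _ / bet in e.
  have -> : (2 - tau) * lorentz n w0 / bet = (2 - tau) * r by rewrite /r mulrA.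
  clearbody p q r; rewrite e !mulmxDr -!scalemxAr Qn Q'n.
  transitivity (p *: (Q *m a + Q' *m a) + q *: (Q *m c + Q' *m c) + (2 * r) *: n).
    move: (Q *m a) (Q' *m a) (Q *m c) (Q' *m c) => u1 u2 u3 u4.
    by apply: vec3P; rewrite !mxE; ring.
  by rewrite Pa Pc; apply: vec3P; rewrite !mxE; ring.
have key2 : (A * T * A^-1) ^+ N *m u + (A * T' * A^-1) ^+ N *m u =
   cheb t N *: u + ((2 - cheb t N) * lorentz (A *m n) u / bet) *: (A *m n).
  have AVK w0 : A *m (A^-1 *m w0) = w0 by rewrite mulmxA -[A *m _]/(A * _) mulrV // mul1mx.
  rewrite !hconj -![_ * A^-1]/(_ *m _) -![A * _]/(_ *m _) -!mulmxA -mulmxDr key mulmxDr -!scalemxAr AVK.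
  by rewrite -(proj1 (gi' hA) n (A^-1 *m u)) AVK.
have hBinv : ((A * T * A^-1) ^+ N)^-1 = (A * T' * A^-1) ^+ N.
  have uB : (A * T * A^-1) ^+ N \is a GRing.unit by have [] := isom_inv (gi' (gsub hN)).
  apply: (mulrI uB); rewrite mulrV // inverse_pow //.
  have conjM S S' : A * S * A^-1 * (A * S' * A^-1) = A * (S * S') * A^-1.
    by rewrite !mulrA (mulrVK uA).
  by rewrite conjM TT' mulr1 mulrV.
have [w1 hw1] := (polygon_groupP (quad_normals_unit hq) _).1 hN.
have hrB1 : ratv ((A * T * A^-1) ^+ N *m u) by rewrite hw1; apply: (krational_ev hq hx hy).
have hrB2 : ratv ((A * T' * A^-1) ^+ N *m u).
  by rewrite -hBinv hw1 (evV (quad_normals_unit hq)); apply: (krational_ev hq hx hy).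
have hr := krational_lorentz hq hx (krational_vecD hrB1 hrB2) hw.
rewrite key2 !lorentz_lin in hr.
(* What remains after subtracting the scalar part is a multiple of the projection to the axis
   normal, with nonzero factor because [cheb t N > 2] for a translation. *)
have hr2 := krationalB hr (krationalM rt (krational_lorentz hq hx hu hw)).
have c0 : (2 - cheb t N) / bet != 0.
  by rewrite mulf_neq0 ?invr_eq0 // subr_eq0 lt_eqF.
apply: (krational_divK c0).
  by apply: krational_div => //; apply: krationalB => //; exact: krational_nat.
suff -> : forall p q, p * q * ((2 - cheb t N) / bet) = cheb t N * lorentz u w + (2 - cheb t N) * p / bet * q - cheb t N * lorentz u w by [].
by move=> p q; field.
Qed.

(** The axis normals [n], [n1], [n2] form a rational basis, and [f] sends them to axis normals of
    conjugate translations, rational up to scalars [c0], [c1], [c2]. Once these scalars are in the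
    field, the reflection preserves the rational structure, and [lorentz (reflection f *m u) w]
    exhibits the product. *)
Lemma krational_mirror_products f u w : lorentz f f = 1 -> Gam' (reflection f) ->
  ratv u -> ratv w -> rat (lorentz f u * lorentz f w).
Proof.
move=> ff hf.
have [na nc nb nd nn] := axis_normalE; have hrn := krational_axis_normal.
have hax := krational_axis.
move: axis_normal na nc nb nd nn hrn hax => n na nc nb nd nn hrn hax.
have [[haa hbb hcc hdd] [hab hbc hcd hda] [hac hbd] [hx1 hy1 hxy]] := hq.
have gb : Gam' (reflection b) by apply: gsub; apply: polygon_reflection; rewrite !inE eqxx ?orbT.
have gd : Gam' (reflection d) by apply: gsub; apply: polygon_reflection; rewrite !inE eqxx ?orbT.
have n1E : reflection b *m n = n - (2 * bet) *: b by rewrite reflectionE lorentzC nb.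
have n2E : reflection d *m n = n + (2 * bet) *: d.
  by rewrite reflectionE lorentzC nd mulrN scaleNr opprK.
pose n1 := reflection b *m n; pose n2 := reflection d *m n.
have hrn1 : ratv n1 by apply: (krational_reflection hq hx) => //; exact: krational_vecb.
have hrn2 : ratv n2 by apply: (krational_reflection hq hx) => //; exact: (krational_vecd hq hx hy).
have n1n1 : lorentz n1 n1 = bet by rewrite lorentz_reflection.
have n2n2 : lorentz n2 n2 = bet by rewrite lorentz_reflection.
have nn1 : lorentz n n1 = bet * (1 - 2 * bet) by rewrite lorentzC lorentz_reflectionl (lorentzC b n) nn nb; ring.
have nn2 : lorentz n n2 = bet * (1 - 2 * bet) by rewrite lorentzC lorentz_reflectionl (lorentzC d n) nn nd; ring.
have hdet : det3 n n1 n2 != 0.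
  have -> : det3 n n1 n2 = - (4 * bet ^+ 2) * det3 n b d.
    by rewrite /n1 /n2 n1E n2E /det3 !mxE; ring.
  rewrite mulf_neq0 //; first by apply: ltr0_neq0; have : 0 < bet ^+ 2 by [apply: exprn_gt0]; lra.
  apply: det3_neq0; rewrite /gram3 nn nb nd hbb hdd hbd.
  have xxn := lt0r_neq0 xx0.
  have x1 : x - 1 != 0 by apply: lt0r_neq0; lra.
  have x2 : x + 1 != 0 by apply: lt0r_neq0; lra.
  have y1 : 1 - y != 0 by apply: ltr0_neq0; lra.
  have ey : y = 1 + (4 * (x - 1))^-1.
    have -> : y = 1 + (x - 1) * (y - 1) / (x - 1) by field.
    by rewrite hxy; field.
  have e1 : 1 + y - 2 * bet = (4 * (x + 1))^-1.
    by rewrite /bet ey; field; rewrite x1 xxn x2.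
  have -> : bet * (1 * 1 - (- y) ^+ 2) - bet * (bet * 1 - - y * - bet) + - bet * (bet * - y - 1 * - bet)
     = bet * (1 - y) * (1 + y - 2 * bet) by ring.
  rewrite e1 mulf_neq0 ?mulf_neq0 ?(lt0r_neq0 bet0) // invr_eq0 mulf_neq0 //.
pose P (w0 : V) : V := reflection f *m w0.
have PP w0 w1 : lorentz (P w0) (P w1) = lorentz w0 w1 by apply: lorentz_reflection.
(* By [krational_axis], multiplying the vector by one of its own nonzero coordinates makes all its
   coordinates rational. *)
have scale A : Gam' A -> exists2 s, s != 0 & ratv (s *: (A *m n)).
  move=> hA; have hh := fun u w hu hw => hax A u w hA hu hw.
  have [hma hmb hmc] : [/\ ratv a, ratv b & ratv c].
    by split; [exact: krational_veca|exact: krational_vecb|exact: krational_vecc].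
  have sc g : ratv g -> lorentz (A *m n) g != 0 -> exists2 s, s != 0 & ratv (s *: (A *m n)).
    move=> hg h0; exists (lorentz (A *m n) g) => //.
    by apply: (krational_vec_dual hq hx); rewrite lorentzZl; exact: hh.
  have [h0|h0] := eqVneq (lorentz (A *m n) a) 0; last exact: (sc a).
  have [h1|h1] := eqVneq (lorentz (A *m n) b) 0; last exact: (sc b).
  have [h2|h2] := eqVneq (lorentz (A *m n) c) 0; last exact: (sc c).
  have hz : A *m n = 0.
    by apply: (lorentz_sep (det3_abc hq)); rewrite lorentzC.
  have := proj1 (gi' hA) n n; rewrite hz lorentz0l nn => h3.
  by move: bet0; rewrite -h3 ltxx.
have PE A w0 : reflection f *m (A *m w0) = (reflection f * A) *m w0 by rewrite mulmxA.
have [c0 c00 r0] := scale _ hf.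
have [c1 c10 r1] := scale _ (gm' hf gb).
have [c2 c20 r2] := scale _ (gm' hf gd).
rewrite -PE -/n1 -/(P n1) in r1; rewrite -PE -/n2 -/(P n2) in r2; rewrite -/(P n) in r0.
have nu0 : bet * (1 - 2 * bet) != 0.
  by rewrite mulf_neq0 ?(lt0r_neq0 bet0) //; apply: ltr0_neq0; have := bet1; lra.
have rnu : rat (bet * (1 - 2 * bet)).
  by rewrite -nn1; apply: (krational_lorentz hq hx).
have r01 : rat (c0 * c1).
  apply: (krational_divK nu0) => //; have := krational_lorentz hq hx r0 r1.
  by rewrite !lorentz_lin PP nn1 mulrA.
have r02 : rat (c0 * c2).
  apply: (krational_divK nu0) => //; have := krational_lorentz hq hx r0 r2.
  by rewrite !lorentz_lin PP nn2 mulrA.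
have D0 := det3_abc hq.
have rd : rat (det3 n n1 n2 / det3 a b c) by apply: (krational_det3 hq).
have rd0 : det3 n n1 n2 / det3 a b c != 0 by rewrite mulf_neq0 ?invr_eq0.
(* The products of pairs leave a common square root undetermined; the determinant is of odd degree
   in the scalars and removes it. *)
have r012 : rat (c0 * c1 * c2).
  apply: (krational_divK rd0) => //.
  have := krational_det3 hq r0 r1 r2.
  rewrite det3Z det3_reflection // => /krationalN; by rewrite mulrN mulNr opprK mulrA.
have rc2 : rat c2.
  by apply: (krational_divK (mulf_neq0 c00 c10)) => //; rewrite mulrC.
have rc0 : rat c0 by apply: (krational_divK c20).
have rc1 : rat c1 by apply: (krational_divK c00) => //; rewrite mulrC.
have unscale s w0 : s != 0 -> rat s -> ratv (s *: w0) -> ratv w0.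
  move=> s0 rs rw; rewrite -(scale1r w0) -(mulVf s0) -scalerA; apply: krational_vecZ => //.
  exact: krationalV.
have {}r0 := unscale _ _ c00 rc0 r0.
have {}r1 := unscale _ _ c10 rc1 r1.
have {}r2 := unscale _ _ c20 rc2 r2.
have rdq w0 w1 w2 : ratv w0 -> ratv w1 -> ratv w2 -> rat (det3 w0 w1 w2 / det3 n n1 n2).
  move=> h0 h1 h2.
  have -> : det3 w0 w1 w2 / det3 n n1 n2 = (det3 w0 w1 w2 / det3 a b c) / (det3 n n1 n2 / det3 a b c).
    by field; rewrite D0 hdet.
  by apply: krational_div => //; apply: (krational_det3 hq).
have rP w0 : ratv w0 -> ratv (P w0).
  move=> hw0; rewrite (cramer3 w0 hdet) /P !mulmxDr -!scalemxAr.
  by apply: krational_vecD; [apply: krational_vecD|]; apply: krational_vecZ => //; apply: rdq.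
move=> hu hw; have := krational_lorentz hq hx (rP _ hu) hw.
rewrite lorentz_reflectionl => /(krationalB (krational_lorentz hq hx hu hw)).
rewrite opprB addrCA subrr addr0 -mulrA => h.
apply: (@krational_divK _ _ iota _ 2) => //; first exact: krational_nat.
by rewrite mulrC.
Qed.

End Commensurability.

(** * Mirrors of an overgroup are translates of the sides *)

Section Maximality.
Variable R : realType.
Local Notation V := 'cV[R]_3.
Implicit Types (f g h z u : V).
Variables (L : fieldType) (iota : {rmorphism L -> R}).

(* cosines of the angles at which two mirrors of a discrete group can cross *)
Definition angle_cosines : set R := [set s |
  [/\ s ^+ 2 < 1, krational iota (s ^+ 2) &
    exists2 m : nat, (0 < m)%N & cheb (4 * s ^+ 2 - 2) m = 2]].

Variables (a b c d v0 : V) (x y : R).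
Hypotheses (hq : quad_gram a b c d x y) (hv0 : interior_point a b c d v0).
Hypotheses (hx : krational iota x) (hy : krational iota y).
Local Notation Gam := (polygon_group (quad_normals a b c d)).

Variable Gam' : set 'M[R]_3.
Hypotheses (hG' : is_subgroup Gam') (hfin : finite_index_in Gam Gam').

Let gi' : Gam' `<=` @isom_group R. Proof. by case/subgroupP: hG'. Qed.
Let gm' A B : Gam' A -> Gam' B -> Gam' (A * B). Proof. by case/subgroupP: hG' => _ _ h _; exact: h. Qed.
Let gV' A : Gam' A -> Gam' A^-1. Proof. by case/subgroupP: hG' => _ _ _ h; exact: h. Qed.
Let gsub A : Gam A -> Gam' A. Proof. by case: hfin => h _; exact: h. Qed.

Definition mirrors : set V := [set f | lorentz f f = 1 /\ Gam' (reflection f)].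

Lemma mirrors_image A f : Gam' A -> mirrors f -> mirrors (A *m f).
Proof.
move=> hA [h1 h2]; split; first by rewrite (proj1 (gi' hA)).
by rewrite reflection_conj; [apply: gm'; [apply: gm'|apply: gV']|exact: gi'].
Qed.

(** The product of the two reflections is a rotation about the crossing point. Some power of it lies
    in the polygon group, where [elliptic_finite_order] bounds the order of an element fixing a
    point. *)
Lemma crossing_mirrors_finite_order f g : mirrors f -> mirrors g -> lorentz f g ^+ 2 < 1 ->
  exists2 m : nat, (0 < m)%N & cheb (4 * lorentz f g ^+ 2 - 2) m = 2.
Proof.
move=> [ff hf] [gg hg] hfg.
pose T := reflection f * reflection g; pose T' := reflection g * reflection f.
have TT' : T * T' = 1 by apply: reflection_pair_inverse.
have T'T : T' * T = 1 by apply: reflection_pair_inverse.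
have hT : Gam' T by apply: gm'.
have [N N0 hN] := finite_index_power (polygon_subgroup hq) hG' hfin hT.
have [z fz [zf zg]] : exists2 z, future z & lorentz z f = 0 /\ lorentz z g = 0.
  pose z := cross f g.
  have zz : lorentz z z < 0 by rewrite lorentz_crosscross ff gg; lra.
  have [zf zg] : lorentz z f = 0 /\ lorentz z g = 0.
    by rewrite !(lorentzC z) lorentz_crossl lorentz_crossr.
  have fv : future v0 by case: hv0.
  have vz : lorentz v0 z != 0.
    apply/eqP => h; have := orthogonal_timelike fv h; lra.
  case/orP: (lt_total vz) => hlt.
    by exists z => //; split=> //; rewrite -(timelike_lorentz_neg fv zz).
  have zz' : lorentz (- z) (- z) < 0 by rewrite !lorentz_lin opprK.
  exists (- z); last by rewrite !lorentz_lin zf zg oppr0.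
  by split=> //; rewrite -(timelike_lorentz_neg fv zz') lorentzNr oppr_lt0.
have fixz h : lorentz z h = 0 -> reflection h *m z = z.
  by move=> h0; rewrite reflectionE lorentzC h0 mulr0 scale0r subr0.
have Tz k : T ^+ k *m z = z.
  elim: k => [|k IH]; first by rewrite mul1mx.
  by rewrite exprS -[_ * _]/(_ *m _) -mulmxA IH -[T]/(reflection f *m reflection g) -mulmxA !fixz.
have h6 := elliptic_finite_order hq hv0 hN fz (Tz N).
exists (N * 6)%N; first by rewrite muln_gt0 N0.
have TN : T ^+ (N * 6) = 1 by rewrite exprM.
have T'N : T' ^+ (N * 6) = 1.
  by have := inverse_pow (N * 6) TT'; rewrite TN mul1r.
have [Tf _] := reflection_pair_eigen ff gg.
have := power_sum_eigen TT' T'T Tf (N * 6).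
rewrite TN T'N !mul1mx -mulr2n -scaler_nat => /(congr1 (lorentz f)).
by rewrite !lorentz_lin ff !mulr1 => <-.
Qed.

Lemma quad_mirror_hyps : mirror_hyps iota angle_cosines mirrors a b c d.
Proof.
have [haa hbb hcc hdd] : [/\ lorentz a a = 1, lorentz b b = 1, lorentz c c = 1 & lorentz d d = 1].
  by case: hq.
have gM g : g \in [:: a; b; c; d] -> mirrors g.
  move=> hg; split; last by apply: gsub; apply: (polygon_reflection hq).
  by move: hg; rewrite !inE => /or4P[] /eqP ->.
have prod f g h : mirrors f -> g \in [:: a; b; c; d] -> h \in [:: a; b; c; d] ->
    krational iota (lorentz f g * lorentz f h).
  move=> [h1 h2] hg hh; apply: (krational_mirror_products hq hx hy hG' hfin h1 h2);
    exact: (krational_mem hq hx hy).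
split.
- by move=> f [].
- by move=> f g [h1 h2] hg; apply: mirrors_image.
- by split; apply: gM; rewrite !inE eqxx ?orbT.
- by move=> f hf g h hg hh; apply: prod.
- move=> f g hf hg hlt; split=> //; first by rewrite expr2; apply: prod.
  by apply: crossing_mirrors_finite_order => //; apply: gM.
Qed.

Hypotheses (hcone : compact_cone a b c d).
Hypotheses (gx : generic_param iota angle_cosines x) (gy : generic_param iota angle_cosines y).

Lemma interior_avoids_mirrors f z : mirrors f -> interior_point a b c d z -> lorentz f z <> 0.
Proof. exact: (no_cutting_mirror hq hcone gx gy quad_mirror_hyps). Qed.

Lemma pushed_in_avoids_mirrors f z u : mirrors f -> future z -> lorentz f z = 0 -> lorentz f u = 0 ->
  (forall g, g \in [:: a; b; c; d] -> lorentz z g < 0 \/ lorentz z g = 0 /\ lorentz u g < 0) -> False.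
Proof.
move=> hf fz hfz hfu h; have [t [t0 ft ht]] := interior_perturb fz h.
apply: (interior_avoids_mirrors hf (z := z + t *: u)); last by rewrite !lorentz_lin hfz hfu; ring.
by split=> //; split; apply: ht; rewrite !inE eqxx ?orbT.
Qed.

(** A mirror through an inner point of a side and different from its line is transversal to it, so
    sliding along the mirror leads into the interior. *)
Lemma side_mirror f g z : mirrors f -> g \in [:: a; b; c; d] -> future z ->
  lorentz f z = 0 -> lorentz z g = 0 ->
  (forall h, h \in [:: a; b; c; d] -> h != g -> lorentz z h < 0) -> f = g \/ f = - g.
Proof.
move=> hf hg fz hfz hzg hh; have [ff _] := hf.
have gg : lorentz g g = 1.
  by have [_ _ [m1 m2 m3 m4] _ _] := quad_mirror_hyps; move: hg; rewrite !inE => /or4P[] /eqP ->; [case: m1|case: m2|case: m3|case: m4].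
have [->|n1] := eqVneq f g; first by left.
have [->|n2] := eqVneq f (- g); first by right.
have hlt : lorentz g f ^+ 2 < 1.
  by apply: (@crossing_lt1 _ z) => //; [case: fz|rewrite lorentzC].
exfalso; apply: (@pushed_in_avoids_mirrors f z (lorentz g f *: f - g)) => //.
  by rewrite !lorentz_lin ff (lorentzC f g); ring.
move=> h hm; have [->|nh] := eqVneq h g; last by left; apply: hh.
by right; split=> //; rewrite !lorentz_lin gg (lorentzC f g); lra.
Qed.

(** When the coefficients have opposite signs, the line of [f] passes inside the angle at the
    vertex. *)
Lemma vertex_opposite_signs f g h p q z : mirrors f -> lorentz g g = 1 -> lorentz h h = 1 ->
  lorentz g h = 0 \/ lorentz g h = - 2^-1 -> future z -> lorentz z g = 0 -> lorentz z h = 0 ->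
  (forall k, k \in [:: a; b; c; d] -> k != g -> k != h -> lorentz z k < 0) ->
  f = p *: g + q *: h -> 0 <= p * q.
Proof.
move=> hf gg hh gh fz zg zh hrest ef; rewrite leNgt; apply/negP => pq.
set k := lorentz g h in gh.
have k2 : 1 - k ^+ 2 != 0 by apply: lt0r_neq0; case: gh => ->; lra.
have [s [t [eg eh hst]]] : exists s t, [/\ s + t * k < 0, s * k + t < 0 & p * (s + t * k) + q * (s * k + t) = 0].
  (* [sol A B] gives the vector in the span of [g] and [h] whose products with them are [A] and [B].
     The choices [(- q, p)] and [(q, - p)] make it orthogonal to [f], and the signs of [p] and [q]
     tell which one points inwards. *)
  pose sol A B := ((A - k * B) / (1 - k ^+ 2), (B - k * A) / (1 - k ^+ 2)).
  have solE A B : (sol A B).1 + (sol A B).2 * k = A /\ (sol A B).1 * k + (sol A B).2 = B.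
    by rewrite /sol /=; split; field.
  case: (ltP p 0) => hp.
    have hq0 : 0 < q by rewrite -(nmulr_rlt0 _ hp).
    exists (sol (- q) p).1, (sol (- q) p).2; have [-> ->] := solE (- q) p.
    by split; [lra|lra|ring].
  have hp' : 0 < p.
    by rewrite lt_neqAle hp andbT; apply/eqP => h0; move: pq; rewrite -h0 mul0r ltxx.
  have hq0 : q < 0 by rewrite -(pmulr_rlt0 _ hp').
  exists (sol q (- p)).1, (sol q (- p)).2; have [-> ->] := solE q (- p).
  by split; [lra|lra|ring].
have fz0 : lorentz f z = 0 by rewrite ef !lorentz_lin (lorentzC g) (lorentzC h) zg zh; ring.
apply: (@pushed_in_avoids_mirrors f z (s *: g + t *: h)) => //.
  rewrite ef !lorentz_lin gg hh (lorentzC h g) -/k -hst; ring.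
move=> l hl; have [->|ng] := eqVneq l g.
  by right; split=> //; rewrite !lorentz_lin gg (lorentzC h g) -/k mulr1.
have [->|nh] := eqVneq l h; last by left; apply: hrest.
by right; split=> //; rewrite !lorentz_lin hh -/k mulr1.
Qed.

Definition side_mirror_image f := exists A g, [/\ Gam A, g \in [:: a; b; c; d] & f = A *m g \/ f = - (A *m g)].

(** The sign condition is applied to [f] and to its images under the two side reflections. At a
    right angle it leaves only the two sides; at an angle of pi/3 it also allows [p = q], the third
    mirror through the vertex, which is the image of one side under the other. *)
Lemma vertex_mirror f g h z : mirrors f -> g \in [:: a; b; c; d] -> h \in [:: a; b; c; d] ->
  lorentz g h = 0 \/ lorentz g h = - 2^-1 -> future z -> lorentz f z = 0 -> lorentz z g = 0 -> lorentz z h = 0 ->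
  (forall k, k \in [:: a; b; c; d] -> k != g -> k != h -> lorentz z k < 0) ->
  side_mirror_image f.
Proof.
move=> hf hg hh gh fz hfz zg zh hrest; have [ff _] := hf.
have unit k : k \in [:: a; b; c; d] -> lorentz k k = 1.
  by have [_ _ [m1 m2 m3 m4] _ _] := quad_mirror_hyps; rewrite !inE => /or4P[] /eqP ->; [case: m1|case: m2|case: m3|case: m4].
have gg := unit _ hg; have hhh := unit _ hh.
have hsub := polygon_subgroup hq.
have G1 : Gam 1 by case/subgroupP: hsub.
have Gg := polygon_reflection hq hg.
have Gh := polygon_reflection hq hh.
have [p [q ef]] : exists p q, f = p *: g + q *: h.
  have k2 : 1 - lorentz g h ^+ 2 != 0 by apply: lt0r_neq0; case: gh => ->; lra.
  have zz : lorentz z z != 0 by case: fz => h1 _; apply: ltr0_neq0.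
  have hd : det3 z g h != 0.
    apply: det3_neq0; rewrite /gram3 gg hhh zg zh.
    by rewrite (_ : _ + _ = lorentz z z * (1 - lorentz g h ^+ 2)) ?mulf_neq0 //; ring.
  have e := cramer3 f hd.
  exists (det3 z f h / det3 z g h), (det3 z g f / det3 z g h).
  have := congr1 (lorentz z) e; rewrite !lorentz_lin zg zh (lorentzC z f) hfz !mulr0 !addr0 => /esym/eqP.
  by rewrite mulf_eq0 (negbTE zz) orbF => /eqP h0; rewrite {1}e h0 scale0r add0r.
have unitN (s : R) k : lorentz (s *: k) (s *: k) = 1 -> lorentz k k = 1 -> s = 1 \/ s = -1.
  rewrite !lorentz_lin => h1 h2; move: h1; rewrite h2 mulr1 -expr2 => /eqP.
  by rewrite sqrf_eq1 => /orP[] /eqP ->; [left|right].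
have simple s k A : Gam A -> k \in [:: a; b; c; d] -> f = s *: (A *m k) -> lorentz (A *m k) (A *m k) = 1 -> side_mirror_image f.
  move=> hA hk e hu; exists A, k; split=> //; move: ff; rewrite e => /unitN/(_ hu)[] ->.
    by rewrite scale1r; left.
  by rewrite scaleN1r; right.
have [p0|p0] := eqVneq p 0.
  by apply: (simple q h 1); rewrite ?mul1mx // ef p0 scale0r add0r.
have [q0|q0] := eqVneq q 0.
  by apply: (simple p g 1); rewrite ?mul1mx // ef q0 scale0r addr0.
have pq : 0 < p * q.
  rewrite lt_neqAle eq_sym mulf_neq0 //=.
  exact: (vertex_opposite_signs hf gg hhh gh fz zg zh hrest ef).
have Rg : mirrors (reflection g *m f) by apply: mirrors_image => //; apply: gsub.
have Rh : mirrors (reflection h *m f) by apply: mirrors_image => //; apply: gsub.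
case: gh => gh.
  have e : reflection g *m f = (- p) *: g + q *: h.
    by rewrite reflectionE ef !lorentz_lin gg gh; apply: vec3P; rewrite !mxE; ring.
  have := vertex_opposite_signs Rg gg hhh (or_introl gh) fz zg zh hrest e; lra.
have e1 : reflection g *m f = (q - p) *: g + q *: h.
  by rewrite reflectionE ef !lorentz_lin gg gh; apply: vec3P; rewrite !mxE; field.
have e2 : reflection h *m f = p *: g + (p - q) *: h.
  by rewrite reflectionE ef !lorentz_lin hhh (lorentzC h g) gh; apply: vec3P; rewrite !mxE; field.
have h1 := vertex_opposite_signs Rg gg hhh (or_intror gh) fz zg zh hrest e1.
have h2 := vertex_opposite_signs Rh gg hhh (or_intror gh) fz zg zh hrest e2.
have hpq : p = q.
  have hs : (p - q) ^+ 2 <= 0.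
    by rewrite -(pmulr_lle0 _ pq); have := mulr_ge0 h1 h2; lra.
  by apply/eqP; rewrite -subr_eq0 -sqrf_eq0 eq_le hs sqr_ge0.
apply: (simple q h (reflection g)) => //; last by rewrite lorentz_reflection.
by rewrite -(reflectionK f gg) e1 hpq subrr scale0r add0r scalemxAr.
Qed.

Theorem mirror_is_side_image f : mirrors f -> side_mirror_image f.
Proof.
move=> hf; have [ff hGf] := hf.
have hsub := polygon_subgroup hq.
have [gi g1 gm gV] := (subgroupP _).1 hsub.
have [fv [va vb vc vd]] := hv0.
(* The foot of the perpendicular from [v0], used merely as some point on the mirror. *)
pose z0 := v0 - lorentz f v0 *: f.
have fz0 : lorentz f z0 = 0 by rewrite !lorentz_lin ff; ring.
have z0z0 : lorentz z0 z0 < 0.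
  rewrite {1}/z0 !lorentzDl !lorentzNl lorentzZl fz0 !lorentz_lin (lorentzC v0 f).
  by case: fv => h _; have := sqr_ge0 (lorentz f v0); lra.
have futz0 : future z0.
  split=> //; rewrite -(timelike_lorentz_neg fv z0z0) !lorentz_lin (lorentzC v0 f).
  by case: fv => h _; have := sqr_ge0 (lorentz f v0); lra.
have [|A hA hfold] := covering hq hv0 hsub _ futz0; first by move=> g; exact: (polygon_reflection hq).
suff [B [g [hB hg e]]] : side_mirror_image (A *m f).
  have [uA _] := isom_inv (gi _ hA).
  have AVK w : A^-1 *m (A *m w) = w by rewrite mulmxA -[A^-1 *m _]/(A^-1 * _) mulVr // mul1mx.
  exists (A^-1 * B), g; split=> //; first by apply (gm _ _ (gV _ hA) hB).
  by case: e => e; [left|right]; rewrite -(AVK _ f) e ?mulmxN mulmxA.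
have hAf := mirrors_image (gsub hA) hf.
have fAz : lorentz (A *m f) (A *m z0) = 0 by rewrite (proj1 (gi _ hA)).
have futAz : future (A *m z0) by apply: isom_future => //; apply: gi.
move: (A *m f) (A *m z0) hAf fAz futAz hfold => f1 z hf1 hfz fz hfold.
have [r r0 hrz] := future_normalize fz.
have [ac _] := opposite_sides_apart hq hv0 hrz.
have [bd _] := opposite_sides_apart (quad_gram_flip hq) (interior_flip hv0) hrz.
rewrite lorentzZl pmulr_rlt0 // lorentzDr in ac.
rewrite lorentzZl pmulr_rlt0 // lorentzDr in bd.
have [_ [hab hbc hcd hda] _ _] := hq.
have ma : a \in [:: a; b; c; d] by rewrite !inE eqxx ?orbT.
have mb : b \in [:: a; b; c; d] by rewrite !inE eqxx ?orbT.
have mc : c \in [:: a; b; c; d] by rewrite !inE eqxx ?orbT.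
have md : d \in [:: a; b; c; d] by rewrite !inE eqxx ?orbT.
have za := hfold a ma; have zb := hfold b mb; have zc := hfold c mc; have zd := hfold d md.
have side g : g \in [:: a; b; c; d] -> lorentz z g = 0 ->
    (forall h, h \in [:: a; b; c; d] -> h != g -> lorentz z h < 0) -> side_mirror_image f1.
  move=> hg h0 hh; exists 1, g; split=> //; rewrite mul1mx.
  exact: (side_mirror hf1 hg fz hfz h0 hh).
have cases4 (P : V -> Prop) : P a -> P b -> P c -> P d -> forall h, h \in [:: a; b; c; d] -> P h.
  by move=> pa pb pc pd h; rewrite !inE => /or4P[] /eqP ->.
have neg g : lorentz z g <= 0 -> lorentz z g != 0 -> lorentz z g < 0.
  by move=> h1 h2; rewrite lt_neqAle h2.
have nac : lorentz z a = 0 -> lorentz z c = 0 -> False by move=> h1 h2; move: ac; rewrite h1 h2 addr0 ltxx.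
have nbd : lorentz z b = 0 -> lorentz z d = 0 -> False by move=> h1 h2; move: bd; rewrite h1 h2 addr0 ltxx.
have [a0|a0] := eqVneq (lorentz z a) 0; have [b0|b0] := eqVneq (lorentz z b) 0;
 have [c0|c0] := eqVneq (lorentz z c) 0; have [d0|d0] := eqVneq (lorentz z d) 0; try by [case: nac|case: nbd].
- apply: (vertex_mirror hf1 ma mb _ fz hfz a0 b0); first by left.
  by apply: cases4; rewrite ?eqxx // => _ _; apply: neg.
- apply: (vertex_mirror hf1 md ma _ fz hfz d0 a0); first by right.
  by apply: cases4; rewrite ?eqxx // => _ _; apply: neg.
- by apply: (side a) => //; apply: cases4; rewrite ?eqxx // => _; apply: neg.
- apply: (vertex_mirror hf1 mb mc _ fz hfz b0 c0); first by right.
  by apply: cases4; rewrite ?eqxx // => _ _; apply: neg.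
- by apply: (side b) => //; apply: cases4; rewrite ?eqxx // => _; apply: neg.
- apply: (vertex_mirror hf1 mc md _ fz hfz c0 d0); first by left.
  by apply: cases4; rewrite ?eqxx // => _ _; apply: neg.
- by apply: (side c) => //; apply: cases4; rewrite ?eqxx // => _; apply: neg.
- by apply: (side d) => //; apply: cases4; rewrite ?eqxx // => _; apply: neg.
- exfalso; apply: (interior_avoids_mirrors hf1 (z := z)) => //.
  by split=> //; split; apply: neg.
Qed.

Theorem mirror_reflection_mem f : mirrors f -> Gam (reflection f).
Proof.
move=> /mirror_is_side_image[A [g [hA hg e]]].
have [gi _ gm gV] := (subgroupP _).1 (polygon_subgroup hq).
have -> : reflection f = A * reflection g * A^-1.
  by case: e => ->; rewrite ?reflectionN reflection_conj //; exact: gi.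
by apply (gm _ _ (gm _ _ hA (polygon_reflection hq hg)) (gV _ hA)).
Qed.

End Maximality.

Section MaximalGroup.
Variable R : realType.
Local Notation V := 'cV[R]_3.
Variables (L : fieldType) (iota : {rmorphism L -> R}).
Variables (a b c d v0 : V) (x y : R).
Hypotheses (hq : quad_gram a b c d x y) (hv0 : interior_point a b c d v0).
Hypotheses (hcone : compact_cone a b c d).
Hypotheses (gx : generic_param iota (angle_cosines iota) x) (gy : generic_param iota (angle_cosines iota) y).
Local Notation Gam := (polygon_group (quad_normals a b c d)).

Lemma finite_index_refl : finite_index_in Gam Gam.
Proof.
have [gi g1 gm gV] := (subgroupP _).1 (polygon_subgroup hq).
split=> //; apply: (sub_finite_set _ (finite_set1 Gam)).
move=> _ [g hg <-]; apply/seteqP; split=> [_ [h hh <-]|h hh]; first exact: gm.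
exists (g^-1 * h); first by apply: gm => //; exact: gV.
by rewrite mulVKr //; have [] := isom_inv (gi _ hg).
Qed.

Theorem quad_maximal : maximal_reflection_group Gam.
Proof.
have hx : krational iota x by case: gx.
have hy : krational iota y by case: gy.
split.
  exists [set reflection (quad_normals a b c d i) | i in [set: 'I_4]] => //.
  move=> _ [i _ <-]; exists (quad_normals a b c d i) => //; exact: (quad_normals_unit hq).
move=> Gam' [S hS eS]; split=> [hfin|->]; last exact: finite_index_refl.
have hG' : is_subgroup Gam'.
  rewrite eS; apply: generated_subgroup_is_subgroup => A /hS[e he ->].
  exact: reflection_isom.
apply/seteqP; split; last by case: hfin.
suff : Gam' `<=` Gam by [].
rewrite [in X in X `<=` _]eS => A; apply; split; first exact: (polygon_subgroup hq).
move=> B hB; have [e he eB] := hS _ hB; rewrite eB.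
apply: (mirror_reflection_mem hq hv0 hx hy hG' hfin hcone gx gy).
by split=> //; rewrite -eB eS => M [_]; apply.
Qed.

End MaximalGroup.

(** * Conjugation, and the parameter recovered from the group *)

Section Transport.
Variable R : realType.
Local Notation V := 'cV[R]_3.
Implicit Types (f g h z u : V).

Lemma quad_gram_image (A : 'M[R]_3) a b c d x y : isom_group A -> quad_gram a b c d x y ->
  quad_gram (A *m a) (A *m b) (A *m c) (A *m d) x y.
Proof. by move=> [h _]; rewrite /quad_gram !h. Qed.

Lemma isomVK (A : 'M[R]_3) u : isom_group A -> A *m (A^-1 *m u) = u.
Proof. by move=> /isom_inv[uA _]; rewrite mulmxA -[A *m _]/(A * _) mulrV // mul1mx. Qed.

Lemma isom_adj (A : 'M[R]_3) u f : isom_group A -> lorentz (A^-1 *m u) f = lorentz u (A *m f).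
Proof. by move=> hA; rewrite -(proj1 hA) isomVK. Qed.

Lemma interior_point_image (A : 'M[R]_3) a b c d z : isom_group A -> interior_point a b c d z ->
  interior_point (A *m a) (A *m b) (A *m c) (A *m d) (A *m z).
Proof. by move=> hA [hz h]; split; rewrite ?(proj1 hA) //; apply: isom_future. Qed.

Lemma compact_cone_image (A : 'M[R]_3) a b c d : isom_group A -> compact_cone a b c d ->
  compact_cone (A *m a) (A *m b) (A *m c) (A *m d).
Proof.
move=> hA hc n n0 nn; have := hc (A^-1 *m n); rewrite !isom_adj // isomVK //.
apply => //.
pose p : V := delta_mx 0 0.
have hp : future p by split; rewrite ?lorentzE !mxE /=; [lra|exact: ltr01].
apply: (null_lorentz_neg (isom_future (isomV hA) hp)); first by rewrite (proj1 (isomV hA)).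
by rewrite (proj1 (isomV hA)) lorentzE !mxE /=; lra.
Qed.

Lemma polygon_group_image (A : 'M[R]_3) a b c d x y : isom_group A -> quad_gram a b c d x y ->
  polygon_group (quad_normals (A *m a) (A *m b) (A *m c) (A *m d)) =
  [set A * h * A^-1 | h in polygon_group (quad_normals a b c d)].
Proof.
move=> hA hq; have [uA _] := isom_inv hA.
have hun := quad_normals_unit hq.
have hun' := quad_normals_unit (quad_gram_image hA hq).
have e i : quad_normals (A *m a) (A *m b) (A *m c) (A *m d) i = A *m quad_normals a b c d i.
  by move: i; apply: ord4_ind.
have key w : ev (quad_normals (A *m a) (A *m b) (A *m c) (A *m d)) w = A * ev (quad_normals a b c d) w * A^-1.
  elim: w => [|i w IH]; first by rewrite !ev_nil mulr1 mulrV.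
  by rewrite !ev_cons IH e reflection_conj // !mulrA (mulrVK uA).
apply/seteqP; split=> [B /(polygon_groupP hun')[w ->]|_ [B /(polygon_groupP hun)[w ->] <-]].
  by exists (ev (quad_normals a b c d) w) => //; apply/(polygon_groupP hun); exists w.
by apply/(polygon_groupP hun'); exists w.
Qed.

End Transport.

Section Uniqueness.
Variable R : realType.
Local Notation V := 'cV[R]_3.
Implicit Types (f g h z u w : V).
Variables (L : fieldType) (iota : {rmorphism L -> R}).
Let F := angle_cosines iota.

Section Chamber.
Variables (a b c d v0 : V) (x y : R).
Hypotheses (hq : quad_gram a b c d x y) (hv0 : interior_point a b c d v0).
Hypotheses (hcone : compact_cone a b c d).
Hypotheses (gx : generic_param iota F x) (gy : generic_param iota F y).
Local Notation Gam := (polygon_group (quad_normals a b c d)).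

Lemma interior_avoids f z : lorentz f f = 1 -> Gam (reflection f) ->
  interior_point a b c d z -> lorentz f z <> 0.
Proof.
move=> ff hf; have hx : krational iota x by case: gx.
have hy : krational iota y by case: gy.
by apply: (interior_avoids_mirrors hq hv0 hx hy (polygon_subgroup hq) (finite_index_refl hq) hcone gx gy).
Qed.

(** Otherwise the segment from [z] to [w], which stays in the interior, would meet the mirror. *)
Lemma interior_same_sign f z w : lorentz f f = 1 -> Gam (reflection f) ->
  interior_point a b c d z -> interior_point a b c d w -> lorentz f z < 0 -> lorentz f w < 0.
Proof.
move=> ff hf hz hw fz; rewrite ltNge; apply/negP => fw.
have {}fw : 0 < lorentz f w.
  by rewrite lt_neqAle fw andbT; apply/eqP => /esym; apply: interior_avoids hw.
apply: (@interior_avoids f (lorentz f w *: z + (- lorentz f z) *: w)) => //; last first.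
  by rewrite !lorentz_lin; ring.
case: hz hw => hz [z1 z2 z3 z4] [hw [w1 w2 w3 w4]].
have fz' : 0 < - lorentz f z by rewrite oppr_gt0.
have neg p q : p < 0 -> q < 0 -> lorentz f w * p + - lorentz f z * q < 0.
  move=> hp hq'; have : lorentz f w * p < 0 by rewrite pmulr_rlt0.
  have : - lorentz f z * q < 0 by rewrite pmulr_rlt0.
  lra.
by split; [apply: futureD; apply: futureZ|rewrite !lorentzDl !lorentzZl; split; apply: neg].
Qed.

(** The foot of the perpendicular from [v0] to the side. It stays strictly inside the other
    half-planes because distinct normals have nonpositive products. *)
Lemma side_point g : g \in [:: a; b; c; d] -> exists u, [/\ future u, lorentz u g = 0 &
  forall h, h \in [:: a; b; c; d] -> h != g -> lorentz u h < 0].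
Proof.
move=> hg; have [[haa hbb hcc hdd] [hab hbc hcd hda] [hac hbd] [hx1 hy1 hxy]] := hq.
have [fv [va vb vc vd]] := hv0.
have gg : lorentz g g = 1 by move: hg; rewrite !inE => /or4P[] /eqP ->.
exists (v0 - lorentz v0 g *: g).
have tl : lorentz (v0 - lorentz v0 g *: g) (v0 - lorentz v0 g *: g) < 0.
  rewrite !lorentz_lin gg (lorentzC g v0); case: fv => h _; have := sqr_ge0 (lorentz v0 g); lra.
split.
- split=> //; rewrite -(timelike_lorentz_neg fv tl) !lorentz_lin; case: fv => h _; have := sqr_ge0 (lorentz v0 g); lra.
- by rewrite !lorentz_lin gg; ring.
move=> h hh; rewrite !lorentz_lin.
have nx p : p < 0 -> 0 < x * - p by move=> hp; rewrite mulr_gt0 //; lra.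
have ny p : p < 0 -> 0 < y * - p by move=> hp; rewrite mulr_gt0 //; lra.
have := nx _ va; have := nx _ vc; have := ny _ vb; have := ny _ vd.
move: hg hh; rewrite !inE => /or4P[] /eqP -> /or4P[] /eqP ->; rewrite ?eqxx // => p1 p2 p3 p4 _;
 rewrite ?(lorentzC b a) ?(lorentzC c b) ?(lorentzC d c) ?(lorentzC a d) ?(lorentzC c a) ?(lorentzC d b)
   ?hab ?hbc ?hcd ?hda ?hac ?hbd; lra.
Qed.

End Chamber.

(** Once an element of the group has moved [v'] into the first polygon, the two polygons are the
    same chamber of the mirror arrangement. The product of the opposite normals [a] and [c], being
    less than -1, is then one of [- x'] and [- y']. *)
Theorem quad_unique a b c d x y a' b' c' d' x' y' v v' :
  quad_gram a b c d x y -> interior_point a b c d v -> compact_cone a b c d ->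
  generic_param iota F x -> generic_param iota F y ->
  quad_gram a' b' c' d' x' y' -> interior_point a' b' c' d' v' -> compact_cone a' b' c' d' ->
  generic_param iota F x' -> generic_param iota F y' ->
  polygon_group (quad_normals a b c d) = polygon_group (quad_normals a' b' c' d') ->
  x = x' \/ x = y'.
Proof.
move=> hq hv hcone gx gy hq' hv' hcone' gx' gy' eG.
have hsub := polygon_subgroup hq.
have [gi g1 gm gV] := (subgroupP _).1 hsub.
have [A hA hfold] := covering hq hv hsub (fun g => @polygon_reflection _ _ _ _ _ _ _ hq g) (proj1 hv').
wlog hfold1 : a' b' c' d' v' A hq' hv' hcone' eG hA hfold / A = 1.
  move=> H; apply: (H (A *m a') (A *m b') (A *m c') (A *m d') (A *m v') 1); try assumption; last by [].
  - by apply: quad_gram_image => //; apply: gi.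
  - by apply: interior_point_image => //; apply: gi.
  - by apply: compact_cone_image => //; apply: gi.
  - rewrite (polygon_group_image (gi _ hA) hq') -eG; apply/seteqP; split=> [B hB|_ [B hB <-]]; last first.
      by apply (gm _ _ (gm _ _ hA hB) (gV _ hA)).
    have [uA _] := isom_inv (gi _ hA).
    exists (A^-1 * B * A); first by apply (gm _ _ (gm _ _ (gV _ hA) hB) hA).
    by rewrite !mulrA mulrV // mul1r mulrK.
  - by move=> g hg; rewrite mul1mx; exact: hfold.
rewrite hfold1 mul1mx in hfold.
have munit (a1 b1 c1 d1 : V) x1 y1 g : quad_gram a1 b1 c1 d1 x1 y1 -> g \in [:: a1; b1; c1; d1] -> lorentz g g = 1.
  by move=> [[h1 h2 h3 h4] _ _ _]; rewrite !inE => /or4P[] /eqP ->.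
have mG g : g \in [:: a; b; c; d] -> polygon_group (quad_normals a' b' c' d') (reflection g).
  by move=> hg; rewrite -eG; apply: (polygon_reflection hq).
have mG' g : g \in [:: a'; b'; c'; d'] -> polygon_group (quad_normals a b c d) (reflection g).
  by move=> hg; rewrite eG; apply: (polygon_reflection hq').
have negv g : g \in [:: a; b; c; d] -> lorentz v' g < 0.
  move=> hg; rewrite lt_neqAle hfold // andbT; apply/eqP => h.
  apply: (interior_avoids hq' hv' hcone' gx' gy' (munit _ _ _ _ _ _ _ hq hg) (mG _ hg) hv').
  by rewrite lorentzC.
have fv' : future v' by case: hv'.
have hint : interior_point a b c d v'.
  by split=> //; split; apply: negv; rewrite !inE eqxx ?orbT.
have negv' g : g \in [:: a'; b'; c'; d'] -> lorentz g v' < 0.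
  by case: hv' => _ [h1 h2 h3 h4]; rewrite lorentzC !inE => /or4P[] /eqP ->.
have hx : krational iota x by case: gx.
have hy : krational iota y by case: gy.
(* An inner point [u] of the side cannot be separated from [v'] by a side of the second polygon, as
   no mirror cuts the first. It is not interior to the second one either, since it lies on the
   mirror [g]. So it is on some side [g'], and [side_mirror] identifies [g'] with [g] up to sign. *)
have side g : g \in [:: a; b; c; d] -> g \in [:: a'; b'; c'; d'].
  move=> hg; have [u [fu ug uh]] := side_point hq hv hg.
  have le0 g' : g' \in [:: a'; b'; c'; d'] -> lorentz g' u <= 0.
    move=> hg'; rewrite leNgt; apply/negP => hpos.
    have hs h : h \in [:: - g'; a; b; c; d] -> lorentz u h < 0 \/ lorentz u h = 0 /\ lorentz v' h < 0.
      rewrite inE => /orP[/eqP ->|hh]; first by left; rewrite lorentzNr oppr_lt0 lorentzC.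
      have [->|nh] := eqVneq h g; last by left; apply: uh.
      by right; split=> //; apply: negv.
    have [t [t0 ft ht]] := interior_perturb fu hs.
    have hI : interior_point a b c d (u + t *: v').
      by split=> //; split; apply: ht; rewrite !inE eqxx ?orbT.
    have := interior_same_sign hq hv hcone gx gy (munit _ _ _ _ _ _ _ hq' hg') (mG' _ hg') hint hI (negv' _ hg').
    have := ht (- g') (mem_head _ _); rewrite lorentzNr lorentzC; lra.
  have [g' hg' g'u] : exists2 g', g' \in [:: a'; b'; c'; d'] & lorentz g' u = 0.
    apply: contrapT => hno.
    have hneg g' : g' \in [:: a'; b'; c'; d'] -> lorentz u g' < 0.
      move=> hg'; rewrite lt_neqAle lorentzC le0 // andbT; apply/eqP => h; apply: hno; exists g' => //.
    apply: (interior_avoids hq' hv' hcone' gx' gy' (munit _ _ _ _ _ _ _ hq hg) (mG _ hg) (z := u)).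
      by split=> //; split; apply: hneg; rewrite !inE eqxx ?orbT.
    by rewrite lorentzC.
  have hM : mirrors (polygon_group (quad_normals a b c d)) g'.
    by split; [exact: (munit _ _ _ _ _ _ _ hq')|exact: mG'].
  case: (side_mirror hq hv hx hy hsub (finite_index_refl hq) hcone gx gy hM hg fu g'u ug uh) => e.
    by rewrite -e.
  have h1 := negv' _ hg'; have h2 := negv _ hg; move: h1; rewrite e lorentzNl (lorentzC g); lra.
have [[haa hbb hcc hdd] [hab hbc hcd hda] [hac hbd] [hx1 hy1 hxy]] := hq'.
have [_ _ [eac _] [hx0 _ _]] := hq.
have ha : a \in [:: a'; b'; c'; d'] by apply: side; rewrite !inE eqxx.
have hc : c \in [:: a'; b'; c'; d'] by apply: side; rewrite !inE eqxx !orbT.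
move: ha hc eac; rewrite !inE => /or4P[] /eqP -> /or4P[] /eqP ->;
  rewrite ?(lorentzC b' a') ?(lorentzC c' b') ?(lorentzC d' c') ?(lorentzC a' d') ?(lorentzC c' a') ?(lorentzC d' b')
   ?haa ?hbb ?hcc ?hdd ?hab ?hbc ?hcd ?hda ?hac ?hbd => e; clear -hx0 hx1 hy1 e; by [exfalso; lra|left; lra|right; lra].
Qed.

End Uniqueness.

Lemma rational_minpoly (k : fieldExtType rat) (C : fieldType) (s : {rmorphism k -> C})
    (iC : {rmorphism rat -> C}) (z : k) :
  exists q : {poly rat}, [/\ q != 0, (size q <= (\dim {:k}).+1)%N & root (map_poly iC q) (s z)].
Proof.
have /polyOver1P[q eq] : minPoly 1 z \is a polyOver 1%VS by exact: minPolyOver.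
have sq : size q = size (minPoly 1 z) by rewrite eq size_map_poly.
exists q; split.
- by rewrite -size_poly_eq0 sq size_minPoly.
- rewrite sq size_minPoly ltnS.
  have := dim_Fadjoin 1 z; rewrite dimv1 muln1 => <-.
  exact: (dimvS (subvf _)).
- have -> : map_poly iC q = map_poly s (minPoly 1 z).
    rewrite eq -map_poly_comp; apply: eq_map_poly => r /=.
    rewrite fmorph_eq_rat; exact/esym/(fmorph_eq_rat (s \o GRing.in_alg k)).
  by rewrite fmorph_root root_minPoly.
Qed.

Lemma finite_roots (F : closedFieldType) (p : {poly F}) : p != 0 -> finite_set [set x | root p x].
Proof.
move=> p0; have [r e] := closed_field_poly_normal p.
apply: (sub_finite_set _ (finite_seq r)) => x /=; rewrite e rootZ ?lead_coef_eq0 //.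
by rewrite root_prod_XsubC.
Qed.

(** * The finite set of angles between mirrors *)

Section FiniteAngles.
Variables (R : realType) (k : fieldExtType rat) (iota : {rmorphism k -> R}).
Local Notation C := R[i].

Lemma cheb_complex (t : R) (z : C) n : z != 0 -> t%:C%C = z + z^-1 ->
  (cheb t n)%:C%C = z ^+ n + z ^- n.
Proof.
move=> z0 ht.
suff [] : (cheb t n)%:C%C = z ^+ n + z ^- n /\ (cheb t n.+1)%:C%C = z ^+ n.+1 + z ^- n.+1 by [].
elim: n => [|n [h1 h2]]; first by rewrite !expr0 !expr1 invr1 -ht; split=> //=; rewrite rmorph_nat.
split=> //; rewrite chebSS rmorphB rmorphM /= h1 h2 ht !exprS.
set w := z ^+ n; have w0 : w != 0 by rewrite expf_neq0.
by field; rewrite z0 w0.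
Qed.

(** The trace [4 * s ^+ 2 - 2] is [z + z^-1] for a root of unity [z]. Its degree over the rationals
    is at most [d], that of [z] at most [2 * d], so one exponent [M] annihilates every [z] that
    occurs. *)
Lemma finite_angle_cosines : finite_set (angle_cosines iota).
Proof.
pose d := \dim {:k}; pose M := (2 * (2 * d))`!%N.
pose P : {poly C} := 'X^M - 1.
have P0 : P != 0.
  have M0 : (0 < M)%N by exact: fact_gt0.
  by rewrite -size_poly_eq0 size_XnsubC.
have hfin : finite_set [set x | root P x] by exact: finite_roots.
(* Recovers the absolute value of [s] from [z], by inverting [4 * s ^+ 2 - 2 = z + z^-1]. *)
pose f (z : C) : R := Num.sqrt ((complex.Re (z + z^-1) + 2) / 4).
apply: (@sub_finite_set _ _ ((f @` [set x | root P x]) `|` ((fun z => - f z) @` [set x | root P x]))); last first.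
  by rewrite finite_setU; split; apply: finite_image.
move=> s [s1 [l hl] [m m0 hm]].
pose t := 4 * s ^+ 2 - 2.
have [z hz] : exists z : C, root ('X^2 - t%:C%C%:P * 'X + 1) z.
  apply/closed_rootP.
  have -> : ('X^2 - t%:C%C%:P * 'X + 1 : {poly C}) = 'X^2 + (- t%:C%C%:P * 'X + 1) by rewrite addrA mulNr.
  rewrite size_polyDl size_polyXn //.
  rewrite -polyCN; apply: leq_ltn_trans (_ : 2 < 3)%N => //.
  by rewrite size_MXaddC; case: ifP => // _; rewrite ltnS size_polyC leq_b1.
have hz' : z ^+ 2 - t%:C%C * z + 1 = 0 by move/rootP: hz; rewrite !hornerE.
have z0 : z != 0.
  by apply/eqP => h; move/eqP: hz'; rewrite h expr0n /= mulr0 subr0 add0r oner_eq0.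
have ht : t%:C%C = z + z^-1.
  apply: (mulIf z0); rewrite mulrDl mulVf // -expr2.
  by apply/eqP; rewrite eq_sym -subr_eq0 -[X in _ == X]hz' addrAC.
have zm : z ^+ m = 1.
  have := cheb_complex m z0 ht; rewrite hm => h.
  have zm0 : z ^+ m != 0 by rewrite expf_neq0.
  have h2 : (2%:R : R)%:C%C = 2 :> C by rewrite rmorph_nat.
  rewrite h2 in h.
  apply/eqP; rewrite -subr_eq0 -sqrf_eq0.
  have -> : (z ^+ m - 1) ^+ 2 = z ^+ m * (z ^+ m + z ^- m - 2) by field.
  by rewrite -h subrr mulr0.
have [n hn _] := prim_order_exists m0 zm.
have [q [q0 qs qr]] := @rational_minpoly k C (@real_complex R \o iota) (ratr : {rmorphism rat -> C}) (4 * l - 2).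
have qz : root (map_poly (ratr : rat -> C) q) (z + z^-1).
  rewrite -ht; move: qr; rewrite /= rmorphB rmorphM !rmorph_nat -hl.
  by congr (root _ _); rewrite /t rmorphB rmorphM !rmorph_nat.
have tn : (totient n <= 2 * d)%N.
  have := totient_le_degree hn (symmetrized_neq0 q0) (symmetrized_root z0 qz).
  move=> h; have := leq_trans h (size_symmetrized q); move: qs; rewrite -/d; lia.
have zM : z ^+ M = 1.
  have /dvdnP[j hj] := totient_bound_dvd_fact (prim_order_gt0 hn) tn.
  by rewrite /M hj mulnC exprM (prim_expr_order hn) expr1n.
have rz : root P z by rewrite /root !hornerE zM subrr.
have fz : f z = `|s|.
  by rewrite /f -ht /= /t -sqrtr_sqr; congr Num.sqrt; field.
case: (lerP 0 s) => hs; [left|right]; exists z => //.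
  by rewrite fz ger0_norm.
by rewrite fz ltr0_norm ?opprK.
Qed.

End FiniteAngles.

(** * The supply of parameters *)

Section NeverSquare.
Variables (R : realType) (k : fieldExtType rat) (iota : {rmorphism k -> R}).

(** For fixed [e] these numbers form a grid of step [p ^ 2 / 2 ^ e]. Real approximation thus leaves
    the p-adic condition intact when [p] is odd. *)
Lemma dyadic_dense (p : nat) (n : int) (al be : R) : (0 < p)%N -> al < be ->
  exists (v : int) (e : nat), al < n%:~R + (p%:Z ^+ 2 * v)%:~R / (2 ^ e)%:R < be.
Proof.
move=> p0 hab; pose P : R := p%:R ^+ 2.
have P0 : 0 < P by rewrite exprn_gt0 // ltr0n.
have d0 : 0 < be - al by rewrite subr_gt0.
pose e := Num.bound (P / (be - al)).
have he : P / (be - al) < 2 ^+ e by apply: upper_nthrootP.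
pose E : R := (2 ^ e)%:R.
have E0 : 0 < E by rewrite ltr0n expn_gt0.
have EE : E = 2 ^+ e by rewrite /E natrX.
pose y := (al - n%:~R) * E / P.
exists (Num.floor y + 1), e.
have /andP[f1 f2] := floor_itv y.
have -> : (p%:Z ^+ 2 * (Num.floor y + 1))%:~R = P * (Num.floor y + 1)%:~R :> R.
  by rewrite rmorphM rmorphXn.
rewrite -/E; move: f1 f2; rewrite intrD; set w : R := (Num.floor y)%:~R => f1 f2.
have -> : n%:~R + P * (w + 1%:~R) / E = al + (P / E) * (w + 1%:~R - y).
  by rewrite /y; field; rewrite (lt0r_neq0 P0) (lt0r_neq0 E0).
have PE : P / E < be - al by rewrite ltr_pdivrMr // mulrC -ltr_pdivrMr // EE.
have PE0 : 0 < P / E by rewrite divr_gt0.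
have w1 : 0 < w + 1%:~R - y by rewrite subr_gt0.
have w2 : w + 1%:~R - y <= 1 by rewrite (_ : 1%:~R = 1) // addrAC -lerBrDr subrr subr_le0.
apply/andP; split; first by rewrite ltrDl mulr_gt0.
have : (P / E) * (w + 1%:~R - y) <= P / E by rewrite ler_piMr // ltW.
lra.
Qed.

Lemma infinite_range (T : Type) (f : nat -> T) : injective f -> infinite_set (range f).
Proof.
move=> hf hfin; apply: infinite_nat.
have := @finite_preimage _ _ (range f) f (in2W hf) hfin.
by apply: sub_finite_set => n _; exists n.
Qed.

Lemma finite_preimage_inj (T U : Type) (B : set U) (f : T -> U) : injective f ->
  finite_set B -> finite_set (f @^-1` B).
Proof. by move=> hf; apply: finite_preimage; exact: in2W. Qed.

Definition never_square (Xi : seq k) (D : k) := forall xi l, xi \in Xi -> xi * D != l ^+ 2.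

Lemma infinite_never_square (Xi : seq k) : 0 \notin Xi ->
  infinite_set [set x | exists lx : k, [/\ x = iota lx, 1 < x < 3 / 2,
    forall s : {rmorphism k -> R}, (exists z, s z <> iota z) -> s lx ^+ 2 <= 3 / 4,
    <<1; lx ^+ 2>>%VS = fullv & never_square Xi (lx ^+ 2 - 3 / 4)]].
Proof.
move=> hXi; have [h [h0 hgen hdom]] := dominated_element iota.
have hn0 : h != 0 by apply: contraTneq h0 => ->; rewrite rmorph0 ltxx.
have nk (m : nat) : (m.+1)%:R != 0 :> k by rewrite -(fmorph_eq0 iota) rmorph_nat pnatr_eq0.
pose u := 3 * h ^+ 2.
have h2u : h ^+ 2 \in <<1; u>>%VS.
  have -> : h ^+ 2 = (3^-1 : rat) *: u by rewrite /u mulr_natl -scaler_nat scalerA mulVf // scale1r.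
  by rewrite rpredZ // memv_adjoin.
have hu : <<1; u>>%VS = fullv.
  apply/eqP; rewrite eqEsubv subvf /= -hgen; apply/FadjoinP; split; [exact: sub1v|exact: h2u].
have u0 : u != 0 by rewrite mulf_neq0 ?(nk 2) // expf_neq0.
have [p [n [pp p2 hp]]] := nonsquare_parameter hu u0 hXi.
pose H := iota h.
(* The intervals are disjoint, so different [j] give different parameters, and they lie between
   [2 * H] and [3 * H], which puts [rho / (2 * H)] between 1 and 3/2. *)
pose lo (j : nat) : R := 2 * H + H / (j.+2)%:R.
pose hi (j : nat) : R := 2 * H + H / (j.+1)%:R.
have lohi j : lo j < hi j.
  by rewrite ltrD2l ltr_pM2l // ltf_pV2 ?posrE ?ltr0n // ltr_nat.
have /choice[f hf] (j : nat) : exists ve : int * nat,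
    lo j < n%:~R + (p%:Z ^+ 2 * ve.1)%:~R / (2 ^ ve.2)%:R < hi j.
  by have [v [e he]] := dyadic_dense n (prime_gt0 pp) (lohi j); exists (v, e).
pose rho (j : nat) : rat := n%:~R + (p%:Z ^+ 2 * (f j).1)%:~R / (2 ^ (f j).2)%:R.
have rhoE j : ratr (rho j) = n%:~R + (p%:Z ^+ 2 * (f j).1)%:~R / (2 ^ (f j).2)%:R :> R.
  by rewrite rmorphD /= fmorph_div rmorph_nat /= !ratr_int.
have rho_itv j : lo j < ratr (rho j) < hi j by rewrite rhoE.
pose lx (j : nat) : k := (rho j)%:A / (2 * h).
have lxE j (s : {rmorphism k -> R}) : s (lx j) = ratr (rho j) / (2 * s h).
  by rewrite fmorph_div rmorph_rat rmorphM rmorph_nat.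
have lo2 j : 2 * H < lo j by rewrite ltrDl divr_gt0.
have hi3 j : hi j <= 3 * H.
  have : H / (j.+1)%:R <= H by rewrite ler_pdivrMr // ler_peMr ?ler1n // ltW.
  rewrite /hi => hle; have -> : 3 * H = 2 * H + H by ring.
  by rewrite lerD2l.
have rho0 j : 0 < ratr (rho j) :> R.
  have /andP[r1 _] := rho_itv j; apply: lt_trans r1; apply: lt_trans (lo2 j).
  by rewrite mulr_gt0.
have H2 : 0 < 2 * H by rewrite mulr_gt0.
have xj j : 1 < iota (lx j) < 3 / 2.
  rewrite lxE -/H; have /andP[r1 r2] := rho_itv j; have := lo2 j; have := hi3 j.
  by rewrite ltr_pdivlMr // ltr_pdivrMr // => *; apply/andP; split; lra.
have inj : injective (fun j => iota (lx j)).
  have dec i j : (i < j)%N -> ratr (rho j) < ratr (rho i) :> R.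
    move=> hij; have /andP[_ r2] := rho_itv j; have /andP[r1 _] := rho_itv i.
    apply: lt_trans r2 _; apply: le_lt_trans r1; rewrite lerD2l ler_pM2l //.
    by rewrite lef_pV2 ?posrE ?ltr0n // ler_nat.
  move=> i j; rewrite /= !lxE => /(mulIf (invr_neq0 (lt0r_neq0 H2))) e.
  by have [/dec|/dec|//] := ltngtP i j; rewrite e ltxx.
apply: sub_infinite_set (infinite_range inj) => _ [j _ <-].
exists (lx j); split=> //.
- move=> s hs; have hd := hdom s hs; rewrite lxE.
  have Hh : 0 < H by [].
  have sh0 : 0 < `|s h| by rewrite -/H in hd; lra.
  have nE : `|ratr (rho j) / (2 * s h)| = ratr (rho j) / (2 * `|s h|) :> R.
    by rewrite normf_div gtr0_norm // normrM ger0_norm.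
  rewrite -real_normK ?num_real // nE.
  have le1 : ratr (rho j) / (2 * `|s h|) <= 1 / 2.
    rewrite ler_pdivrMr; last by rewrite mulr_gt0.
    by have /andP[_ r2] := rho_itv j; have := hi3 j; rewrite -/H in hd; lra.
  have ge0 : 0 <= ratr (rho j) / (2 * `|s h|) by rewrite divr_ge0 // ltW // ltr0q -(ltr0q R).
  have : (ratr (rho j) / (2 * `|s h|)) ^+ 2 <= (1 / 2) ^+ 2 by rewrite lerXn2r ?nnegrE //; lra.
  lra.
- apply/eqP; rewrite eqEsubv subvf /= -hgen; apply/FadjoinP; split; first exact: sub1v.
  have -> : h ^+ 2 = ((rho j) ^+ 2 / 4) *: (lx j ^+ 2)^-1.
    have eA : (rho j ^+ 2 / 4)%:A = (rho j)%:A ^+ 2 / 4 :> k.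
      by rewrite -[LHS]/(GRing.in_alg k _) fmorph_div rmorphXn rmorph_nat.
    rewrite -[RHS]mulr_algl eA /lx.
    have r0 : ((rho j)%:A : k) != 0.
      rewrite scaler_eq0 oner_eq0 orbF; apply/eqP => e; have := rho0 j; by rewrite e rmorph0 ltxx.
    by field; rewrite r0 (nk 1) (nk 3) hn0.
  by rewrite rpredZ // rpredV memv_adjoin.
- move=> xi l hxi; apply/eqP => e.
  have cE : coprime p (2 ^ (f j).2).
    by rewrite coprimeXr // prime_coprime // dvdn_prime2 //; apply/eqP => h2; move: p2; rewrite h2.
  have E0 : (0 < 2 ^ (f j).2)%N by rewrite expn_gt0.
  have := hp (f j).1 (2 ^ (f j).2)%N cE E0 xi (l * (2 * h)) hxi.
  rewrite -/(rho j) exprMn -e => /eqP; apply.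
  have -> : (rho j ^+ 2)%:A = (rho j)%:A ^+ 2 :> k by exact: (rmorphXn (GRing.in_alg k)).
  rewrite /u /lx; field.
  by rewrite hn0 (nk 3) (nk 1).
Qed.

End NeverSquare.

Section Supply.
Variables (R : realType) (k : fieldExtType rat) (iota : {rmorphism k -> R}).

(** The denominator [w] lets one condition serve both parameters: [y ^+ 2 - 3 / 4] is
    [x ^+ 2 - 3 / 4] divided by the square of [2 * (x - 1)]. *)
Lemma never_square_multiple (Xi : seq k) (lx w l : k) (xi : R) :
  never_square Xi (lx ^+ 2 - 3 / 4) -> 1 < iota lx -> w != 0 ->
  (forall z, iota z = xi -> z != 0 -> z \in Xi) ->
  xi * ((iota lx ^+ 2 - 3 / 4) / iota w ^+ 2) = iota l ^+ 2 -> xi = 0.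
Proof.
move=> hns hx w0 hXi e; set D := lx ^+ 2 - 3 / 4 in hns.
have eD : iota D = iota lx ^+ 2 - 3 / 4.
  by rewrite rmorphB rmorphXn fmorph_div !rmorph_nat.
have D0 : D != 0.
  rewrite -(fmorph_eq0 iota) eD; apply: lt0r_neq0.
  by rewrite subr_gt0; apply: lt_trans (_ : 1 < _); [lra|rewrite expr_gt1 // ltW // (lt_trans ltr01)].
have iw0 : iota w != 0 by rewrite fmorph_eq0.
have iD0 : iota D != 0 by rewrite fmorph_eq0.
have ez : iota ((l * w) ^+ 2 / D) = xi.
  rewrite fmorph_div rmorphXn rmorphM exprMn -e -eD; field.
  by rewrite iw0 iD0.
apply: contraPeq (hns ((l * w) ^+ 2 / D) (l * w)) => xi0 /(_ _) H.
have /H : (l * w) ^+ 2 / D \in Xi by apply: hXi => //; rewrite -(fmorph_eq0 iota) ez.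
by rewrite divfK // eqxx.
Qed.

Lemma opposite_param_inj : injective (fun x : R => 1 + (4 * (x - 1))^-1).
Proof.
move=> x y /addrI/invr_inj/mulfI h; have : x - 1 = y - 1 by apply: h; rewrite pnatr_eq0.
by move/addIr.
Qed.

Lemma cross_cosine_inj : injective (fun x : R => 1 - (4 * (x + 1))^-1).
Proof.
move=> x y /addrI/oppr_inj/invr_inj/mulfI h; have : x + 1 = y + 1 by apply: h; rewrite pnatr_eq0.
by move/addIr.
Qed.

Definition admissible_params (F : set R) : set R := [set x | exists lx : k,
  [/\ x = iota lx, 1 < x < 3 / 2,
      forall s : {rmorphism k -> R}, (exists z, s z <> iota z) -> s lx ^+ 2 <= 3 / 4,
      <<1; lx ^+ 2>>%VS = fullv &
      generic_param iota F x /\ generic_param iota F (1 + (4 * (x - 1))^-1)]].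

Theorem infinite_admissible_params (F : set R) : finite_set F ->
  infinite_set (admissible_params F).
Proof.
move=> hF.
pose A : set R := [set p ^+ 2 * kappa0 p q | p in F & q in F] `|`
                  [set p ^+ 2 * kappa1 p q | p in F & q in F].
have hA : finite_set A by rewrite finite_setU; split; apply: finite_image2.
have : finite_set ((iota @^-1` A) `\` [set 0]).
  by apply: finite_setD; apply: finite_preimage_inj hA; exact: fmorph_inj.
case/finite_seqP => Xi eXi.
have hXi xi : A xi -> forall z, iota z = xi -> z != 0 -> z \in Xi.
  move=> hxi z ez z0; have : ((iota @^-1` A) `\` [set 0]) z by split; [rewrite /= ez|exact/eqP].
  by rewrite eXi.
have Xi0 : 0 \notin Xi.
  by apply/negP => h; have : [set` Xi] 0 by []; rewrite -eXi => -[_]; apply.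
(* The square conditions are met through [Xi]. The remaining clauses of [generic_param] exclude only
   finitely many values, which are removed for [x] and, by an injective change of variable, for
   [y]. *)
pose B1 : set R := [set (t.2 - t.1.2) / (2 * t.1.1) | t in (F `*` F) `*` F].
pose B : set R := B1 `|` (fun x : R => 1 - (4 * (x + 1))^-1) @^-1` F.
have hB : finite_set B.
  rewrite finite_setU; split; first by apply: finite_image; do 2![apply: finite_setX => //].
  by apply: finite_preimage_inj hF; exact: cross_cosine_inj.
have hB' : finite_set (B `|` (fun x : R => 1 + (4 * (x - 1))^-1) @^-1` B).
  by rewrite finite_setU; split=> //; apply: finite_preimage_inj hB; exact: opposite_param_inj.
have hBx x : ~ B x -> (forall p q q', F p -> F q -> F q' -> 2 * x * p = q' - q -> p = 0) /\
    ~ F (1 - (4 * (x + 1))^-1).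
  move=> hx; split; last by move=> h; apply: hx; right.
  move=> p q q' hp hq hq' e; apply/eqP; apply/negP => /negP p0; apply: hx; left.
  exists ((p, q), q') => //=; rewrite -e; field; exact: p0.
refine (sub_infinite_set _ (infinite_setD (infinite_never_square (iota := iota) Xi0) hB')).
move=> x [[lx [ex hx12 hs hgen hns]] /not_orP[nB nB']].
have /andP[x1 x32] := hx12.
have [x4 x5] := hBx _ nB; have [y4 y5] := hBx _ nB'.
have ilx : 1 < iota lx by rewrite -ex.
have xm1 : x - 1 != 0 by rewrite lt0r_neq0 // subr_gt0.
have w0 : 2 * (lx - 1) != 0 :> k.
  by rewrite -(fmorph_eq0 iota) rmorphM rmorphB rmorph1 rmorph_nat -ex mulf_neq0 ?pnatr_eq0.
have yE : (1 + (4 * (x - 1))^-1) ^+ 2 - 3 / 4 =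
    (iota lx ^+ 2 - 3 / 4) / iota (2 * (lx - 1)) ^+ 2.
  by rewrite rmorphM rmorphB rmorph1 rmorph_nat -ex; field; exact: xm1.
exists lx; split=> //; split; split=> //.
- by exists lx.
- move=> p q l hp hq e; apply: (never_square_multiple (w := 1) (l := l) hns ilx (oner_neq0 _)).
    by apply: hXi; left; exists p => //; exists q.
  by rewrite rmorph1 expr1n divr1 -ex.
- move=> p q l hp hq e; apply: (never_square_multiple (w := 1) (l := l) hns ilx (oner_neq0 _)).
    by apply: hXi; right; exists p => //; exists q.
  by rewrite rmorph1 expr1n divr1 -ex.
- by exists (1 + (4 * (lx - 1))^-1); rewrite rmorphD fmorphV rmorphM rmorphB rmorph1 rmorph_nat -ex.
- move=> p q l hp hq e; apply: (never_square_multiple (w := 2 * (lx - 1)) (l := l) hns ilx w0).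
    by apply: hXi; left; exists p => //; exists q.
  by rewrite -e yE.
- move=> p q l hp hq e; apply: (never_square_multiple (w := 2 * (lx - 1)) (l := l) hns ilx w0).
    by apply: hXi; right; exists p => //; exists q.
  by rewrite -e yE.
Qed.

End Supply.

(** * The quadrilaterals *)

Section ConcreteQuadrilateral.
Variable R : realType.
Local Notation V := 'cV[R]_3.

Definition vec3 (p q r : R) : V := \col_(i < 3) nth 0 [:: p; q; r] i.

Lemma lorentz_vec3 p q r p' q' r' :
  lorentz (vec3 p q r) (vec3 p' q' r') = - (p * p') + q * q' + r * r'.
Proof. by rewrite lorentzE !mxE. Qed.

(* In the projective model, the polygon lies in a disc of radius < 1. *)
Definition narrow (a b c d : V) := exists2 r : R, r < 1 & forall n : V, 0 < n 0 0 ->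
  lorentz n a <= 0 -> lorentz n b <= 0 -> lorentz n c <= 0 -> lorentz n d <= 0 ->
  n 1 0 ^+ 2 + n 2%:R 0 ^+ 2 <= r * n 0 0 ^+ 2.

Lemma narrow_compact a b c d : narrow a b c d -> compact_cone a b c d.
Proof.
move=> [r r1 hr] n n0 nn ha hb hc hd; have := hr n n0 ha hb hc hd.
rewrite lorentzE -!expr2; have n2 : 0 < n 0 0 ^+ 2 by rewrite exprn_gt0.
have : r * n 0 0 ^+ 2 < 1 * n 0 0 ^+ 2 by rewrite ltr_pM2r.
lra.
Qed.

Theorem quad_exists x : 1 < x -> x < 3 / 2 -> exists a b c d v : V,
  [/\ quad_gram a b c d x (1 + (4 * (x - 1))^-1), interior_point a b c d v & narrow a b c d].
Proof.
move=> x1 x32; pose t := x ^+ 2 - 1.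
have t0 : 0 < t by rewrite subr_gt0 expr_gt1 //; lra.
pose s := Num.sqrt t; have s0 : 0 < s by rewrite sqrtr_gt0.
have ss : s ^+ 2 = x ^+ 2 - 1 by rewrite sqr_sqrtr // ltW.
pose B := Num.sqrt (1 + (4 * t)^-1).
have Bp : 0 < 1 + (4 * t)^-1 by rewrite addr_gt0 // invr_gt0 mulr_gt0.
have B0 : 0 < B by rewrite sqrtr_gt0.
have BB : B ^+ 2 = 1 + (4 * s ^+ 2)^-1 by rewrite sqr_sqrtr ?ltW // ss.
have sn := lt0r_neq0 s0.
have xn : x - 1 != 0 by rewrite lt0r_neq0 // subr_gt0.
clearbody s B; pose y := 1 + (4 * (x - 1))^-1.
have y1 : 1 < y by rewrite ltrDl invr_gt0 mulr_gt0 // subr_gt0.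
(* The common perpendicular of [a] and [c] is the line where the last coordinate vanishes. The
   products with [a] and [c] give the first two coordinates of [b] and [d], and their unit norm
   gives the last one, [B] up to sign. *)
pose a := vec3 0 1 0; pose b := vec3 (2 * s)^-1 0 B.
pose c := vec3 s (- x) 0; pose d := vec3 (x / (2 * s)) (- 2^-1) (- B).
have hq : quad_gram a b c d x y.
  rewrite /quad_gram !lorentz_vec3; split.
  - split; first ring.
    + have -> : - ((2 * s)^-1 * (2 * s)^-1) + 0 * 0 + B * B = B ^+ 2 - (4 * s ^+ 2)^-1 by field.
      by rewrite BB addrK.
    + have -> : - (s * s) + - x * - x + 0 * 0 = x ^+ 2 - s ^+ 2 by ring.
      by rewrite ss; ring.
    + have -> : - (x / (2 * s) * (x / (2 * s))) + - 2^-1 * - 2^-1 + - B * - B =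
        B ^+ 2 + 4^-1 - x ^+ 2 / (4 * s ^+ 2) by field.
      rewrite BB (_ : x ^+ 2 = s ^+ 2 + 1); last by rewrite ss subrK.
      by field.
  - split; [ring|field; exact: sn| field; exact: sn|field; exact: sn].
  - split; first ring.
    have -> : - ((2 * s)^-1 * (x / (2 * s))) + 0 * - 2^-1 + B * - B = - B ^+ 2 - x / (4 * s ^+ 2).
      by field.
    rewrite BB ss /y; field; rewrite xn -ss expf_neq0 //.
  - by split=> //; rewrite /y; field.
(* The products of the sum with the normals are the row sums of the Gram matrix, [1 / 2 - x] and
   [1 / 2 - y], all negative. *)
exists a, b, c, d, (a + b + c + d); split=> //.
- have [[haa hbb hcc hdd] [hab hbc hcd hda] [hac hbd] _] := hq.
  have v0 : 0 < (a + b + c + d) 0 0.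
    rewrite !mxE /= add0r; apply: addr_gt0; first by rewrite addr_gt0 // invr_gt0 mulr_gt0.
    by rewrite divr_gt0 ?mulr_gt0 //; lra.
  clear -x1 x32 y1 v0 haa hbb hcc hdd hab hbc hcd hda hac hbd.
  by clearbody a b c d y; (split; first split=> //; last split);
    rewrite !lorentz_lin ?(lorentzC b a) ?(lorentzC c b) ?(lorentzC d c) ?(lorentzC a d)
    ?(lorentzC c a) ?(lorentzC d b) ?haa ?hbb ?hcc ?hdd ?hab ?hbc ?hcd ?hda ?hac ?hbd; lra.
have x2 : 1 < x ^+ 2 by rewrite expr_gt1 //; lra.
have x20 : 0 < x ^+ 2 by lra.
have x3 : 0 < 4 * x ^+ 2 - 3 by lra.
have x2n := lt0r_neq0 x20; have x3n := lt0r_neq0 x3.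
(* The sides [a] and [c] bound the first spatial coordinate and contribute [1 - 1 / x^2]; [b] and
   [d] bound the second and contribute the other term. The sum is below 1 because
   [1 < x ^+ 2 < 3]. *)
exists (1 - (x ^+ 2)^-1 + x ^+ 2 / (4 * x ^+ 2 - 3)).
  rewrite -subr_gt0.
  have -> : 1 - (1 - (x ^+ 2)^-1 + x ^+ 2 / (4 * x ^+ 2 - 3)) =
    (x ^+ 2 - 1) * (3 - x ^+ 2) / (x ^+ 2 * (4 * x ^+ 2 - 3)).
    field; by rewrite x3n -sqrf_eq0.
  rewrite divr_gt0 ?(mulr_gt0 t0) ?(mulr_gt0 x20) //.
  rewrite subr_gt0; have : x ^+ 2 < (3 / 2) ^+ 2 by apply: ltrXn2r => //; lra.
  lra.
move=> n n0; rewrite /a /b /c /d !lorentzE !mxE /=; clear a b c d hq.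
move: (n 0 0) (n 1 0) (n 2%:R 0) n0 => p q r p0 ha hb hc hd.
have q2 : q ^+ 2 * x ^+ 2 <= (x ^+ 2 - 1) * p ^+ 2.
  have q0 : 0 <= - q * x by rewrite mulr_ge0 //; lra.
  have sp : - q * x <= s * p by lra.
  rewrite -ss -!exprMn -(sqrrN (q * x)) -mulNr.
  by rewrite ler_sqr ?nnegrE // mulr_ge0 // ltW.
have i1 : 0 < (2 * s)^-1 by rewrite invr_gt0 mulr_gt0.
have r1 : `|B * r| <= p * (x * (2 * s)^-1).
  have pi0 : p * (2 * s)^-1 <= p * (x * (2 * s)^-1).
    by rewrite (ler_wpM2l (ltW p0)) // ler_peMl // ltW.
  rewrite ler_norml; lra.
have r2 : r ^+ 2 * (4 * x ^+ 2 - 3) <= x ^+ 2 * p ^+ 2.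
  have : `|B * r| ^+ 2 <= (p * (x * (2 * s)^-1)) ^+ 2.
    by rewrite lerXn2r ?nnegrE // (le_trans _ r1).
  rewrite real_normK ?num_real // exprMn BB => h.
  have -> : r ^+ 2 * (4 * x ^+ 2 - 3) = 4 * s ^+ 2 * ((1 + (4 * s ^+ 2)^-1) * r ^+ 2).
    have -> : x ^+ 2 = s ^+ 2 + 1 by rewrite ss subrK.
    by field.
  have -> : x ^+ 2 * p ^+ 2 = 4 * s ^+ 2 * (p * (x * (2 * s)^-1)) ^+ 2 by field.
  by rewrite ler_pM2l // mulr_gt0 // exprn_gt0.
have q3 : q ^+ 2 <= (1 - (x ^+ 2)^-1) * p ^+ 2.
  rewrite -(ler_pM2r x20) (_ : _ * p ^+ 2 * x ^+ 2 = (x ^+ 2 - 1) * p ^+ 2) //.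
  by rewrite mulrAC mulrBl mulVf // mul1r.
have r3 : r ^+ 2 <= x ^+ 2 / (4 * x ^+ 2 - 3) * p ^+ 2.
  by rewrite -(ler_pM2r x3) [_ * p ^+ 2 * _]mulrAC divfK.
by rewrite mulrDl lerD.
Qed.

End ConcreteQuadrilateral.

(** * Angles of the quadrilateral *)

Section Coxeter.
Variable R : realType.
Local Notation V := 'cV[R]_3.

Lemma cos_pi3 : cos (pi / 3 : R) = 1 / 2.
Proof.
pose t : R := pi / 3; have ht : 0 < cos t.
  apply: cos_gt0_pihalf; have := pi_gt0 R; rewrite /t => ?; apply/andP; split; lra.
have e : pi = t + (t + t) :> R by rewrite /t; field.
have h0 := cospi R; rewrite e cosD sinD cosD in h0; move: (cos2Dsin2 t) h0.
rewrite -/t; move: (cos t) (sin t) ht => c s c0 cs h.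
have h' : c ^+ 3 - 3 * c * s ^+ 2 + 1 = 0 by lra.
have es : s ^+ 2 = 1 - c ^+ 2 by lra.
have : (c + 1) * (2 * c - 1) ^+ 2 = 0 by rewrite -h' es; ring.
move/eqP; rewrite mulf_eq0 expf_eq0 /= => /orP[|] /eqP h2; lra.
Qed.

Lemma acos_half : acos (1 / 2 : R) = pi / 3.
Proof.
rewrite -cos_pi3 cosK // in_itv /=; have := pi_gt0 R => ?.
by apply/andP; split; lra.
Qed.

Variables (a b c d v0 : V) (x y : R).
Hypotheses (hq : quad_gram a b c d x y) (hv0 : interior_point a b c d v0).
Local Notation e := (quad_normals a b c d).

Lemma quad_normals_inj i j : i != j -> e j != e i.
Proof.
move=> hij; apply/eqP => eij; have := quad_normals_coxeter hq hij.
by rewrite eij (quad_normals_unit hq) => -[]; lra.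
Qed.

Lemma quad_coxeter : is_coxeter_polygon e.
Proof.
split; first split.
- exact: (quad_normals_unit hq).
- have [hf [va vb vc vd]] := hv0; have [s s0 hs] := future_normalize hf.
  exists (s *: v0) => // i; rewrite lorentzZl pmulr_rlt0 //.
  by move: i; apply: ord4_ind.
- move=> i; have [u [fu ui uj]] := side_point hq hv0 (quad_normals_mem a b c d i).
  have [s s0 hs] := future_normalize fu.
  have neg j : j != i -> lorentz (s *: u) (e j) < 0.
    move=> ji; rewrite lorentzZl pmulr_rlt0 //; apply: uj; first exact: quad_normals_mem.
    by apply: quad_normals_inj; rewrite eq_sym.
  have si : lorentz (s *: u) (e i) = 0 by rewrite lorentzZl ui mulr0.
  exists (s *: u) => //; split=> //; split=> // j.
  by have [->|/neg/ltW//] := eqVneq j i; rewrite si.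
move=> i j hij [z [[[hz _] zi] [_ zj]]]; rewrite /dihedral_angle.
case: (quad_normals_coxeter hq hij) => [->|->|hle].
- by exists 2%N => //; rewrite oppr0 acos0.
- by exists 3%N => //; rewrite opprK -[2^-1]div1r acos_half.
(* Opposite sides do not meet: at a common point [crossing_lt1] would make the square of the product
   less than 1. *)
have eu := quad_normals_unit hq.
have hji := quad_normals_inj hij.
have [z2 _] := hyperbolic_future hz.
have [eN|neN] := eqVneq (e j) (- e i).
  have [v [hv vi vj] ] : exists v, [/\ future v, lorentz v (e i) < 0 & lorentz v (e j) < 0].
    have [hf [va vb vc vd]] := hv0; exists v0; split=> //.
      by move: (i); apply: ord4_ind.
    by move: (j); apply: ord4_ind.
  by move: vj; rewrite eN lorentzNr; lra.
have := crossing_lt1 z2 (eu i) (eu j) _ _ hji neN.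
rewrite !(lorentzC _ z) => /(_ zi zj).
move=> h; have : 0 <= (- 1 - lorentz (e i) (e j)) * (1 - lorentz (e i) (e j)) by rewrite mulr_ge0; lra.
lra.
Qed.

End Coxeter.

(** * Finiteness of the area *)

Section Area.
Variable R : realType.
Local Notation V := 'cV[R]_3.
Local Notation mu2 := (@lebesgue_measure R \x @lebesgue_measure R)%E.

Lemma measurable_chart_height :
  measurable_fun setT (fun p : R * R => Num.sqrt (1 + p.1 ^+ 2 + p.2 ^+ 2)).
Proof.
apply: (@measurableT_comp _ _ _ _ _ _ (@Num.sqrt R)).
  by apply: continuous_measurable_fun; exact: sqrt_continuous.
apply: measurable_funD; last by apply: measurable_funX.
by apply: measurable_funD => //; apply: measurable_funX.
Qed.

Lemma chart_inv_coord (p : R * R) :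
  [/\ chart_inv p 0 0 = Num.sqrt (1 + p.1 ^+ 2 + p.2 ^+ 2), chart_inv p 1 0 = p.1 &
      chart_inv p 2%:R 0 = p.2].
Proof. by split; rewrite mxE. Qed.

Lemma measurable_chart_lorentz (u : V) :
  measurable_fun setT (fun p : R * R => lorentz (chart_inv p) u).
Proof.
have -> : (fun p : R * R => lorentz (chart_inv p) u) =
    (fun p => - (Num.sqrt (1 + p.1 ^+ 2 + p.2 ^+ 2) * u 0 0) + p.1 * u 1 0 + p.2 * u 2%:R 0).
  by apply/funext => p; have [h0 h1 h2] := chart_inv_coord p; rewrite lorentzE h0 h1 h2.
apply: measurable_funD; last by apply: measurable_funM.
apply: measurable_funD; last by apply: measurable_funM.
by apply: measurable_funN; apply: measurable_funM => //; exact: measurable_chart_height.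
Qed.

Lemma chart_inv_hyperbolic (p : R * R) : hyperbolic_plane (chart_inv p).
Proof.
have [h0 h1 h2] := chart_inv_coord p.
have pos : 0 < 1 + p.1 ^+ 2 + p.2 ^+ 2 by rewrite ltr_wpDr ?sqr_ge0 // ltr_wpDr ?sqr_ge0.
split; last by rewrite h0 sqrtr_gt0.
by rewrite lorentzE h0 h1 h2 -!expr2 sqr_sqrtr ?ltW //; ring.
Qed.

(** In the chart the density is at most 1, and a bound on the height confines the region to the
    square of side [2 * C]. *)
Lemma finite_area (N : nat) (e : 'I_N -> V) (C : R) :
  (forall z, polygon e z -> z 0 0 <= C) -> (hyperbolic_area (polygon e) < +oo)%E.
Proof.
move=> hC; set D := @chart_inv R @^-1` polygon e.
have mD : measurable D.
  have -> : D = \bigcap_(i in [set: 'I_N]) [set p | lorentz (chart_inv p) (e i) <= 0].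
    apply/seteqP; split=> [p [_ h] i _|p h]; first exact: h.
    by split=> [|i]; [exact: chart_inv_hyperbolic|exact: h].
  apply: fin_bigcap_measurable => // i _.
  have := measurable_chart_lorentz (e i) measurableT (measurable_itv `]-oo, 0]).
  by rewrite setTI; congr measurable; apply/seteqP; split=> p; rewrite /= in_itv.
pose B : set R := `[- C, C]%classic.
have mB : measurable B by exact: measurable_itv.
have hD : D `<=` B `*` B.
  move=> p hp; have := hC _ hp; have [h0 h1 h2] := chart_inv_coord p; rewrite h0.
  have pos : 0 <= 1 + p.1 ^+ 2 + p.2 ^+ 2 by rewrite !addr_ge0 ?sqr_ge0.
  have bnd t : t ^+ 2 <= 1 + p.1 ^+ 2 + p.2 ^+ 2 -> Num.sqrt (1 + p.1 ^+ 2 + p.2 ^+ 2) <= C ->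
      B t.
    move=> ht hs; rewrite /B /= in_itv /= -ler_norml -sqrtr_sqr; apply: le_trans hs.
    by rewrite ler_wsqrtr.
  by move=> hs; split; apply: bnd => //; have := sqr_ge0 p.1; have := sqr_ge0 p.2; lra.
have mI : measurable_fun setT (fun p : R * R => (Num.sqrt (1 + p.1 ^+ 2 + p.2 ^+ 2))^-1).
  have -> : (fun p : R * R => (Num.sqrt (1 + p.1 ^+ 2 + p.2 ^+ 2))^-1) =
      (@powR R ^~ (-1)) \o (fun p => Num.sqrt (1 + p.1 ^+ 2 + p.2 ^+ 2)).
    by apply/funext => p; rewrite /= powR_inv1 // sqrtr_ge0.
  by apply: measurableT_comp; [exact: measurable_powR|exact: measurable_chart_height].
apply: (@le_lt_trans _ _ (\int[mu2]_(p in D) (cst 1%:E p))%E).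
  apply: ge0_le_integral => //.
  - by refine (measurable_funTS _); exact/measurable_EFinP.
  - move=> p _; rewrite lee_fin.
    have one : 1 <= Num.sqrt (1 + p.1 ^+ 2 + p.2 ^+ 2) :> R.
      by rewrite -[leLHS]sqrtr1 ler_wsqrtr // -addrA lerDl addr_ge0 ?sqr_ge0.
    by rewrite invf_le1 // (lt_le_trans ltr01).
rewrite integral_cst // mul1e.
apply: (@le_lt_trans _ _ (mu2 (B `*` B))).
  by apply: le_measure => //; rewrite inE //; exact: measurableX.
rewrite product_measure1E //= /B lebesgue_measure_itv /=.
by case: ifP => _; rewrite ?mule0 ?ltry // -!EFinD -EFinM ltry.
Qed.

Lemma narrow_bounded (a b c d : V) : narrow a b c d ->
  exists C, forall z, polygon (quad_normals a b c d) z -> z 0 0 <= C.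
Proof.
move=> [r r1 hr]; exists (Num.sqrt (1 - r)^-1) => z [[z1 z0] hz].
have r0 : 0 < 1 - r by rewrite subr_gt0.
have := hr z z0 (hz 0) (hz 1) (hz 2%:R) (hz 3%:R).
move: z1; rewrite lorentzE -!expr2 => z1 h.
rewrite -[z 0 0]ger0_norm ?(ltW z0) // -sqrtr_sqr ler_wsqrtr //.
rewrite -(ler_pM2r r0) mulVf ?lt0r_neq0 //; lra.
Qed.

End Area.

(** * The Gram field and quasi-arithmeticity *)

Section Subfields.
Variable R : realType.

Lemma subfield_horner (F : set R) (q : {poly rat}) w : divring_closed (mem F) -> F w ->
  F (map_poly ratr q).[w].
Proof.
move=> [f1 fB fD].
have {f1} f1 : F 1 by move: f1; rewrite inE.
have {fB} fB s t : F s -> F t -> F (s - t) by move=> hs ht; have := fB s t; rewrite !inE; apply.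
have {fD} fD s t : F s -> F t -> F (s / t) by move=> hs ht; have := fD s t; rewrite !inE; apply.
have f0 : F 0 by rewrite -(subrr 1); apply: fB.
have fN s : F s -> F (- s) by move=> hs; rewrite -sub0r; apply: fB.
have fS s t : F s -> F t -> F (s + t) by move=> hs ht; rewrite -(opprK t); apply: fB => //; apply: fN.
have fV s : F s -> F s^-1 by move=> hs; rewrite -div1r; apply: fD.
have fM s t : F s -> F t -> F (s * t) by move=> hs ht; rewrite -(invrK t); apply: fD => //; apply: fV.
have fn n : F n%:R by elim: n => // n IH; rewrite -natr1; apply: fS.
have fz (n : int) : F n%:~R.
  by case: n => n; [exact: fn|rewrite NegzE mulrNz; apply: fN; exact: fn].
move=> hw; rewrite horner_coef; apply: big_ind => // i _.
apply: (fM _ _); first by rewrite coef_map /=; apply: (fD _ _); exact: fz.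
by elim: (nat_of_ord i) => [|m IH]; rewrite ?expr0 // exprS; apply: fM.
Qed.

Lemma generated_subfield_closed (S : set R) : divring_closed (mem (generated_subfield S)).
Proof.
split; rewrite ?inE.
- by move=> F [[F1 _ _] _]; move: F1; rewrite inE.
- move=> s t; rewrite !inE => hs ht F hF; have [[_ FB _] _] := hF.
  by have := FB s t; rewrite !inE; apply; [exact: hs|exact: ht].
- move=> s t; rewrite !inE => hs ht F hF; have [[_ _ FD] _] := hF.
  by have := FD s t; rewrite !inE; apply; [exact: hs|exact: ht].
Qed.

Variables (k : fieldExtType rat) (iota : {rmorphism k -> R}).

Lemma generated_subfield_eq (S : set R) (w : k) : <<1; w>>%VS = fullv ->
  S `<=` range iota -> generated_subfield S (iota w) -> generated_subfield S = range iota.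
Proof.
move=> hw hS hSw; apply/seteqP; split.
  apply: smallest_sub => //; split; rewrite ?inE.
  - by exists 1; rewrite ?rmorph1.
  - by move=> s t; rewrite !inE => -[s' _ <-] [t' _ <-]; exists (s' - t'); rewrite ?rmorphB.
  - by move=> s t; rewrite !inE => -[s' _ <-] [t' _ <-]; exists (s' / t'); rewrite ?fmorph_div.
move=> _ [z _ <-]; have [|q hq] := @generated_value k w z; first by rewrite hw memvf.
rewrite hq; exact: (subfield_horner _ (generated_subfield_closed _) hSw).
Qed.

End Subfields.

Section QuasiArithmetic.
Variables (R : realType) (k : fieldExtType rat) (iota : {rmorphism k -> R}).
Local Notation V := 'cV[R]_3.
Variables (a b c d : V) (lx : k).
Let ly := 1 + (4 * (lx - 1))^-1.
Hypothesis hq : quad_gram a b c d (iota lx) (iota ly).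
Hypothesis hgen : <<1; lx ^+ 2>>%VS = fullv.
Hypothesis hs : forall s : {rmorphism k -> R}, (exists z, s z <> iota z) -> s lx ^+ 2 <= 3 / 4.

Definition gram_over : 'M[k]_4 := \matrix_(i, j) nth 0 (nth [::]
  [:: [:: 1; 0; - lx; - 2^-1]; [:: 0; 1; - 2^-1; - ly];
      [:: - lx; - 2^-1; 1; 0]; [:: - 2^-1; - ly; 0; 1]] i) j.

Lemma gram_over_map : gram (quad_normals a b c d) = map_mx iota gram_over.
Proof.
have [[haa hbb hcc hdd] [hab hbc hcd hda] [hac hbd] _] := hq.
have hba := hab; have hcb := hbc; have hdc := hcd; have had := hda; have hca := hac; have hdb := hbd.
rewrite lorentzC in hba; rewrite lorentzC in hcb; rewrite lorentzC in hdc; rewrite lorentzC in had.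
rewrite lorentzC in hca; rewrite lorentzC in hdb.
apply/matrixP; apply: ord4_ind; apply: ord4_ind; rewrite !mxE /quad_normals /=;
 rewrite ?rmorphN ?rmorph0 ?rmorph1 ?fmorphV ?rmorph_nat //.
Qed.

Lemma sum_ord4 (M : nmodType) (f : 'I_4 -> M) : \sum_i f i = f 0 + f 1 + f 2%:R + f 3%:R.
Proof.
rewrite !big_ord_recl big_ord0 addr0 !addrA.
by congr (f _ + f _ + f _ + f _); exact/val_inj.
Qed.

Lemma gram_over_psd (s : {rmorphism k -> R}) : s lx ^+ 2 <= 3 / 4 ->
  pos_semidef (map_mx s gram_over).
Proof.
move=> hX v; rewrite mxE sum_ord4 !mxE !sum_ord4 !mxE /=.
rewrite ?rmorphN ?rmorph0 ?rmorph1 ?fmorphV ?rmorph_nat /ly.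
rewrite rmorphD fmorphV rmorphM rmorphB rmorph1 rmorph_nat.
move: (s lx) (v 0 0) (v 1 0) (v 2%:R 0) (v 3%:R 0) hX => X v0 v1 v2 v3 hX.
have X1 : 0 < 1 - X ^+ 2 by lra.
have X1n := lt0r_neq0 X1.
have Xn : X - 1 != 0 by apply: contraTneq X1 => /eqP; rewrite subr_eq0 => /eqP ->; rewrite expr1n subrr ltxx.
set Q := (X in 0 <= X).
(* Completing squares in [v0] and then [v2] leaves a form in [v1] and [v3]; the relation between the
   two parameters makes it degenerate, a multiple of [(v1 - v3) ^+ 2]. *)
have -> : Q = (v0 - X * v2 - v3 / 2) ^+ 2
   + (1 - X ^+ 2) * (v2 - (v1 + X * v3) / (2 * (1 - X ^+ 2))) ^+ 2
   + (3 - 4 * X ^+ 2) / (4 * (1 - X ^+ 2)) * (v1 - v3) ^+ 2.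
  by rewrite /Q; field; rewrite Xn X1n.
rewrite !addr_ge0 ?sqr_ge0 // mulr_ge0 ?sqr_ge0 //; first exact: ltW.
by rewrite divr_ge0 // ?mulr_ge0 // ?(ltW X1) //; lra.
Qed.

Lemma quad_quasi_arithmetic : totally_real R k ->
  quasi_arithmetic_polygon (quad_normals a b c d).
Proof.
move=> hreal; exists k, iota, gram_over.
have gS := @generated_subfield_closed R.
split=> //.
- apply: (generated_subfield_eq hgen).
    by move=> _ [i [j ->]]; rewrite gram_over_map mxE; exists (gram_over i j).
  have hx : gram_field (quad_normals a b c d) (- iota lx).
    move=> G [_ hG]; apply: hG; exists 0, 2%:R.
    by rewrite gram_over_map !mxE /= rmorphN.
  have := subfield_horner 'X^2 (gS _) hx.
  by rewrite map_polyXn hornerXn sqrrN -rmorphXn.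
- exact: gram_over_map.
- move=> s hns; apply: gram_over_psd; apply: hs.
  apply: contrapT => h; apply: hns => z _; apply: contrapT => hz; apply: h; by exists z.
Qed.

End QuasiArithmetic.

(** * Traces of the adjoint representation *)

Section AdjointTrace.
Variable R : realType.
Local Notation V := 'cV[R]_3.
Implicit Types (g X Y : 'M[R]_3) (u v w : V).

Lemma sum_ord3 (M : nmodType) (f : 'I_3 -> M) : \sum_i f i = f 0 + f 1 + f 2%:R.
Proof.
rewrite !big_ord_recl big_ord0 addr0 !addrA.
by congr (f _ + f _ + f _); exact/val_inj.
Qed.

Lemma mat3P X Y : (forall i j : 'I_3, i \in [:: 0; 1; 2%:R] -> j \in [:: 0; 1; 2%:R] -> X i j = Y i j) ->
  X = Y.
Proof.
have all3 (i : 'I_3) : i \in [:: 0; 1; 2%:R].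
  by case: i => [[|[|[|//]]]] Hi; rewrite !inE -!val_eqE.
by move=> h; apply/matrixP => i j; apply: h.
Qed.

(** The trace of [g] on the exterior square, to which the adjoint representation of the orthogonal
    group is isomorphic. *)
Definition minor_sum g :=
  (g 0 0 * g 1 1 - g 0 1 * g 1 0) + (g 0 0 * g 2%:R 2%:R - g 0 2%:R * g 2%:R 0)
  + (g 1 1 * g 2%:R 2%:R - g 1 2%:R * g 2%:R 1).

(** Allows [minor_sum] to be computed in any basis, in particular in the normals instead of the
    standard coordinates. *)
Lemma det3_minor_sum g u v w : det3 (g *m u) (g *m v) w + det3 (g *m u) v (g *m w) +
  det3 u (g *m v) (g *m w) = minor_sum g * det3 u v w.
Proof.
have h i z : (g *m z) i 0 = g i 0 * z 0 0 + g i 1 * z 1 0 + g i 2%:R * z 2%:R 0.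
  by rewrite mxE sum_ord3.
by rewrite /det3 !h /minor_sum; ring.
Qed.

(** The trace does not depend on the basis; the [phi j] are the coordinates with respect to the
    [E j]. *)
Lemma vbasis_trace (W : vectType R) (U : {vspace W}) (T : {linear W -> W}) (n : nat)
    (E : 'I_n -> W) (phi : 'I_n -> {linear W -> R^o}) :
  (forall j, E j \in U) -> (forall z, z \in U -> z = \sum_j phi j z *: E j) ->
  (forall z, z \in U -> T z \in U) ->
  \sum_(i < \dim U) coord (vbasis U) i (T (vbasis U)`_i) = \sum_j phi j (T (E j)).
Proof.
move=> hE hphi hT.
have e i : coord (vbasis U) i (T (vbasis U)`_i) =
    \sum_j phi j (vbasis U)`_i * coord (vbasis U) i (T (E j)).
  have hb : (vbasis U)`_i \in U by rewrite vbasis_mem // mem_nth // size_tuple.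
  rewrite {1}(hphi _ hb) linear_sum linear_sum; apply: eq_bigr => j _.
  by rewrite linearZ linearZ.
rewrite (eq_bigr _ (fun i _ => e i)) exchange_big /=; apply: eq_bigr => j _.
rewrite [in RHS](coord_vbasis (hT _ (hE j))) linear_sum; apply: eq_bigr => i _.
by rewrite linearZ /= mulrC.
Qed.

Lemma so_algebra_Ad g X : isom_group g -> X \in so_algebra R -> Ad g X \in so_algebra R.
Proof.
move=> hg; rewrite !mem_so_algebra /Ad => /eqP hX; have [gu ge] := isom_inv hg.
have hV := isom_tr (isomV hg); have hJ := isom_tr hg.
have e1 : g^T *m lorentz_form R = lorentz_form R *m g^-1.
  by rewrite -[in RHS]hJ -[RHS]mulmxA -[g *m g^-1]/(g * g^-1) divrr // mulmx1.
have e2 : lorentz_form R *m g = (g^-1)^T *m lorentz_form R.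
  by rewrite -{1}hV -!mulmxA -[g^-1 *m g]/(g^-1 * g) mulVr // mulmx1.
apply/eqP; rewrite -[g * X * g^-1]/(g *m X *m g^-1) !trmx_mul -!mulmxA e1 (mulmxA _ g) e2.
have -> : (g^-1)^T *m (X^T *m (lorentz_form R *m g^-1)) + (g^-1)^T *m lorentz_form R *m (X *m g^-1)
   = (g^-1)^T *m (X^T *m lorentz_form R + lorentz_form R *m X) *m g^-1.
  by rewrite mulmxDr mulmxDl !mulmxA.
by rewrite hX mulmx0 mul0mx.
Qed.

Fact Ad_linear g : linear (Ad g).
Proof. by move=> s X Y; rewrite /Ad mulrDr mulrDl -scalerAr -scalerAl. Qed.
HB.instance Definition _ g := GRing.isLinear.Build R 'M[R]_3 'M[R]_3 _ (Ad g) (Ad_linear g).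

Definition so_basis (j : 'I_3) : 'M[R]_3 := nth 0
  [:: delta_mx 0 1 + delta_mx 1 0; delta_mx 0 2%:R + delta_mx 2%:R 0;
      delta_mx 1 2%:R - delta_mx 2%:R 1] j.

Definition so_coord (j : 'I_3) (X : 'M[R]_3) : R^o := nth 0 [:: X 0 1; X 0 2%:R; X 1 2%:R] j.

Fact so_coord_linear j : linear (so_coord j).
Proof.
move=> s X Y; case: j => [[|[|[|//]]]] Hj; by rewrite /so_coord /= !mxE.
Qed.
HB.instance Definition _ j := GRing.isLinear.Build R 'M[R]_3 R^o _ (so_coord j) (so_coord_linear j).

Lemma so_mapE X : so_map X = \matrix_(i, j) ((if j == 0 then -1 else 1) * X j i +
  (if i == 0 then -1 else 1) * X i j).
Proof.
by apply/matrixP => i j; rewrite /so_map /lorentz_form mul_mx_diag mul_diag_mx !mxE mulrC.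
Qed.

Lemma so_basis_mem j : so_basis j \in so_algebra R.
Proof.
rewrite mem_so_algebra -[_ + _]/(so_map _) so_mapE; apply/eqP; apply: mat3P => i1 i2.
rewrite !inE => /or3P[] /eqP -> /or3P[] /eqP ->; case: j => [[|[|[|//]]]] Hj; rewrite !mxE /=; ring.
Qed.

Lemma so_basis_span X : X \in so_algebra R -> X = \sum_j so_coord j X *: so_basis j.
Proof.
rewrite mem_so_algebra -[_ + _]/(so_map _) so_mapE => /eqP/matrixP h.
have h00 := h 0 0; have h11 := h 1 1; have h22 := h 2%:R 2%:R.
have h01 := h 0 1; have h02 := h 0 2%:R; have h12 := h 1 2%:R.
rewrite !mxE /= in h00 h11 h22 h01 h02 h12.
rewrite sum_ord3 /so_coord /so_basis /=.
apply: mat3P => i1 i2; rewrite !inE => /or3P[] /eqP -> /or3P[] /eqP ->; rewrite !mxE /=; lra.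
Qed.

Theorem trace_Ad_isom g : isom_group g -> trace_Ad g = minor_sum g.
Proof.
move=> hg; rewrite /trace_Ad.
rewrite (@vbasis_trace _ _ (Ad g) _ so_basis (fun j => so_coord j)); last 3 first.
- exact: so_basis_mem.
- exact: so_basis_span.
- by move=> X; apply: so_algebra_Ad.
have [_ ge] := isom_inv hg.
have hE i j : g^-1 i j = (if i == 0 then -1 else 1) * (if j == 0 then -1 else 1) * g j i.
  by rewrite ge /lorentz_form mul_mx_diag mul_diag_mx !mxE mulrAC.
have mE X Y i j : (X * Y) i j = X i 0 * Y 0 j + X i 1 * Y 1 j + X i 2%:R * Y 2%:R j.
  by rewrite mxE sum_ord3.
rewrite sum_ord3 /= /so_coord /so_basis /Ad /= !mE !hE !mxE /= /minor_sum; ring.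
Qed.

(** The eigenvalues of the translation are 1 and an inverse pair with sum [4 * x ^+ 2 - 2], so their
    second symmetric function is one more than this sum. *)
Lemma minor_sum_reflections (a b c d : V) (x y : R) : quad_gram a b c d x y ->
  minor_sum (reflection a * reflection c) = 4 * x ^+ 2 - 1.
Proof.
move=> hq; have [[haa hbb hcc hdd] [hab hbc hcd hda] [hac hbd] _] := hq.
apply: (mulIf (det3_abc hq)); rewrite -det3_minor_sum -![_ * reflection c]/(_ *m reflection c) -!mulmxA.
have -> : reflection a *m (reflection c *m a) = (4 * x ^+ 2 - 1) *: a + (2 * x) *: c.
  rewrite !reflectionE !lorentz_lin haa hac (lorentzC c a) hac; apply: vec3P; rewrite !mxE; ring.
have -> : reflection a *m (reflection c *m b) = b + c + (2 * x) *: a.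
  rewrite !reflectionE !lorentz_lin hab hac (lorentzC c b) hbc; apply: vec3P; rewrite !mxE; by field.
have -> : reflection a *m (reflection c *m c) = - c - (2 * x) *: a.
  rewrite !reflectionE !lorentz_lin hac hcc; apply: vec3P; rewrite !mxE; ring.
by rewrite /det3 !mxE; ring.
Qed.

End AdjointTrace.

(** * The field of definition *)

Section FieldOfDefinition.
Variables (R : realType) (k : fieldExtType rat) (iota : {rmorphism k -> R}).
Local Notation V := 'cV[R]_3.

Theorem quad_field_of_definition (a b c d : V) (lx ly : k) :
  quad_gram a b c d (iota lx) (iota ly) -> <<1; lx ^+ 2>>%VS = fullv ->
  field_of_definition (polygon_group (quad_normals a b c d)) = range iota.
Proof.
move=> hq hgen; have hu := quad_normals_unit hq.
have hx : krational iota (iota lx) by exact: krational_iota.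
have hy : krational iota (iota ly) by exact: krational_iota.
apply: (generated_subfield_eq hgen).
  move=> _ [g /(polygon_groupP hu)[w ->] <-].
  rewrite trace_Ad_isom; last exact: ev_isom.
  set A := ev _ w.
  have hA u : krational_vec iota a b c u -> krational_vec iota a b c (A *m u).
    exact: (krational_ev hq hx hy).
  (* In standard coordinates the entries of [A] need not lie in the field, whereas quotients of
     determinants of rational vectors do. *)
  have -> : minor_sum A = (det3 (A *m a) (A *m b) c + det3 (A *m a) b (A *m c) +
      det3 a (A *m b) (A *m c)) / det3 a b c.
    by rewrite det3_minor_sum mulfK // (det3_abc hq).
  have va := krational_veca iota a b c; have vb := krational_vecb iota a b c.
  have vc := krational_vecc iota a b c.
  have [l ->] : krational iota ((det3 (A *m a) (A *m b) c + det3 (A *m a) b (A *m c) +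
      det3 a (A *m b) (A *m c)) / det3 a b c).
    rewrite 2!mulrDl; apply: krationalD; first apply: krationalD;
      by apply: (krational_det3 hq) => //; apply: hA.
  by exists l.
have key : generated_subfield [set trace_Ad g | g in polygon_group (quad_normals a b c d)]
    (4 * iota lx ^+ 2 - 1).
  move=> G [_ hG]; apply: hG; exists (reflection a * reflection c).
    apply/(polygon_groupP hu); exists [:: 0; 2%:R].
    by rewrite ev_cons ev_seq1.
  rewrite trace_Ad_isom; first exact: minor_sum_reflections hq.
  by have [[haa _ hcc _] _ _ _] := hq; apply: isomM; apply: reflection_isom.
have := subfield_horner (4^-1 *: ('X + 1)) (@generated_subfield_closed R _) key.
rewrite map_polyZ rmorphD /= map_polyX rmorph1 hornerZ hornerD hornerX hornerC subrK.
by rewrite fmorphV rmorph_nat mulKf ?pnatr_eq0 // rmorphXn.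
Qed.

End FieldOfDefinition.

(** * Infinitely many conjugacy classes *)

Section Realization.
Variables (R : realType) (k : fieldExtType rat) (iota : {rmorphism k -> R}).
Local Notation V := 'cV[R]_3.
Local Notation F := (angle_cosines iota).

Definition realizes (x : R) (Gam : set 'M[R]_3) := exists a b c d v : V,
  [/\ quad_gram a b c d x (1 + (4 * (x - 1))^-1), interior_point a b c d v,
      compact_cone a b c d, generic_param iota F x /\ generic_param iota F (1 + (4 * (x - 1))^-1) &
      Gam = polygon_group (quad_normals a b c d)].

Lemma realizes_conj x Gam g : isom_group g -> realizes x Gam -> realizes x [set g * h * g^-1 | h in Gam].
Proof.
move=> hg [a [b [c [d [v [hq hv hc hgen ->]]]]]].
exists (g *m a), (g *m b), (g *m c), (g *m d), (g *m v); split=> //.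
- exact: quad_gram_image.
- exact: interior_point_image.
- exact: compact_cone_image.
- by rewrite (polygon_group_image hg hq).
Qed.

(** The alternative [x = y'] of [quad_unique] is impossible, since [x' < 3 / 2] makes [y'] larger
    than 3/2. *)
Lemma realizes_inj x x' Gam : realizes x Gam -> realizes x' Gam -> x < 3 / 2 -> x' < 3 / 2 -> x = x'.
Proof.
move=> [a [b [c [d [v [hq hv hc [gx gy] eG]]]]]] [a' [b' [c' [d' [v' [hq' hv' hc' [gx' gy'] eG']]]]]].
move=> hx hx'; have eGG := etrans (esym eG) eG'.
have [//|e] := quad_unique hq hv hc gx gy hq' hv' hc' gx' gy' eGG.
have [_ _ _ [x1 _ _]] := hq'.
have : 2^-1 < (4 * (x' - 1))^-1.
  by rewrite ltf_pV2 ?posrE // ?mulr_gt0 // ?subr_gt0 //; lra.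
lra.
Qed.

Lemma conjugacy_class_refl (Gam : set 'M[R]_3) : conjugacy_class Gam Gam.
Proof.
exists 1; first exact: isom1.
by apply/seteqP; split=> [_ [h hh <-]|h hh]; [|exists h]; rewrite // mul1r invr1 mulr1.
Qed.

Lemma realizes_class_inj x x' Gam Gam' : realizes x Gam -> realizes x' Gam' ->
  x < 3 / 2 -> x' < 3 / 2 -> conjugacy_class Gam = conjugacy_class Gam' -> x = x'.
Proof.
move=> h h' hx hx' e; have := conjugacy_class_refl Gam; rewrite e => -[g hg eG].
by apply: (realizes_inj h) => //; rewrite -eG; apply: realizes_conj.
Qed.

End Realization.

Theorem mainTheorem3 (R : realType) (d : nat) (hd : (1 <= d)%N)
    (k : fieldExtType rat) (hk : \dim {: k} = d) (hreal : totally_real R k)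
    (iota : {rmorphism k -> R}) :
  infinite_set
    [set conjugacy_class Gam | Gam in
      [set Gam : set 'M[R]_3 |
        [/\ quasi_arithmetic_reflection_group Gam,
            maximal_reflection_group Gam &
            field_of_definition Gam = range iota]]].
Proof.
set good := (X in image X _).
have hS := infinite_admissible_params (iota := iota) (finite_angle_cosines iota).
set S := admissible_params _ _ in hS.
have /choice[f hf] (x : R) : exists Gam, S x -> realizes iota x Gam /\ good Gam.
  (* Outside [S] nothing is claimed, and [setT] is an arbitrary value. *)
  have [[lx [ex /andP[x1 x32] hs hgen [gx gy]]]|nS] := pselect (S x); last by exists setT.
  have [a [b [c [e [v [hq hv hn]]]]]] := quad_exists x1 x32.
  have hc := narrow_compact hn; exists (polygon_group (quad_normals a b c e)) => _.
  have hq' : quad_gram a b c e (iota lx) (iota (1 + (4 * (lx - 1))^-1)).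
    by rewrite rmorphD fmorphV rmorphM rmorphB rmorph1 rmorph_nat -ex.
  split; first by exists a, b, c, e, v.
  split.
  - exists 4%N, (quad_normals a b c e); split=> //.
    + exact: quad_coxeter hq hv.
    + by have [C hC] := narrow_bounded hn; exact: finite_area hC.
    + exact: quad_quasi_arithmetic hq' hgen hs hreal.
  - exact: quad_maximal hq hv hc gx gy.
  - exact: quad_field_of_definition hq' hgen.
move=> hfin; apply: hS.
have inj : {in S &, injective (fun x => conjugacy_class (f x))}.
  move=> x x'; rewrite !inE => Sx Sx'.
  have [rx _] := hf _ Sx; have [rx' _] := hf _ Sx'.
  case: Sx Sx' => [lx [_ /andP[_ h] _ _ _]] [lx' [_ /andP[_ h'] _ _ _]].
  exact: realizes_class_inj rx rx' h h'.
rewrite -(eq_finite_set (inj_card_eq inj)).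
by apply: sub_finite_set hfin => _ [x Sx <-]; exists (f x) => //; have [] := hf _ Sx.
Qed.
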